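(* Let $n\ge p$, let $f\in\mathcal{E}_{[r+1]}(n,p)$, let $J$ be a bounded open interval containing $[0,1]$, let $g\in\mathcal{E}_{[r+1]}(n,p)$ be arbitrary with $j^rg(0)=j^rf(0)$, and define $F:(\mathbb{R}^n\times J,\{0\}\times J)\to(\mathbb{R}^p,0)$ by $F(x,t):=f(x)+t(g(x)-f(x))$. If, for any polynomial map $h$ of degree $r+1$ such that $j^rh(0)=j^rf(0)$, there are positive numbers $C,\alpha,\overline{w},\delta>0$ (depending on $h$) such that $$\kappa(\operatorname{grad} f_1(x),\ldots,\operatorname{grad} f_p(x))\ge C|x|^{r-\delta}\quad\text{in }\ \mathcal{H}_{r+1}(h;\overline{w})\cap\{|x|<\alpha\},$$ then the stratification $\Sigma(\mathbb{R}^n\times J)$ of $\mathbb{R}^n\times J$ around $\{0\}\times J$ is $(c)$-regular.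
   Context: $\mathcal{E}_{[s]}(n,p)$, $n\ge p$, is the set of $C^s$ map-germs $(\mathbb{R}^n,0)\to(\mathbb{R}^p,0)$; $j^rf(0)$ is the $r$-jet of $f$ at $0$; $f_1,\ldots,f_p$ are the components of $f$. Horn-neighbourhood of $h^{-1}(0)$ of degree $s$ and width $\overline{w}$: $\mathcal{H}_s(h;\overline{w}):=\{x\in\mathbb{R}^n: |h(x)|\le\overline{w}|x|^s\}$. Kuo distance of vectors $v_1,\ldots,v_p\in\mathbb{R}^n$ ($n\ge p$): $\kappa(v_1,\ldots,v_p)=\min_i\{\text{distance of } v_i \text{ to } V_i\}$, where $V_i$ is the span of the $v_j$, $j\ne i$; for $p=1$, $\kappa(v)=\|v\|$. The stratification $\Sigma(\mathbb{R}^n\times J)$ (considered around $\{0\}\times J$, i.e. in a small neighbourhood of it): if $F^{-1}(0)\ne\{0\}\times J$ as set-germs at $\{0\}\times J$, $$\Sigma(\mathbb{R}^n\times J):=\{\mathbb{R}^n\times J\setminus F^{-1}(0),\ F^{-1}(0)\setminus\{0\}\times J,\ \{0\}\times J\};$$ if $F^{-1}(0)=\{0\}\times J$ as set-germs at $\{0\}\times J$, $$\Sigma(\mathbb{R}^n\times J):=\{\mathbb{R}^n\times J\setminus\{0\}\times J,\ \{0\}\times J\}.$$ Under the hypothesis on $f$ in the theorem, $F^{-1}(0)\setminus\{0\}\times J$ is smooth (a submanifold, of class $C^{r+1}$) around $\{0\}\times J$ if it is not empty, of dimension $n+1-p$. $(c)$-regularity of a pair: let $X,Y$ be submanifolds of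 a Riemannian manifold $M$ (here $\mathbb{R}^n\times J$ with the Euclidean metric) with $Y\subset\overline{X}$, and let $(T_Y,\pi,\rho)$ be a tubular neighbourhood for $Y$ with projection $\pi$ and non-negative control function $\rho$ such that $\rho^{-1}(0)=Y$ and $\operatorname{grad}\rho(x)\in\operatorname{Ker} d\pi(x)$. The pair $(X,Y)$ is $(c)$-regular at $y_0\in Y$ for the control function $\rho$ if for any sequence of points $\{x_i\}$ of $X$ tending to $y_0$ such that the planes $\operatorname{Ker} d\rho(x_i)\cap T_{x_i}X$ tend to some plane $\tau$ in the Grassmann space of $(\dim X-1)$-planes, one has $T_{y_0}Y\subset\tau$. It is $(c)$-regular for $\rho$ if this holds at every $y_0\in Y$. A stratification is $(c)$-regular if for each stratum $Y$ there is such a tubular neighbourhood with control function $\rho_Y$ such that, for every stratum $X\neq Y$ with $Y\subset\overline{X}$, the pair $(X,Y)$ is $(c)$-regular for $\rho_Y$. *)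

(* Defs.v *)
From HB Require Import structures.
From mathcomp Require Import all_boot all_order all_algebra.
From mathcomp Require Import all_classical all_reals all_analysis.
(* The notations of mpoly clash with those of mathcomp-analysis. *)
From mathcomp Require Import(canonicals, coercions) mpoly.

Set Implicit Arguments.
Unset Strict Implicit.
Unset Printing Implicit Defensive.

Import Order.TTheory GRing.Theory Num.Theory.
Import numFieldNormedType.Exports.

Local Open Scope classical_set_scope.
Local Open Scope ring_scope.

(* The library norm on 'rV[R]_N is the sup norm, which induces the usual
   topology; lengths and angles below use the Euclidean structure. *)
Definition edot (R : realType) (N : nat) (u v : 'rV[R]_N) : R :=
  \sum_(j < N) u 0 j * v 0 j.

Definition enorm (R : realType) (N : nat) (u : 'rV[R]_N) : R :=
  Num.sqrt (edot u u).

Definition grad (R : realType) (N : nat) (phi : 'rV[R]_N -> R^o)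
    (x : 'rV[R]_N) : 'rV[R]_N :=
  \row_j 'D_(delta_mx 0 j) phi x.

(* C^k maps on U; meant for open U. *)
Fixpoint Ck (R : realType) (V W : normedModType R) (k : nat) (U : set V)
    (f : V -> W) : Prop :=
  if k is k'.+1 then
    (forall x, U x -> differentiable f x) /\
    (forall v, Ck k' U (fun x => 'D_v f x))
  else forall x, U x -> {for x, continuous f}.

(* f represents a C^s map-germ (R^n, 0) -> (R^p, 0); its values far from 0 are
   irrelevant. *)
Definition map_germ (R : realType) (n p s : nat)
    (f : 'rV[R]_n -> 'rV[R]_p) : Prop :=
  f 0 = 0 /\ exists2 U, open_nbhs (0 : 'rV[R]_n) U & Ck s U f.

Definition partial (R : realType) (n p : nat) (js : seq 'I_n)
    (f : 'rV[R]_n -> 'rV[R]_p) : 'rV[R]_n -> 'rV[R]_p :=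
  foldr (fun j (h : 'rV[R]_n -> 'rV[R]_p) x => 'D_(delta_mx 0 j) h x) f js.

(* j^r f(0) = j^r g(0) *)
Definition same_jet0 (R : realType) (n p r : nat)
    (f g : 'rV[R]_n -> 'rV[R]_p) : Prop :=
  forall js : seq 'I_n, (size js <= r)%N -> partial js f 0 = partial js g 0.

(* [mpoly.msize q <= d.+1] says that q has degree at most d. *)
Definition poly_map (R : realType) (n p : nat)
    (q : 'I_p -> mpoly.mpoly n R) (x : 'rV[R]_n) : 'rV[R]_p :=
  \row_i mpoly.meval (fun j => x 0 j) (q i).

Definition horn (R : realType) (n p s : nat) (h : 'rV[R]_n -> 'rV[R]_p)
    (w : R) : set 'rV[R]_n :=
  [set x | enorm (h x) <= w * enorm x ^+ s].

Definition edist (R : realType) (N : nat) (v : 'rV[R]_N)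
    (E : {vspace 'rV[R]_N}) : R :=
  inf [set enorm (v - w) | w in [set w | w \in E]].

(* The infimum over i is a minimum as soon as 0 < p; for p = 1 the span of the
   empty family is 0 and the value is the norm of the vector. *)
Definition kuo_dist (R : realType) (n p : nat) (v : 'I_p -> 'rV[R]_n) : R :=
  inf (range (fun i : 'I_p =>
    edist (v i) (\sum_(j < p | j != i) <[v j]>)%VS)).

(* X is a C^k submanifold of dimension d of R^N (k >= 1): locally the zero set
   of a C^k submersion to R^c, with d + c = N. *)
Definition submanifold (R : realType) (N k d : nat) (X : set 'rV[R]_N) :
    Prop :=
  exists2 c : nat, (d + c = N)%N &
  forall x, X x -> exists (W : set 'rV[R]_N) (Phi : 'rV[R]_N -> 'rV[R]_c),
    [/\ open_nbhs x W, Ck k W Phi,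
        (forall z, W z -> \rank (jacobian Phi z) = c)
      & X `&` W = [set z | Phi z = 0] `&` W].

Definition tangent_vector (R : realType) (N : nat) (X : set 'rV[R]_N)
    (x v : 'rV[R]_N) : Prop :=
  exists gamma : R^o -> 'rV[R]_N,
    [/\ gamma 0 = x, \forall t \near (0 : R^o), X (gamma t)
      & is_derive (0 : R^o) (1 : R^o) gamma v].

(* The tangent vectors form a subspace at each point of a C^1 submanifold;
   elsewhere the default value 0 may be returned. *)
Definition tangent_space (R : realType) (N : nat) (X : set 'rV[R]_N)
    (x : 'rV[R]_N) : {vspace 'rV[R]_N} :=
  xget 0%VS [set E : {vspace 'rV[R]_N} |
    forall v, v \in E <-> tangent_vector X x v].

Definition normal_bundle (R : realType) (N : nat) (Y : set 'rV[R]_N) :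
    set ('rV[R]_N * 'rV[R]_N) :=
  [set w | Y w.1 /\ forall v, v \in tangent_space Y w.1 -> edot w.2 v = 0].

(* T is a tubular neighbourhood, of class C^k, of Y in the open set M, with
   projection pi: z |-> (pi z, psi z) is a diffeomorphism of T onto an open
   neighbourhood (cut out by Z) of the zero section of the normal bundle of Y,
   which is the identity on Y; phi is an ambient extension of its inverse. *)
Definition tubular_nbhd (R : realType) (N k : nat) (M Y T : set 'rV[R]_N)
    (pi : 'rV[R]_N -> 'rV[R]_N) : Prop :=
  [/\ open T, Y `<=` T, T `<=` M, Ck k T pi &
   exists (psi : 'rV[R]_N -> 'rV[R]_N)
          (phi : 'rV[R]_N * 'rV[R]_N -> 'rV[R]_N)
          (Z : set ('rV[R]_N * 'rV[R]_N)),
   [/\ open Z, Ck k T psi, Ck k Z phi,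
       forall y, Y y -> Z (y, 0) /\ phi (y, 0) = y &
       (forall z, T z ->
          [/\ normal_bundle Y (pi z, psi z), Z (pi z, psi z)
            & phi (pi z, psi z) = z]) /\
       (forall w, normal_bundle Y w -> Z w ->
          T (phi w) /\ (pi (phi w), psi (phi w)) = w)]].

Definition control_function (R : realType) (N k : nat) (Y T : set 'rV[R]_N)
    (pi : 'rV[R]_N -> 'rV[R]_N) (rho : 'rV[R]_N -> R^o) : Prop :=
  [/\ Ck k T rho, (forall z, T z -> 0 <= rho z),
      T `&` [set z | rho z = 0] = Y
    & forall z, T z -> 'd pi z (grad rho z) = 0].

Definition gap (R : realType) (N : nat) (P Q : {vspace 'rV[R]_N}) : R :=
  sup [set edist v Q | v in [set v | v \in P /\ enorm v = 1]].

(* Between subspaces of the same dimension, gap is the usual metric of the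
   Grassmannian. *)
Definition grassmann_cvg (R : realType) (N d : nat)
    (P : nat -> {vspace 'rV[R]_N}) (Q : {vspace 'rV[R]_N}) : Prop :=
  [/\ forall i, \dim (P i) = d, \dim Q = d
    & (gap (P i) Q : R^o) @[i --> \oo] --> (0 : R^o)].

Definition c_regular_at (R : realType) (N dX : nat) (X Y T : set 'rV[R]_N)
    (rho : 'rV[R]_N -> R^o) (y0 : 'rV[R]_N) : Prop :=
  forall (x : nat -> 'rV[R]_N) (tau : {vspace 'rV[R]_N}),
    (forall i, (X `&` T) (x i)) ->
    x i @[i --> \oo] --> y0 ->
    grassmann_cvg dX.-1
      (fun i => (lker (linfun ('d rho (x i))) :&: tangent_space X (x i))%VS)
      tau ->
    (tangent_space Y y0 <= tau)%VS.

Definition stratification (R : realType) (N k : nat) (M : set 'rV[R]_N)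
    (S : set (set 'rV[R]_N)) : Prop :=
  [/\ trivIset S id, \bigcup_(X in S) X = M
    & forall X, S X -> exists d, submanifold k d X].

(* Regularity classes: the normal bundle of a C^(k+1) submanifold, hence its
   tubular neighbourhoods, are only C^k in general, whereas the squared
   distance to it is C^(k+1). *)
Definition c_regular_stratification (R : realType) (N k : nat)
    (M : set 'rV[R]_N) (S : set (set 'rV[R]_N)) : Prop :=
  stratification k.+1 M S /\
  forall Y, S Y -> exists T pi rho,
    [/\ tubular_nbhd k M Y T pi, control_function k.+1 Y T pi rho
      & forall X dX, S X -> X <> Y -> Y `<=` closure X ->
          submanifold k.+1 dX X ->
          forall y0, Y y0 -> c_regular_at dX X Y T rho y0].

(* R^n x R is 'rV[R]_(n + 1), with (x, t) encoded as row_mx x t%:M. *)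
Definition xpart (R : realType) (n : nat) (z : 'rV[R]_(n + 1)) : 'rV[R]_n :=
  lsubmx z.

Definition tpart (R : realType) (n : nat) (z : 'rV[R]_(n + 1)) : R :=
  rsubmx z 0 0.

Definition deformation (R : realType) (n p : nat)
    (f g : 'rV[R]_n -> 'rV[R]_p) (z : 'rV[R]_(n + 1)) : 'rV[R]_p :=
  f (xpart z) + tpart z *: (g (xpart z) - f (xpart z)).

Definition cylinder (R : realType) (n : nat) (J : set R) :
    set 'rV[R]_(n + 1) :=
  [set z | J (tpart z)].

Definition axis (R : realType) (n : nat) (J : set R) : set 'rV[R]_(n + 1) :=
  [set z | xpart z = 0 /\ J (tpart z)].

Definition nbhd_of_axis (R : realType) (n : nat) (J : set R)
    (U : set 'rV[R]_(n + 1)) : Prop :=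
  [/\ open U, axis J `<=` U & U `<=` cylinder J].

(* F^{-1}(0) = {0} x J as set-germs at {0} x J *)
Definition zero_germ_is_axis (R : realType) (n p : nat) (J : set R)
    (F : 'rV[R]_(n + 1) -> 'rV[R]_p) : Prop :=
  exists2 V, nbhd_of_axis J V & [set z | F z = 0] `&` V = axis J `&` V.

(* The strata of Sigma(R^n x J) inside the neighbourhood U of {0} x J. *)
Definition Sigma (R : realType) (n p : nat) (J : set R)
    (F : 'rV[R]_(n + 1) -> 'rV[R]_p) (U : set 'rV[R]_(n + 1)) :
    set (set 'rV[R]_(n + 1)) :=
  if `[< zero_germ_is_axis J F >] then
    [set U `\` axis J; axis J]
  else
    [set U `\` [set z | F z = 0];
         (U `&` [set z | F z = 0]) `\` axis J;
         axis J].

(* Main.v *)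
(* Near (0, t0) the zeros of F = f + t (g - f) lie over the horn of the Taylor
   polynomial h of degree r+1 of f + t0 (g - f), where the hypothesis bounds
   |a dh(x)| below by a large multiple of |a| |x|^r. On this horn a dh(x) is
   almost orthogonal to x. Otherwise one could follow a semialgebraic family of
   points x = s y with |y| = 1 and h(x) = s^(r+1) u, from the parameter s to
   s + s^(r+1), so slowly that (y, u) changes by o(s^r): a bounded semialgebraic
   function of s does not drift faster. Then h changes by O(s^(2r+1)) while x
   moves essentially radially by s^(r+1), which is incompatible with an angle
   between a dh(x) and x bounded away from a right angle.
   Hence a (g - f)(x) is negligible with respect to a d_xF + b x for all a, b,
   and this says that the kernel planes of d|x|^2 on F = 0 become parallel to the
   axis. Away from the axis F = 0 is regular; it has a tubular neighbourhood
   given by nearest-point projection, C^r by the inverse function theorem, and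
   for the squared distance every open stratum is (c)-regular over it. For r = 0
   the hypothesis is contradictory. *)

Require Import Defs.
From HB Require Import structures.
From mathcomp Require Import all_boot all_order all_algebra.
From mathcomp Require Import all_classical all_reals all_analysis.
From mathcomp Require Import(canonicals, coercions) mpoly.
From mathcomp Require Import ring lra.
From mathcomp Require ordered_qelim qe_rcf.

Set Implicit Arguments.
Unset Strict Implicit.
Unset Printing Implicit Defensive.

Import Order.TTheory GRing.Theory Num.Theory.
Import numFieldNormedType.Exports.

Local Open Scope classical_set_scope.
Local Open Scope ring_scope.

(* The name is also that of the extended distance of mathcomp-analysis. *)
Local Notation edist := Defs.edist.

(** * Semialgebraic selection *)

(** The step s^(r+1) is dictated by the size of the covectors. Normalise |a dh(x)| = 1; the
    hypothesis then gives |a| = o(s^-r). When x = s y moves by s^(r+1) while (y, u) drifts by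
    O(s^r), the change of a h is |a| O(s^(2r+1)) = o(s^(r+1)), Taylor remainder included, and a
    drift o(s^r) of y moves x sideways by o(s^(r+1)) only. An oblique a dh(x) would make this change
    of exact order s^(r+1). No curve selection or Puiseux expansion is involved. Definable
    conditions on one parameter are eventually constant near 0, and this already yields pairs of
    points at the parameters s and s + s^(r+1). The polynomial h, hence the width of its horn,
    depends on t0. The estimates are therefore local near one point (0, t0), where zeros with t
    close to t0 still lie in the horn; this suffices because (c)-regularity is a pointwise condition
    along the axis. Local inverses from the inverse function theorem have no reason to agree on
    overlaps. Nearest points are canonical, so they glue to a global projection. *)

Module ord := ordered_qelim.ord.

Section Semialgebraic.
Variable R : realType.
Implicit Types (e : seq R) (k : nat).

(* On sequences of length k, P is a first-order condition over the ordered field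
   R, i.e. defines a semialgebraic subset of R^k. *)
Definition sadef k (P : seq R -> Prop) :=
  exists phi : ord.formula R, forall e, size e = k ->
    ord.holds e phi <-> P e.

(** Extensional, like [sadef]: the closure lemmas handle functions of [e] and never formulas. *)
Definition saterm k (u : seq R -> R) :=
  exists t : GRing.term R, forall e, size e = k -> GRing.eval e t = u e.

Lemma saterm_cst k (c : R) : saterm k (fun=> c).
Proof. by exists (GRing.Const c). Qed.

Lemma saterm_var k i : saterm k (fun e => e`_i).
Proof. by exists (GRing.Var R i). Qed.

Lemma satermD k u v : saterm k u -> saterm k v -> saterm k (fun e => u e + v e).
Proof. by move=> [t tE] [w wE]; exists (GRing.Add t w) => e ek /=; rewrite tE ?wE. Qed.

Lemma satermM k u v : saterm k u -> saterm k v -> saterm k (fun e => u e * v e).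
Proof. by move=> [t tE] [w wE]; exists (GRing.Mul t w) => e ek /=; rewrite tE ?wE. Qed.

Lemma satermX k u n : saterm k u -> saterm k (fun e => u e ^+ n).
Proof. by move=> [t tE]; exists (GRing.Exp t n) => e ek /=; rewrite tE. Qed.

Lemma saterm_sum k (I : Type) (s : seq I) (P : pred I) (u : I -> seq R -> R) :
  (forall i, saterm k (u i)) -> saterm k (fun e => \sum_(i <- s | P i) u i e).
Proof.
move=> uk; elim: s => [|i s [t tE]].
  by exists (GRing.Const 0) => e _; rewrite big_nil.
case Pi: (P i); last by exists t => e ek; rewrite big_cons Pi tE.
have [w wE] := satermD (uk i) (ex_intro _ t tE).
by exists w => e ek; rewrite big_cons Pi wE.
Qed.

Lemma eq_saterm k u v : u =1 v -> saterm k u -> saterm k v.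
Proof. by move=> /funext ->. Qed.

Lemma saterm_edot k m (u v : seq R -> 'rV[R]_m) : (forall j, saterm k (fun e => u e 0 j)) ->
  (forall j, saterm k (fun e => v e 0 j)) -> saterm k (fun e => edot (u e) (v e)).
Proof. by move=> uk vk; apply: saterm_sum => j; exact: satermM. Qed.

(** A term that represents [u] may mention variables of index at least [k]; they read 0 in an
    environment of length [k], but not in a longer one. Each step of the induction substitutes the
    constant 0 for the next such variable. *)
Lemma saterm_take k m u : saterm k u -> saterm (k + m) (fun e => u (take k e)).
Proof.
elim: m u => [|m IH] u uk.
  case: uk => t tE; exists t => e; rewrite addn0 => ek.
  by rewrite -ek take_size tE.
have [t tE] := IH u uk.
exists (GRing.tsubst t ((k + m)%N, GRing.Const 0)) => e ek.
have <- : take k (take (k + m) e) = take k e by rewrite take_takel ?leq_addr.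
have st : size (take (k + m) e) = (k + m)%N by rewrite size_takel// ek addnS.
rewrite -(tE _ st) GRing.eval_tsubst; apply: GRing.eq_eval => i.
rewrite nth_set_nth /=; case: eqP => [->|/eqP ikm].
  by rewrite [RHS]nth_default// st.
have [ilt|ige] := ltnP i (k + m)%N; first by rewrite nth_take.
rewrite !nth_default// ?st// ek addnS.
by rewrite ltn_neqAle eq_sym ikm.
Qed.

Lemma eq_sadef k P Q : (forall e, size e = k -> P e <-> Q e) ->
  sadef k P -> sadef k Q.
Proof.
by move=> PQ [phi phiE]; exists phi => e ek; rewrite phiE //; exact: PQ.
Qed.

Lemma sadef_le k u v : saterm k u -> saterm k v -> sadef k (fun e => u e <= v e).
Proof.
move=> [t tE] [w wE]; exists (ord.Le t w) => e ek /=.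
by rewrite tE ?wE.
Qed.

Lemma sadef_eq k u v : saterm k u -> saterm k v -> sadef k (fun e => u e = v e).
Proof.
move=> [t tE] [w wE]; exists (ord.Equal t w) => e ek /=.
by rewrite tE ?wE.
Qed.

Lemma sadef_and k P Q : sadef k P -> sadef k Q -> sadef k (fun e => P e /\ Q e).
Proof.
move=> [f fE] [g gE]; exists (ord.And f g) => e ek /=.
by rewrite fE ?gE.
Qed.

Lemma sadef_imp k P Q : sadef k P -> sadef k Q -> sadef k (fun e => P e -> Q e).
Proof.
move=> [f fE] [g gE]; exists (ord.Implies f g) => e ek /=.
by rewrite fE ?gE.
Qed.

Lemma sadef_not k P : sadef k P -> sadef k (fun e => ~ P e).
Proof.
by move=> [f fE]; exists (ord.Not f) => e ek /=; rewrite fE.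
Qed.

Lemma sadef_all k m (P : 'I_m -> seq R -> Prop) : (forall i, sadef k (P i)) ->
  sadef k (fun e => forall i, P i e).
Proof.
move=> Pk; suff H : forall s : seq 'I_m, sadef k (fun e => forall i, i \in s -> P i e).
  apply: eq_sadef (H (enum 'I_m)) => e _.
  by split=> Pe i; [apply: Pe; rewrite mem_enum|move=> _].
elim=> [|i s IH]; first by exists (ord.Bool true).
apply: eq_sadef (sadef_and (Pk i) IH) => e _; split=> [[Pi Ps] j|Pe].
  by rewrite inE => /orP[/eqP->//|]; exact: Ps.
by split=> [|j js]; apply: Pe; rewrite inE ?eqxx// js orbT.
Qed.

Lemma sadef_ex1 k (Q : seq R -> R -> Prop) :
  sadef k.+1 (fun e => Q (take k e) e`_k) -> sadef k (fun e => exists x, Q e x).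
Proof.
move=> [f fE]; exists (ord.Exists k f) => e ek /=.
have E x : ord.holds (set_nth 0 e k x) f <-> Q e x.
  have -> : set_nth 0 e k x = rcons e x.
    by rewrite -ek; elim: (e) => //= y s ->.
  rewrite fE ?size_rcons ?ek//.
  by rewrite -cats1 take_cat -ek ltnn subnn take0 cats0 nth_cat ltnn subnn.
by split=> -[x /E Qx]; exists x.
Qed.

(** One scalar quantifier per coordinate; coordinate [j] of the bound vector is read in variable
    [k + j]. *)
Lemma sadef_ex k m (Q : seq R -> 'rV[R]_m -> Prop) :
  sadef (k + m) (fun e => Q (take k e) (\row_j e`_(k + j))) ->
  sadef k (fun e => exists y, Q e y).
Proof.
elim: m k Q => [|m IH] k Q Qd.
  move: Qd; rewrite addn0 => Qd; apply: eq_sadef Qd => e ek.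
  rewrite -ek take_size; split=> [Qe|[y Qe]]; first by eexists; exact: Qe.
  by rewrite (_ : \row__ _ = y)//; apply/rowP => -[].
pose Q' (e : seq R) (x : R) (y : 'rV[R]_m) := Q e (row_mx x%:M y : 'rV[R]_(1 + m)).
have H : sadef k (fun e => exists x, exists y, Q' e x y).
  apply: (@sadef_ex1 _ (fun e x => exists y, Q' e x y)).
  apply: (IH _ (fun e y => Q' (take k e) e`_k y)).
  move: Qd; rewrite -addSnnS => Qd. apply: eq_sadef Qd => e ek; rewrite /Q'.
  rewrite take_takel// nth_take//.
  suff -> : \row_j e`_(k + j) =
    (row_mx (e`_k)%:M (\row_j e`_(k.+1 + j)) : 'rV[R]_(1 + m)) by [].
  apply/rowP => j; rewrite !mxE; case: splitP => j' jE.
    by rewrite !mxE jE !ord1 /= addn0 ?eqxx ?mulr1n.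
  by rewrite !mxE jE addSn addnS.
apply: eq_sadef H => e ek; split=> [[x [y Qe]]|[y Qe]]; first by eexists; exact: Qe.
exists ((y : 'rV[R]_(1 + m)) 0 0), (rsubmx (y : 'rV[R]_(1 + m))); rewrite /Q'.
suff -> : row_mx ((y : 'rV[R]_(1 + m)) 0 0)%:M (rsubmx (y : 'rV[R]_(1 + m))) = y by [].
rewrite -[RHS](@hsubmxK _ 1 1 m); congr row_mx.
by apply/rowP => i; rewrite !mxE !ord1 ?eqxx ?mulr1n; congr (y _ _); apply/val_inj.
Qed.

Lemma sadef_forall k m (Q : seq R -> 'rV[R]_m -> Prop) :
  sadef (k + m) (fun e => Q (take k e) (\row_j e`_(k + j))) ->
  sadef k (fun e => forall y, Q e y).
Proof.
move=> /sadef_not Qd.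
have /sadef_not := @sadef_ex k m (fun e y => ~ Q e y) Qd; apply: eq_sadef => e _.
split=> [nQ y|Qy [y]]; last exact.
by apply: contrapT => nQy; apply: nQ; exists y.
Qed.

Lemma rterm_poly (t : GRing.term R) : GRing.rterm t ->
  exists p : {poly R}, forall s, GRing.eval [:: s] t = p.[s].
Proof.
elim: t => //=.
(* Only variable 0 has a value in [[:: s]]; the others read the default value 0. *)
- move=> [|i] _; first by exists 'X => s; rewrite hornerX.
  by exists 0 => s; rewrite horner0 /= nth_nil.
- by move=> c _; exists c%:P => s; rewrite hornerC.
- by move=> n _; exists n%:R%:P => s; rewrite hornerC.
- move=> t IHt u IHu /andP[/IHt[p pE] /IHu[q qE]]; exists (p + q) => s.
  by rewrite hornerD pE qE.
- by move=> t IHt /IHt[p pE]; exists (- p) => s; rewrite hornerN pE.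
- by move=> t IHt n /IHt[p pE]; exists (p *+ n) => s; rewrite hornerMn pE.
- move=> t IHt u IHu /andP[/IHt[p pE] /IHu[q qE]]; exists (p * q) => s.
  by rewrite hornerM pE qE.
- by move=> t IHt n /IHt[p pE]; exists (p ^+ n) => s; rewrite horner_exp pE.
Qed.

Definition eventually0 (P : R -> Prop) :=
  exists2 s0, 0 < s0 & forall s, 0 < s -> s < s0 -> P s.

Lemma ev0_and P Q : eventually0 P -> eventually0 Q -> eventually0 (fun s => P s /\ Q s).
Proof.
move=> [a a0 Pa] [b b0 Qb]; exists (Num.min a b); first by rewrite lt_min a0.
by move=> s s0; rewrite lt_min => /andP[sa sb]; split; [exact: Pa|exact: Qb].
Qed.

Lemma ev0_impl P Q : (forall s, 0 < s -> P s -> Q s) -> eventually0 P -> eventually0 Q.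
Proof. by move=> PQ [a a0 Pa]; exists a => // s s0 sa; apply: PQ => //; exact: Pa. Qed.

Lemma ev0_lt (b : R) : 0 < b -> eventually0 (fun s => s < b).
Proof. by exists b. Qed.

(** A nonzero constant term decides the sign by continuity; otherwise a factor X, positive to the
    right of 0, is split off. *)
Lemma poly_ev0 (p : {poly R}) :
  [\/ eventually0 (fun s => p.[s] = 0), eventually0 (fun s => p.[s] < 0) |
      eventually0 (fun s => 0 < p.[s])].
Proof.
elim/poly_ind: p => [|q c IH].
  by constructor 1; exists 1 => // s _ _; rewrite horner0.
have [->|c0] := eqVneq c 0.
  case: IH => -[s0 s0_gt0 H]; [constructor 1|constructor 2|constructor 3];
    exists s0 => // s s_gt0 ss0; rewrite hornerMXaddC addr0; have := H s s_gt0 ss0.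
  - by move=> ->; rewrite mul0r.
  - by rewrite pmulr_llt0.
  - by rewrite pmulr_lgt0.
have := @continuous_horner R (q * 'X + c%:P) 0.
rewrite /continuous_at hornerMXaddC mulr0 add0r => cc.
have /cvgrPdist_lt/(_ `|c|) := cc; rewrite normr_gt0 => /(_ c0).
move=> /nbhs_ballP[d /= d0 H]; move: c0; rewrite neq_lt => /orP[c0|c0];
  [constructor 2|constructor 3]; exists d => // s s_gt0 sd; have := H s;
  rewrite /ball /= sub0r normrN (gtr0_norm s_gt0) ?(ltr0_norm c0) ?(gtr0_norm c0);
  by move=> /(_ sd); rewrite ltr_norml => /andP[]; lra.
Qed.

Lemma qf_ev0 (phi : ord.formula R) :
  ord.qf_form phi -> ord.rformula phi ->
  exists b, eventually0 (fun s => ord.qf_eval [:: s] phi = b).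
Proof.
have sub t1 t2 : GRing.rterm t1 && GRing.rterm t2 -> exists p : {poly R},
    forall s, p.[s] = GRing.eval [:: s] t1 - GRing.eval [:: s] t2.
  move=> /andP[/rterm_poly[p pE] /rterm_poly[q qE]]; exists (p - q) => s.
  by rewrite hornerD hornerN pE qE.
elim: phi => //=.
- by move=> b _ _; exists b, 1.
- move=> t1 t2 _ /sub[p pE].
  have [pev|pev|pev] := poly_ev0 p; [exists true|exists false|exists false];
    apply: ev0_impl pev => s _; rewrite pE => H.
  + by apply/eqP/subr0_eq.
  + by apply/negbTE; rewrite -subr_eq0 lt_eqF//.
  + by apply/negbTE; rewrite -subr_eq0 gt_eqF//.
- move=> t1 t2 _ /sub[p pE].
  have [pev|pev|pev] := poly_ev0 p; [exists false|exists true|exists false];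
    apply: ev0_impl pev => s _; rewrite pE => H.
  + by apply/negbTE; rewrite -leNgt; lra.
  + by rewrite -subr_lt0.
  + by apply/negbTE; rewrite -leNgt; lra.
- move=> t1 t2 _ /sub[p pE].
  have [pev|pev|pev] := poly_ev0 p; [exists true|exists true|exists false];
    apply: ev0_impl pev => s _; rewrite pE => H.
  + by lra.
  + by lra.
  + by apply/negbTE; rewrite -ltNge; lra.
- move=> f IHf g IHg /andP[/IHf {}IHf /IHg {}IHg] /andP[/IHf[b fb] /IHg[c gc]].
  by exists (b && c); apply: ev0_impl (ev0_and fb gc) => s _ [-> ->].
- move=> f IHf g IHg /andP[/IHf {}IHf /IHg {}IHg] /andP[/IHf[b fb] /IHg[c gc]].
  by exists (b || c); apply: ev0_impl (ev0_and fb gc) => s _ [-> ->].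
- move=> f IHf g IHg /andP[/IHf {}IHf /IHg {}IHg] /andP[/IHf[b fb] /IHg[c gc]].
  by exists (b ==> c); apply: ev0_impl (ev0_and fb gc) => s _ [-> ->].
- move=> f IHf /IHf {}IHf /IHf[b fb].
  by exists (~~ b); apply: ev0_impl fb => s _ ->.
Qed.

(** The fragment of o-minimality on which the selection rests: removal of inverses and quantifier
    elimination over the real closed field [R] leave a Boolean combination of sign conditions on
    polynomials in one variable. *)
Lemma sadef_ev0 (P : seq R -> Prop) : sadef 1 P ->
  eventually0 (fun s => P [:: s]) \/ eventually0 (fun s => ~ P [:: s]).
Proof.
move=> [phi phiE].
pose psi := ord.quantifier_elim (fun n bc => qe_rcf.qfr_to_formula (@qe_rcf.wproj R n bc))
  (ord.to_rform phi).
have /andP[qf rf] : ord.qf_form psi && ord.rformula psi.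
  apply: ord.quantifier_elim_wf;
    [exact: qe_rcf.wf_QE_wproj|exact: ord.to_rform_rformula].
have psiE s : reflect (P [:: s]) (ord.qf_eval [:: s] psi).
  apply: (iffP (qe_rcf.rcf_satP [:: s] phi)) => [/phiE|Ps]; first exact.
  exact/phiE.
have [[] ev] := qf_ev0 qf rf; [left|right]; apply: ev0_impl ev => s _ /idP.
  by move=> /psiE.
by move=> nP; apply/psiE/negP.
Qed.

(* Since ln (1 + s^M) <= s^M, the function c - eps * ln does not decrease along
   the steps s |-> s + s^(M+1); as ln is unbounded near 0, c cannot be bounded. *)
Lemma no_drift (c : R -> R) (B s1 eps : R) (M : nat) : 0 < s1 -> 0 < eps ->
  (forall s : R, 0 < s -> s < s1 -> `|c s| <= B) ->
  (forall s : R, 0 < s -> s < s1 -> c s + eps * s ^+ M <= c (s + s ^+ M.+1)) -> False.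
Proof.
move=> s1_gt0 eps0; wlog s1_le1 : s1 s1_gt0 / s1 <= 1 => [H cB cD|].
  apply: (H (Num.min s1 1)) => [|||] //.
  - by rewrite lt_min s1_gt0/=.
  - by rewrite ge_min lexx orbT.
  - by move=> s s0; rewrite lt_min => /andP[? _]; exact: cB.
  - by move=> s s0; rewrite lt_min => /andP[? _]; exact: cD.
move=> cB cD; pose G s := c s - eps * ln s.
have GD (s : R) : 0 < s -> s < s1 -> G s <= G (s + s ^+ M.+1).
  move=> s0 ss1; have sM : 0 < s ^+ M by exact: exprn_gt0.
  have -> : s + s ^+ M.+1 = s * (1 + s ^+ M) by rewrite exprS mulrDr mulr1.
  rewrite /G lnM ?posrE ?addr_gt0//.
  have := cD s s0 ss1; rewrite exprS => {}cD.
  have -> : s * (1 + s ^+ M) = s + s * s ^+ M by rewrite mulrDr mulr1.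
  have L : ln (1 + s ^+ M) <= s ^+ M by apply: le_ln1Dx; lra.
  have := ler_wpM2l (ltW eps0) L; lra.
(* Steps taken from s >= s0 advance by at least s0^(M+1), so finitely many of them pass s1/2; none
   jumps beyond s1, since s < s1/2 at most doubles. *)
have iterG (s0 : R) : 0 < s0 -> forall (k : nat) (s : R), s0 <= s -> s < s1 ->
    s1 / 2 <= s + k%:R * s0 ^+ M.+1 ->
    exists e : R, [/\ s1 / 2 <= e, e < s1 & G s <= G e].
  move=> s0_gt0; elim=> [|k IH] s s0s ss1.
    by rewrite mul0r addr0 => H; exists s.
  move=> H; have [s1s|ss12] := leP (s1 / 2) s; first by exists s.
  have s_gt0 : 0 < s by lra.
  have sM : s ^+ M.+1 <= s by rewrite exprS ler_piMr ?exprn_ile1; lra.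
  have sM0 : s0 ^+ M.+1 <= s ^+ M.+1.
    by rewrite lerXn2r ?nnegrE; lra.
  have sM1 : 0 < s0 ^+ M.+1 by exact: exprn_gt0.
  have [|||e [e1 e2 e3]] := IH (s + s ^+ M.+1); try lra.
  by exists e; split=> //; apply: le_trans e3; exact: GD.
(* So small that eps * ln grows by at least 2 B + 1 from s0 to s1/2, more than the variation 2 B
   available to [c]. *)
pose s0 := Num.min (s1 / 2) (expR (ln (s1 / 2) - (2 * B + 1) / eps)).
have s0_gt0 : 0 < s0 by rewrite lt_min expR_gt0 andbT; lra.
have s0_le : s0 <= s1 / 2 by rewrite ge_min lexx.
have ln_s0 : eps * ln s0 <= eps * ln (s1 / 2) - (2 * B + 1).
  have : ln s0 <= ln (s1 / 2) - (2 * B + 1) / eps.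
    rewrite -[leRHS]expRK ler_ln ?posrE ?expR_gt0//.
    by rewrite ge_min lexx orbT.
  by move=> /(ler_wpM2l (ltW eps0)); rewrite mulrBr mulrCA divff ?gt_eqF// mulr1.
have sM1 : 0 < s0 ^+ M.+1 by exact: exprn_gt0.
have [k kH] : exists k : nat, s1 / 2 / s0 ^+ M.+1 <= k%:R.
  exists (Num.truncn (s1 / 2 / s0 ^+ M.+1)).+1.
  by apply: ltW; rewrite truncnS_gt.
have [|||e [e1 e2]] := iterG s0 s0_gt0 k s0; try lra.
  by move: kH; rewrite ler_pdivrMr//; lra.
rewrite /G => e3.
have lne : ln (s1 / 2) <= ln e by rewrite ler_ln ?posrE; lra.
have := ler_wpM2l (ltW eps0) lne.
have := cB e; have := cB s0 s0_gt0; rewrite !ler_norml => /(_ _)/andP[|]; first lra.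
by move=> B1 B2 /(_ _ _)/andP[||B3 B4]; lra.
Qed.

(** Definability of the graph, stated after substitution of arbitrary terms, so that the family can
    be evaluated at [s] and at [s + s ^+ M.+1] inside one formula. *)
Definition safamily m (A : R -> 'rV[R]_m -> Prop) :=
  forall k (sigma : seq R -> R) (eta : 'I_m -> seq R -> R),
    saterm k sigma -> (forall j, saterm k (eta j)) ->
    sadef k (fun e => A (sigma e) (\row_j eta j e)).

Lemma sadef_family_ex k m (A : R -> 'rV[R]_m -> Prop) (sigma : seq R -> R)
    (Q : seq R -> 'rV[R]_m -> Prop) :
  safamily A -> saterm k sigma ->
  sadef (k + m) (fun e => Q (take k e) (\row_j e`_(k + j))) ->
  sadef k (fun e => exists2 y, A (sigma e) y & Q e y).
Proof.
move=> Asa sk Qd.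
have := @sadef_ex k m (fun e y => A (sigma e) y /\ Q e y) _.
move=> H; apply: eq_sadef (H _) => [e _|].
  by split=> [[y []]|[y]]; exists y.
apply: sadef_and => //; apply: Asa; first exact: saterm_take.
by move=> j; exact: saterm_var.
Qed.

Lemma sadef_family_all k m (A : R -> 'rV[R]_m -> Prop) (sigma : seq R -> R)
    (Q : seq R -> 'rV[R]_m -> Prop) :
  safamily A -> saterm k sigma ->
  sadef (k + m) (fun e => Q (take k e) (\row_j e`_(k + j))) ->
  sadef k (fun e => forall y, A (sigma e) y -> Q e y).
Proof.
move=> Asa sk Qd; apply: (@sadef_forall k m (fun e y => A (sigma e) y -> Q e y)).
apply: sadef_imp => //; apply: Asa; first exact: saterm_take.
by move=> j; exact: saterm_var.
Qed.

(** Comparing one point at time [sigma] with all points at time [tau] says that the infimum of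
    coordinate [i] grows by at least c s^M, without naming an infimum in a formula. *)
Lemma sadef_gap m (A : R -> 'rV[R]_m -> Prop) (i : 'I_m) (sigma tau : seq R -> R)
    (c : R) (M : nat) : safamily A -> saterm 1 sigma -> saterm 1 tau ->
  sadef 1 (fun e => exists2 y, A (sigma e) y &
    forall y', A (tau e) y' -> y 0 i + c * e`_0 ^+ M <= y' 0 i).
Proof.
move=> Asa sk tk; apply: (@sadef_family_ex _ _ _ _ (fun e y => forall y',
  A (tau e) y' -> y 0 i + c * e`_0 ^+ M <= y' 0 i)) => //.
apply: (@sadef_family_all (1 + m) m A (fun e => tau (take 1 e)) (fun e y' =>
  (\row_j e`_(1 + j) : 'rV[R]_m) 0 i + c * (take 1 e)`_0 ^+ M <= y' 0 i)) => //.
  exact: saterm_take.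
apply: (@eq_sadef _ (fun e => e`_(1 + i) + c * e`_0 ^+ M <= e`_(1 + m + i))).
  by move=> e es; rewrite !mxE !nth_take ?ltn_add2l.
apply: sadef_le; last exact: saterm_var.
apply: satermD; first exact: saterm_var.
by apply: satermM; [exact: saterm_cst|apply: satermX; exact: saterm_var].
Qed.

Lemma ev0_ex P : eventually0 P -> exists2 s, 0 < s & P s.
Proof. by move=> [a a0 H]; exists (a / 2); [|apply: H]; lra. Qed.

(* A' s consists of the points of A s whose i-th coordinate is within s^(M+1) of
   the infimum c s; [no_drift] applied to c and - c shows that c moves slowly. *)
Lemma slow_step m (A : R -> 'rV[R]_m -> Prop) (i : 'I_m) (M : nat) (B : R) :
  safamily A -> eventually0 (fun s => exists y, A s y) ->
  eventually0 (fun s => forall y, A s y -> `|y 0 i| <= B) ->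
  exists A' : R -> 'rV[R]_m -> Prop,
  [/\ safamily A', forall s y, A' s y -> A s y, eventually0 (fun s => exists y, A' s y)
    & forall eps, 0 < eps -> eventually0 (fun s => forall y y',
        A' s y -> A' (s + s ^+ M.+1) y' -> `|y 0 i - y' 0 i| <= eps * s ^+ M)].
Proof.
move=> Asa Aex AB.
exists (fun s y => A s y /\ forall z, A s z -> y 0 i <= z 0 i + s ^+ M.+1).
split.
- move=> k sigma eta sk ek; apply: sadef_and; first exact: Asa.
  apply: (@sadef_family_all _ _ _ _ (fun e z =>
    (\row_j eta j e) 0 i <= z 0 i + sigma e ^+ M.+1)) => //.
  apply: (@eq_sadef _ (fun e =>
    eta i (take k e) <= e`_(k + i) + sigma (take k e) ^+ M.+1)) => [e _|].
    by rewrite !mxE.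
  apply: sadef_le; first exact: (saterm_take m (ek i)).
  by apply: satermD; [exact: saterm_var|exact/satermX/saterm_take].
- by move=> s y [].
- apply: ev0_impl (ev0_and Aex AB) => s s0 [[y0 Ay0] sB].
  pose E := [set y 0 i | y in A s].
  have infE : has_inf E.
    split; first by exists (y0 0 i); exists y0.
    by exists (- B) => _ [y Ay <-]; have := sB y Ay; rewrite ler_norml => /andP[].
  have [_ [y Ay <-] yi] := inf_adherent (exprn_gt0 M.+1 s0) infE.
  exists y; split=> // z Az; apply: (le_trans (ltW yi)); rewrite lerD2r.
  by apply: ge_inf; [case: infE|exists z].
- move=> eps eps0.
  have half_gt0 : 0 < eps / 2 by lra.
  (* [up] makes the infimum [c] grow by eps/2 s^M over one step, [dn] makes it fall as much. Each is
     eventually true or eventually false, and the former is excluded by [no_drift]. *)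
  pose up (s : R) := exists2 y, A s y & forall y', A (s + s ^+ M.+1) y' ->
    y 0 i + eps / 2 * s ^+ M <= y' 0 i.
  pose dn (s : R) := exists2 y', A (s + s ^+ M.+1) y' & forall y, A s y ->
    y' 0 i + eps / 2 * s ^+ M <= y 0 i.
  have step : saterm 1 (fun e => e`_0 + e`_0 ^+ M.+1).
    by apply: satermD; [|apply: satermX]; exact: saterm_var.
  have upd : sadef 1 (fun e => up e`_0).
    by apply: (@sadef_gap m A i (fun e => e`_0)) => //; exact: saterm_var.
  have dnd : sadef 1 (fun e => dn e`_0).
    by apply: (@sadef_gap m A i _ (fun e => e`_0)) => //; exact: saterm_var.
  have [sA sA_gt0 Ain] : eventually0 (fun s => (exists y, A s y) /\
    (forall y, A s y -> `|y 0 i| <= B)) by exact: ev0_and.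
  pose c (s : R) := inf [set y 0 i | y in A s].
  have infc (s : R) : 0 < s -> s < sA -> has_inf [set y 0 i | y in A s].
    move=> s0 ssA; have [[y Ay] sB] := Ain s s0 ssA.
    split; first by exists (y 0 i), y.
    by exists (- B) => _ [z Az <-]; have := sB z Az; rewrite ler_norml => /andP[].
  have cB (s : R) : 0 < s -> s < sA -> `|c s| <= B.
    move=> s0 ssA; have [[y Ay] sB] := Ain s s0 ssA; rewrite ler_norml.
    apply/andP; split.
      apply: lb_le_inf; first by case: (infc s s0 ssA).
      by move=> _ [z Az <-]; have := sB z Az; rewrite ler_norml => /andP[].
    apply: (@le_trans _ _ (y 0 i)).
      by apply: ge_inf; [case: (infc s s0 ssA)|exists y].
    by have := sB y Ay; rewrite ler_norml => /andP[].
  have cle (s : R) y : 0 < s -> s < sA -> A s y -> c s <= y 0 i.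
    by move=> s0 ssA Ay; apply: ge_inf; [case: (infc s s0 ssA)|exists y].
  have gec (s : R) x : 0 < s -> s < sA -> (forall y, A s y -> x <= y 0 i) -> x <= c s.
    move=> s0 ssA xA; apply: lb_le_inf; first by case: (infc s s0 ssA).
    by move=> _ [z Az <-]; exact: xA.
  have smallstep (s : R) : 0 < s -> s < Num.min (sA / 2) 1 ->
      [/\ s < sA, 0 < s + s ^+ M.+1 & s + s ^+ M.+1 < sA].
    move=> s0; rewrite lt_min => /andP[ss1 ss2].
    have sM : s ^+ M.+1 <= s by rewrite exprS ler_piMr ?exprn_ile1; lra.
    have := exprn_gt0 M.+1 s0; split; lra.
  have s1_gt0 : 0 < Num.min (sA / 2) 1 by rewrite lt_min; lra.
  have noup : eventually0 (fun s => ~ up s).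
    have [[s0 s0_gt0 upev]|//] := sadef_ev0 upd; exfalso.
    apply: (@no_drift c B (Num.min s0 (Num.min (sA / 2) 1)) (eps / 2) M) => //.
    - by rewrite lt_min s0_gt0.
    - by move=> s s_gt0; rewrite lt_min => /andP[_ /(smallstep _ s_gt0)[? _ _]]; exact: cB.
    - move=> s s_gt0; rewrite lt_min => /andP[ss0 /(smallstep _ s_gt0)[h1 h2 h3]].
      have [y Ay yup] := upev s s_gt0 ss0; apply: gec => // y' /yup.
      by apply: le_trans; rewrite lerD2r; exact: cle.
  have nodn : eventually0 (fun s => ~ dn s).
    have [[s0 s0_gt0 dnev]|//] := sadef_ev0 dnd; exfalso.
    apply: (@no_drift (fun s => - c s) B (Num.min s0 (Num.min (sA / 2) 1)) (eps / 2) M) => //.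
    - by rewrite lt_min s0_gt0.
    - move=> s s_gt0; rewrite lt_min normrN.
      by move=> /andP[_ /(smallstep _ s_gt0)[? _ _]]; exact: cB.
    - move=> s s_gt0; rewrite lt_min => /andP[ss0 /(smallstep _ s_gt0)[h1 h2 h3]].
      have [y' Ay' ydn] := dnev s s_gt0 ss0.
      have := gec s _ s_gt0 h1 ydn; have := cle _ _ h2 h3 Ay'; lra.
  (* Makes the tolerance at the far end, at most (2 s)^(M+1), no larger than eps/2 s^M. *)
  pose s2 := Num.min 1 (eps / 2 / 2 ^+ M.+1).
  have s2_gt0 : 0 < s2 by rewrite lt_min ltr01 divr_gt0// exprn_gt0.
  apply: ev0_impl (ev0_and (ev0_and noup nodn) (ev0_lt s2_gt0)).
  move=> s s_gt0 [[nup ndn] ss2] y y' [Ay ymin] [Ay' ymin'].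
  move: ss2; rewrite lt_min => /andP[s_lt1 ss2].
  have sM0 : 0 < s ^+ M by exact: exprn_gt0.
  have sM : s ^+ M.+1 <= s by rewrite exprS ler_piMr ?exprn_ile1; lra.
  have sM1 : 0 < s ^+ M.+1 by exact: exprn_gt0.
  have H1 : (s + s ^+ M.+1) ^+ M.+1 <= eps / 2 * s ^+ M.
    apply: (@le_trans _ _ ((2 * s) ^+ M.+1)).
      by rewrite lerXn2r ?nnegrE; lra.
    rewrite exprMn (exprS s M) mulrA ler_pM2r// mulrC -ler_pdivlMr ?exprn_gt0//.
    exact: ltW.
  have H2 : s ^+ M.+1 <= eps / 2 * s ^+ M.
    by apply: le_trans H1; rewrite lerXn2r ?nnegrE; lra.
  have [z' Az' zy'] : exists2 z', A (s + s ^+ M.+1) z' & z' 0 i < y 0 i + eps / 2 * s ^+ M.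
    apply: contrapT => H; apply: nup; exists y => // z' Az'; rewrite leNgt.
    by apply/negP => zy; apply: H; exists z'.
  have [z Az zy] : exists2 z, A s z & z 0 i < y' 0 i + eps / 2 * s ^+ M.
    apply: contrapT => H; apply: ndn; exists y' => // z Az; rewrite leNgt.
    by apply/negP => zy; apply: H; exists z.
  have := ymin z Az; have := ymin' z' Az'; rewrite ler_norml => h1 h2.
  by apply/andP; split; lra.
Qed.

(** Stands in for curve selection. Definability turns non-emptiness for arbitrarily small s into
    non-emptiness for all small s; then the coordinates are slowed down one after the other, which
    works because shrinking the family preserves the bounds already obtained. *)
Lemma slow_selection m (A : R -> 'rV[R]_m -> Prop) (M : nat) (B : R) :
  safamily A -> ~ eventually0 (fun s => ~ exists y, A s y) ->
  (forall s y i, A s y -> `|y 0 i| <= B) ->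
  forall eps, 0 < eps -> eventually0 (fun s => exists y y',
    [/\ A s y, A (s + s ^+ M.+1) y' & forall i, `|y 0 i - y' 0 i| <= eps * s ^+ M]).
Proof.
move=> Asa Aex AB eps eps0.
have {}Aex : eventually0 (fun s => exists y, A s y).
  have Ad : sadef 1 (fun e => exists y, A e`_0 y).
    apply: (@sadef_ex 1 m (fun e y => A e`_0 y)); apply: Asa.
      by apply: (@saterm_take 1 m (fun e => e`_0)); exact: saterm_var.
    by move=> j; exact: saterm_var.
  by have [//|nA] := sadef_ev0 Ad; case: Aex.
suff [A' [A'A A'ex A'slow]] : exists A' : R -> 'rV[R]_m -> Prop,
    [/\ forall s y, A' s y -> A s y, eventually0 (fun s => exists y, A' s y)
    & eventually0 (fun s => forall y y' i,
        A' s y -> A' (s + s ^+ M.+1) y' -> `|y 0 i - y' 0 i| <= eps * s ^+ M)].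
  have [sA sA_gt0 Ain] := A'ex.
  have s2_gt0 : 0 < Num.min 1 (sA / 2) by rewrite lt_min; lra.
  apply: ev0_impl (ev0_and (ev0_lt s2_gt0) A'slow) => s s_gt0 [].
  rewrite lt_min => /andP[s1 s2] slow.
  have sM : s ^+ M.+1 <= s by rewrite exprS ler_piMr ?exprn_ile1; lra.
  have sM1 : 0 < s ^+ M.+1 by exact: exprn_gt0.
  have [||y Ay] := Ain s; try lra.
  have [||y' Ay'] := Ain (s + s ^+ M.+1); try lra.
  by exists y, y'; split=> [||i]; [exact: A'A|exact: A'A|exact: slow].
suff H : forall l : seq 'I_m, exists A' : R -> 'rV[R]_m -> Prop,
    [/\ safamily A', forall s y, A' s y -> A s y, eventually0 (fun s => exists y, A' s y)
    & eventually0 (fun s => forall y y' i, i \in l ->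
        A' s y -> A' (s + s ^+ M.+1) y' -> `|y 0 i - y' 0 i| <= eps * s ^+ M)].
  have [A' [_ A'A A'ex slow]] := H (enum 'I_m); exists A'; split => //.
  by apply: ev0_impl slow => s s0 + y y' i; apply; rewrite mem_enum.
elim=> [|i l [A1 [A1sa A1A A1ex A1slow]]].
  by exists A; split=> //; exists 1.
have [|A2 [A2sa A2A A2ex A2slow]] := @slow_step m A1 i M B A1sa A1ex.
  by exists 1 => // s _ _ y /A1A/AB.
exists A2; split => // [s y /A2A/A1A//|].
apply: ev0_impl (ev0_and A1slow (A2slow eps eps0)) => s s0 [h1 h2] y y' j.
rewrite inE => /orP[/eqP -> |jl] Ay Ay'; first exact: h2.
by apply: h1 => //; exact: A2A.
Qed.
End Semialgebraic.

Lemma coord_le_norm (R : realType) m n (u : 'M[R]_(m, n)) i j : `|u i j| <= `|u|.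
Proof.
rewrite [leRHS]/Num.norm /= mx_normrE.
by apply: (le_trans _ (le_bigmax _ _ (i, j))).
Qed.

Lemma norm_le_coord (R : realType) m n (u : 'M[R]_(m, n)) c :
  0 <= c -> (forall i j, `|u i j| <= c) -> `|u| <= c.
Proof.
by move=> c0 uc; rewrite /Num.norm /= mx_normrE; apply: bigmax_le => // -[i j] _.
Qed.

(** * Euclidean norms and polynomials *)

Section Euclid.
Variables (R : realType) (N : nat).
Implicit Types (u v w : 'rV[R]_N).

Lemma edotC u v : edot u v = edot v u.
Proof. by apply: eq_bigr => j _; rewrite mulrC. Qed.

Lemma edotDl u v w : edot (u + v) w = edot u w + edot v w.
Proof. by rewrite -big_split; apply: eq_bigr => j _; rewrite mxE mulrDl. Qed.

Lemma edotZl k u w : edot (k *: u) w = k * edot u w.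
Proof. by rewrite /edot mulr_sumr; apply: eq_bigr => j _; rewrite mxE mulrA. Qed.

Lemma edotNl u w : edot (- u) w = - edot u w.
Proof. by rewrite -scaleN1r edotZl mulN1r. Qed.

Lemma edotBl u v w : edot (u - v) w = edot u w - edot v w.
Proof. by rewrite edotDl edotNl. Qed.

Lemma edot0l w : edot 0 w = 0.
Proof. by rewrite -(scale0r w) edotZl mul0r. Qed.

Lemma edotDr u v w : edot w (u + v) = edot w u + edot w v.
Proof. by rewrite !(edotC w) edotDl. Qed.

Lemma edotZr k u w : edot w (k *: u) = k * edot w u.
Proof. by rewrite !(edotC w) edotZl. Qed.

Lemma edotNr u w : edot w (- u) = - edot w u.
Proof. by rewrite !(edotC w) edotNl. Qed.

Lemma edotBr u v w : edot w (u - v) = edot w u - edot w v.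
Proof. by rewrite edotDr edotNr. Qed.

Lemma edot0r w : edot w 0 = 0.
Proof. by rewrite edotC edot0l. Qed.

Lemma edot_ge0 u : 0 <= edot u u.
Proof. by apply: sumr_ge0 => j _; rewrite -expr2 sqr_ge0. Qed.

Lemma edot_eq0 u : edot u u = 0 -> u = 0.
Proof.
move=> /eqP; rewrite psumr_eq0 => [/allP u0|j _]; last by rewrite -expr2 sqr_ge0.
apply/rowP => j; rewrite mxE; have := u0 j (mem_index_enum _).
by rewrite /= -expr2 sqrf_eq0 => /eqP.
Qed.

Lemma enorm_ge0 u : 0 <= enorm u.
Proof. exact: sqrtr_ge0. Qed.

Lemma sqr_enorm u : enorm u ^+ 2 = edot u u.
Proof. by rewrite sqr_sqrtr// edot_ge0. Qed.

Lemma enorm0 : enorm (0 : 'rV[R]_N) = 0.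
Proof. by rewrite /enorm edot0l sqrtr0. Qed.

Lemma enorm_eq0 u : enorm u = 0 -> u = 0.
Proof. by move=> u0; apply: edot_eq0; rewrite -sqr_enorm u0 expr0n. Qed.

Lemma enorm_gt0 u : u != 0 -> 0 < enorm u.
Proof.
move=> u0; rewrite lt_def enorm_ge0 andbT; apply: contra_neq u0; exact: enorm_eq0.
Qed.

Lemma enormZ k u : enorm (k *: u) = `|k| * enorm u.
Proof.
by rewrite /enorm edotZl edotZr mulrA -expr2 sqrtrM ?sqr_ge0// sqrtr_sqr.
Qed.

Lemma enormN u : enorm (- u) = enorm u.
Proof. by rewrite -scaleN1r enormZ normrN normr1 mul1r. Qed.

Lemma edot_le u v : `|edot u v| <= enorm u * enorm v.
Proof.
have [->|v0] := eqVneq v 0; first by rewrite edot0r normr0 enorm0 mulr0.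
have v_gt0 : 0 < edot v v by rewrite -sqr_enorm exprn_gt0// enorm_gt0.
have := edot_ge0 (edot v v *: u - edot u v *: v).
rewrite !(edotBl, edotBr, edotZl, edotZr) (edotC v u) => H.
have {}H : edot u v ^+ 2 <= edot u u * edot v v.
  by rewrite -(ler_pM2l v_gt0); lra.
rewrite -(@ler_pXn2r _ 2)// ?nnegrE ?mulr_ge0 ?enorm_ge0//.
by rewrite exprMn !sqr_enorm real_normK// num_real.
Qed.

Lemma enormD u v : enorm (u + v) <= enorm u + enorm v.
Proof.
rewrite -(@ler_pXn2r _ 2)// ?nnegrE ?addr_ge0 ?enorm_ge0//.
rewrite sqrrD !sqr_enorm edotDl !edotDr (edotC v u).
have := le_trans (ler_norm _) (edot_le u v); lra.
Qed.

Lemma enormB u v : enorm (u - v) <= enorm u + enorm v.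
Proof. by rewrite -(enormN v); exact: enormD. Qed.

Lemma norm_le_enorm u : `|u| <= enorm u.
Proof.
apply: norm_le_coord => [|i0 j]; first exact: enorm_ge0.
rewrite ord1 -(@ler_pXn2r _ 2)// ?nnegrE ?enorm_ge0// sqr_enorm real_normK ?num_real//.
rewrite /edot (bigD1 j)//= -expr2 lerDl; apply: sumr_ge0 => i _.
by rewrite -expr2 sqr_ge0.
Qed.

Lemma enorm_le_norm u : enorm u <= N%:R * `|u|.
Proof.
rewrite -(@ler_pXn2r _ 2)// ?nnegrE ?mulr_ge0 ?enorm_ge0// sqr_enorm.
apply: (@le_trans _ _ (\sum_(j < N) `|u| ^+ 2)).
  apply: ler_sum => j _; rewrite -expr2 -[X in X <= _]real_normK ?num_real//.
  by rewrite lerXn2r ?nnegrE// coord_le_norm.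
rewrite sumr_const card_ord -[leLHS]mulr_natl exprMn; apply: ler_wpM2r; first exact: sqr_ge0.
by rewrite -natrX ler_nat; case: (N) => // k; rewrite expnS leq_pmulr// expn1.
Qed.

Lemma edot_le_norm u v : `|edot u v| <= N%:R * `|u| * `|v|.
Proof.
apply: (le_trans (ler_norm_sum _ _ _)).
apply: (@le_trans _ _ (\sum_(j < N) `|u| * `|v|)).
  by apply: ler_sum => j _; rewrite normrM ler_pM// coord_le_norm.
by rewrite sumr_const card_ord -[leLHS]mulr_natl mulrA.
Qed.

End Euclid.

Section PolyCalculus.
Variables (R : realType) (n : nat).
Local Notation mp := (mpoly.mpoly n R).
Implicit Types (q : mp) (x : 'rV[R]_n).

Lemma mpoly_ring_ind (T : mp -> Prop) :
  (forall c, T (mpoly.mpolyC n c)) -> (forall i : 'I_n, T (mpoly.mpolyX R (mpoly.mnm1 i))) ->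
  (forall q q', T q -> T q' -> T (q + q')) ->
  (forall q q', T q -> T q' -> T (q * q')) -> forall q, T q.
Proof.
move=> TC TX TD TM q; have T1 : T 1 by rewrite -mpoly.mpolyC1; exact: TC.
have TXn m i : T (mpoly.mpolyX R (mpoly.mnm1 i) ^+ m).
  by elim: m => [|m IH]; rewrite ?expr0// exprS; exact: TM.
rewrite (mpoly.mpolyE q); apply: big_ind => [||m _] //.
  by rewrite -mpoly.mpolyC0.
rewrite mpoly.mpolyXE_id -mpoly.mul_mpolyC; apply: (TM) => //.
exact: (big_ind T).
Qed.

Definition pev q x := mpoly.meval (fun j => x 0 j) q.

Definition pgrad q x : 'rV[R]_n := \row_j pev (mpoly.mderiv j q) x.

Lemma pevD q q' x : pev (q + q') x = pev q x + pev q' x.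
Proof. exact: mpoly.mevalD. Qed.

Lemma pevM q q' x : pev (q * q') x = pev q x * pev q' x.
Proof. exact: mpoly.mevalM. Qed.

Lemma pgradD q q' x : pgrad (q + q') x = pgrad q x + pgrad q' x.
Proof. by apply/rowP => j; rewrite !mxE mpoly.mderivD pevD. Qed.

Lemma pgradM q q' x : pgrad (q * q') x = pev q' x *: pgrad q x + pev q x *: pgrad q' x.
Proof.
apply/rowP => j; rewrite !mxE mpoly.mderivM pevD !pevM.
by congr (_ + _); rewrite mulrC.
Qed.

Lemma pgradC c x : pgrad (mpoly.mpolyC n c) x = 0.
Proof.
by apply/rowP => j; rewrite !mxE mpoly.mderivC; exact: mpoly.meval0.
Qed.

Lemma pgradX i x : pgrad (mpoly.mpolyX R (mpoly.mnm1 i)) x = delta_mx 0 i.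
Proof.
apply/rowP => j; rewrite !mxE mpoly.mderivX eqxx /=.
rewrite /pev mpoly.mevalZ mpoly.mnm1E; have [->|ij] := eqVneq i j.
  rewrite mpoly.mevalX big1 ?mulr1// => k _.
  by rewrite mpoly.mnmBE subnn expr0.
by rewrite mul0r.
Qed.

Lemma saterm_pev q k (eta : 'I_n -> seq R -> R) : (forall j, saterm k (eta j)) ->
  saterm k (fun e => mpoly.meval (fun j => eta j e) q).
Proof.
move=> ek; elim/mpoly_ring_ind: q => [c|i|q q' [t tE] [t' t'E]|q q' [t tE] [t' t'E]].
- by exists (GRing.Const c) => e _; rewrite mpoly.mevalC.
- by have [t tE] := ek i; exists t => e es; rewrite mpoly.mevalXU tE.
- by exists (GRing.Add t t') => e es /=; rewrite mpoly.mevalD tE// t'E.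
- by exists (GRing.Mul t t') => e es /=; rewrite mpoly.mevalM tE// t'E.
Qed.

(** The aim is the last bound, a uniform second-order remainder. The others travel along because the
    remainder of a product involves the values, gradients and increments of its factors. *)
Lemma poly_remainder (B : R) q : exists K, [/\ 0 <= K,
  forall x, `|x| <= B -> `|pev q x| <= K,
  forall x v, `|x| <= B -> `|edot (pgrad q x) v| <= K * `|v|,
  forall x v, `|x| <= B -> `|x + v| <= B -> `|pev q (x + v) - pev q x| <= K * `|v| &
  forall x v, `|x| <= B -> `|x + v| <= B ->
    `|pev q (x + v) - pev q x - edot (pgrad q x) v| <= K * `|v| ^+ 2].
Proof.
elim/mpoly_ring_ind: q => [c|i|q q'|q q'].
- exists `|c|; split=> // [x _|x v _|x v _ _|x v _ _].
  + by rewrite /pev mpoly.mevalC.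
  + by rewrite pgradC edot0l normr0 mulr_ge0.
  + by rewrite /pev !mpoly.mevalC subrr normr0 mulr_ge0.
  + by rewrite pgradC edot0l /pev !mpoly.mevalC subrr subr0 normr0 mulr_ge0// sqr_ge0.
- have XE x : pev (mpoly.mpolyX R (mpoly.mnm1 i)) x = x 0 i by exact: mpoly.mevalXU.
  have dE x v : edot (pgrad (mpoly.mpolyX R (mpoly.mnm1 i)) x) v = v 0 i.
    rewrite pgradX /edot (bigD1 i)//= mxE !eqxx mul1r big1 ?addr0// => j ji.
    by rewrite mxE (negbTE ji) andbF mul0r.
  have vi (v : 'rV[R]_n) : `|v 0 i| <= (1 + `|B|) * `|v|.
    rewrite mulrDl mul1r; have := coord_le_norm v 0 i.
    have : 0 <= `|B| * `|v| by exact: mulr_ge0.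
    lra.
  exists (1 + `|B|); split=> [|x xB|x v _|x v _ _|x v _ _].
  + by rewrite addr_ge0.
  + rewrite XE; have := coord_le_norm x 0 i; have := ler_norm B; lra.
  + by rewrite dE.
  + by rewrite !XE mxE addrAC subrr add0r.
  + rewrite dE !XE mxE (_ : _ - _ = 0) ?normr0; last by ring.
    by rewrite mulr_ge0// ?addr_ge0// sqr_ge0.
- move=> [K [K0 K1 K2 K3 K4]] [K' [K'0 K'1 K'2 K'3 K'4]].
  exists (K + K'); split=> [|x xB|x v xB|x v xB xvB|x v xB xvB].
  + exact: addr_ge0.
  + rewrite pevD; apply: (le_trans (ler_normD _ _)); apply: lerD; [exact: K1|exact: K'1].
  + rewrite pgradD edotDl mulrDl.
    by apply: (le_trans (ler_normD _ _)); apply: lerD; [exact: K2|exact: K'2].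
  + rewrite !pevD mulrDl opprD addrACA.
    by apply: (le_trans (ler_normD _ _)); apply: lerD; [exact: K3|exact: K'3].
  + rewrite !pevD pgradD edotDl mulrDl.
    rewrite (_ : _ - _ = pev q (x + v) - pev q x - edot (pgrad q x) v +
       (pev q' (x + v) - pev q' x - edot (pgrad q' x) v)); last by ring.
    by apply: (le_trans (ler_normD _ _)); apply: lerD; [exact: K4|exact: K'4].
- move=> [K [K0 K1 K2 K3 K4]] [K' [K'0 K'1 K'2 K'3 K'4]].
  exists (3 * (K * K')); split=> [|x xB|x v xB|x v xB xvB|x v xB xvB].
  + by rewrite mulr_ge0// mulr_ge0.
  + rewrite pevM normrM; apply: (@le_trans _ _ (K * K')).
      by apply: ler_pM => //; [exact: K1|exact: K'1].
    by have := mulr_ge0 K0 K'0; lra.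
  + rewrite pgradM edotDl !edotZl; apply: (le_trans (ler_normD _ _)).
    rewrite !normrM.
    have H1 : `|pev q' x| * `|edot (pgrad q x) v| <= K' * (K * `|v|).
      by apply: ler_pM => //; [exact: K'1|exact: K2].
    have H2 : `|pev q x| * `|edot (pgrad q' x) v| <= K * (K' * `|v|).
      by apply: ler_pM => //; [exact: K1|exact: K'2].
    have : 0 <= K * K' * `|v| by rewrite mulr_ge0// mulr_ge0.
    lra.
  + rewrite !pevM (_ : _ - _ = (pev q (x + v) - pev q x) * pev q' (x + v) +
      pev q x * (pev q' (x + v) - pev q' x)); last by ring.
    apply: (le_trans (ler_normD _ _)); rewrite !normrM.
    have H1 : `|pev q (x + v) - pev q x| * `|pev q' (x + v)| <= K * `|v| * K'.
      by apply: ler_pM => //; [exact: K3|exact: K'1].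
    have H2 : `|pev q x| * `|pev q' (x + v) - pev q' x| <= K * (K' * `|v|).
      by apply: ler_pM => //; [exact: K1|exact: K'3].
    have : 0 <= K * K' * `|v| by rewrite mulr_ge0// mulr_ge0.
    lra.
  + rewrite !pevM pgradM edotDl !edotZl.
    rewrite (_ : _ - _ =
      (pev q (x + v) - pev q x - edot (pgrad q x) v) * pev q' (x + v) +
      (pev q x * (pev q' (x + v) - pev q' x - edot (pgrad q' x) v) +
      edot (pgrad q x) v * (pev q' (x + v) - pev q' x))); last by ring.
    apply: (le_trans (ler_normD _ _)).
    rewrite -!mulrA (_ : 3 * _ = K * `|v| ^+ 2 * K' +
      (K * (K' * `|v| ^+ 2) + K * `|v| * (K' * `|v|))); last by ring.
    apply: lerD; last apply: (le_trans (ler_normD _ _)); last apply: lerD.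
    * by rewrite normrM; apply: ler_pM => //; [exact: K4|exact: K'1].
    * by rewrite normrM; apply: ler_pM => //; [exact: K1|exact: K'4].
    * by rewrite normrM; apply: ler_pM => //; [exact: K2|exact: K'3].
Qed.

End PolyCalculus.

(** * Angles on the horn of a polynomial map *)

Section Angle.
Variables (R : realType) (n p r : nat) (h : 'I_p -> mpoly.mpoly n R).

Definition pjac (x : 'rV[R]_n) : 'M[R]_(p, n) :=
  \matrix_(i, j) pev (mpoly.mderiv j (h i)) x.

Lemma pjacE (a : 'rV[R]_p) x v :
  edot (a *m pjac x) v = \sum_i a 0 i * edot (pgrad (h i) x) v.
Proof.
rewrite /edot; under eq_bigr do rewrite mxE mulr_suml.
rewrite exchange_big; apply: eq_bigr => i _; rewrite mulr_sumr.
by apply: eq_bigr => j _; rewrite !mxE mulrA.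
Qed.

(* v = (y, u) encodes a point x = s y of the horn, with |y| = 1 and
   h x = s^(r+1) u, at which a vector a (dh x) makes a small angle with x. *)
Definition bad_family (w eps s : R) (v : 'rV[R]_(n + p)) :=
  [/\ edot (lsubmx v) (lsubmx v) = 1,
      forall i, pev (h i) (s *: lsubmx v) = s ^+ r.+1 * rsubmx v 0 i,
      edot (rsubmx v) (rsubmx v) <= w ^+ 2 &
      exists a : 'rV[R]_p, edot (a *m pjac (s *: lsubmx v)) (a *m pjac (s *: lsubmx v)) = 1 /\
         eps <= edot (a *m pjac (s *: lsubmx v)) (lsubmx v)].

(** Norms enter [bad_family] through their squares, so each clause is a polynomial condition; the
    quantifier over [i] is a finite conjunction, and only the one over [a] ranges over [R]. *)
Lemma safamily_bad w eps : safamily (bad_family w eps).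
Proof.
move=> k sigma eta sk ek.
pose y e : 'rV[R]_n := lsubmx (\row_j eta j e); pose u e : 'rV[R]_p := rsubmx (\row_j eta j e).
have yk j : saterm k (fun e => y e 0 j) by apply: eq_saterm (ek (lshift p j)) => e; rewrite !mxE.
have uk j : saterm k (fun e => u e 0 j) by apply: eq_saterm (ek (rshift n j)) => e; rewrite !mxE.
have xk j : saterm k (fun e => (sigma e *: y e) 0 j).
  by apply: eq_saterm (satermM sk (yk j)) => e; rewrite [RHS]mxE.
have Nk j : saterm (k + p) (fun e =>
    ((\row_i e`_(k + i)) *m pjac (sigma (take k e) *: y (take k e))) 0 j).
  apply: (@eq_saterm _ _ (fun e => \sum_(i < p) e`_(k + i) *
    pev (mpoly.mderiv j (h i)) (sigma (take k e) *: y (take k e)))) => [e|].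
    by rewrite [RHS]mxE; apply: eq_bigr => i _; rewrite !mxE.
  apply: saterm_sum => i; apply: satermM; first exact: saterm_var.
  apply: (@saterm_take _ k p (fun e => pev (mpoly.mderiv j (h i)) (sigma e *: y e))).
  exact: saterm_pev.
have {}yk' j : saterm (k + p) (fun e => y (take k e) 0 j) by exact: (saterm_take p (yk j)).
apply: (@eq_sadef _ _ (fun e => (edot (y e) (y e) = 1 /\
    forall i, pev (h i) (sigma e *: y e) = sigma e ^+ r.+1 * u e 0 i) /\
  (edot (u e) (u e) <= w ^+ 2 /\ exists a : 'rV[R]_p,
    edot (a *m pjac (sigma e *: y e)) (a *m pjac (sigma e *: y e)) = 1 /\
    eps <= edot (a *m pjac (sigma e *: y e)) (y e)))) => [e _|].
  by split=> [[[h1 h2] [h3 h4]]|[h1 h2 h3 h4]].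
apply: sadef_and; apply: sadef_and.
- by apply: sadef_eq; [exact: saterm_edot|exact: saterm_cst].
- apply: sadef_all => i; apply: sadef_eq; first exact: saterm_pev.
  by apply: satermM => //; exact: satermX.
- by apply: sadef_le; [exact: saterm_edot|exact: saterm_cst].
- apply: (@sadef_ex _ k p (fun e a => _ /\ _)).
  apply: sadef_and; [apply: sadef_eq|apply: sadef_le]; try exact: saterm_cst; exact: saterm_edot.
Qed.

(** With t = s^r it bounds the growth of s^k over one step, as s + s^(r+1) = s (1 + s^r). *)
Lemma exprD1_le (t : R) k : 0 <= t -> t <= 1 -> (1 + t) ^+ k - 1 <= 2 ^+ k * t.
Proof.
move=> t0 t1; elim: k => [|k IH]; first by rewrite !expr0 subrr mul1r.
have H : (1 + t) ^+ k <= 2 ^+ k by rewrite lerXn2r ?nnegrE; lra.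
rewrite !exprS mulrDl mul1r.
have := ler_wpM2l t0 H; lra.
Qed.

(** If every [alpha] fails, [bad_family] is non-empty for arbitrarily small s, and [slow_selection]
    gives two bad points at neighbouring parameters. On the displacement between them a dh(x) is at
    least 3/4 eps s^(r+1) by badness and at most 1/4 eps s^(r+1) by the change of h. *)
Lemma angle (w eps : R) : 0 <= w -> 0 < eps ->
  (forall eta : R, 0 < eta ->
  exists2 alpha : R, 0 < alpha & forall x : 'rV[R]_n, x != 0 -> enorm x < alpha ->
    enorm (poly_map h x) <= w * enorm x ^+ r.+1 ->
    forall a : 'rV[R]_p, enorm x ^+ r * `|a| <= eta * enorm (a *m pjac x)) ->
  exists2 alpha : R, 0 < alpha & forall x : 'rV[R]_n, x != 0 -> enorm x < alpha ->
    enorm (poly_map h x) <= w * enorm x ^+ r.+1 ->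
    forall a : 'rV[R]_p,
      `|edot (a *m pjac x) x| <= eps * enorm (a *m pjac x) * enorm x.
Proof.
move=> w0 eps0 h_big; apply: contrapT => nalpha.
have bad : ~ eventually0 (fun s => ~ exists y, bad_family w eps s y).
  move=> [s0 s0_gt0 sH]; apply: nalpha; exists s0 => // x x0 xs0 xw a.
  rewrite leNgt; apply/negP => aH; have ex0 := enorm_gt0 x0.
  apply: (sH _ ex0 xs0).
  set N := a *m pjac x in aH.
  have N0 : 0 < enorm N.
    apply: enorm_gt0; apply/eqP => N0; move: aH.
    by rewrite N0 edot0l normr0 enorm0 mulr0 mul0r ltxx.
  (* Normalises a dh(x); the sign turns the absolute value of the negated conclusion into the
     one-sided bound of [bad_family]. *)
  pose c := Num.sg (edot N x) / enorm N.
  pose y : 'rV[R]_n := (enorm x)^-1 *: x.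
  pose u : 'rV[R]_p := (enorm x ^+ r.+1)^-1 *: poly_map h x.
  have xy : enorm x *: y = x by rewrite scalerA divff ?scale1r// gt_eqF.
  have er0 : 0 < enorm x ^+ r.+1 by exact: exprn_gt0.
  have eN : edot N x != 0.
    apply: contraL aH => /eqP ->; rewrite normr0 -leNgt.
    by rewrite !mulr_ge0// ?enorm_ge0// ltW.
  exists (row_mx y u); rewrite /bad_family row_mxKl row_mxKr xy; split.
  - by rewrite -sqr_enorm enormZ ger0_norm ?invr_ge0 ?enorm_ge0// mulVf ?gt_eqF// expr1n.
  - by move=> i; rewrite !mxE mulrA divff ?mul1r// gt_eqF.
  - have uw : enorm u <= w.
      rewrite enormZ ger0_norm ?invr_ge0; last exact: ltW.
      by rewrite ler_pdivrMl// mulrC.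
    by rewrite -sqr_enorm lerXn2r ?nnegrE ?enorm_ge0.
  - exists (c *: a); rewrite -scalemxAl -/N; split.
      rewrite -sqr_enorm enormZ /c normrM normr_sg eN mul1r.
      by rewrite ger0_norm ?invr_ge0 ?enorm_ge0// mulVf ?gt_eqF// expr1n.
    rewrite edotZl edotZr /c.
    rewrite [leRHS](_ : _ = `|edot N x| / enorm N / enorm x); last first.
      by rewrite normrEsg; ring.
    by rewrite !ler_pdivlMr//; rewrite mulrAC; exact: ltW.
have [K [K0 Krem]] : exists K : R, 0 <= K /\ forall i (x v : 'rV[R]_n), `|x| <= 2 -> `|x + v| <= 2 ->
    `|pev (h i) (x + v) - pev (h i) x - edot (pgrad (h i) x) v| <= K * `|v| ^+ 2.
  have /choice[Kf KfP] := fun i => poly_remainder 2 (h i).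
  exists (\sum_i Kf i); split=> [|i x v x2 xv2].
    by apply: sumr_ge0 => i _; case: (KfP i).
  have [_ _ _ _ H] := KfP i; apply: (le_trans (H x v x2 xv2)).
  rewrite ler_wpM2r ?sqr_ge0// (bigD1 i)//= lerDl.
  by apply: sumr_ge0 => j _; case: (KfP j).
(* The drift allowed to y and u. The factor [n.+1] pays for passing from the sup norm to the
   Euclidean norm, and 8 leaves a loss of eps/4 in [low]. *)
pose eps2 := eps / (8 * n.+1%:R).
have n1_gt0 : 0 < n.+1%:R :> R by rewrite ltr0n.
have eps2_gt0 : 0 < eps2 by rewrite divr_gt0// mulr_gt0.
have eps2E : n%:R * eps2 <= eps / 8.
  have <- : n.+1%:R * eps2 = eps / 8 by rewrite /eps2; field; rewrite gt_eqF.
  by rewrite ler_wpM2r ?ler_nat// ltW.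
(* Bound of dh_i(x) D relative to s^(2r+1): the first summand comes from the change of h_i between
   the two points, the second from the Taylor remainder. *)
pose L := 2 ^+ r.+1 * (eps2 + w) + K * (2 * eps2 + 1) ^+ 2.
have two_gt0 : 0 < 2 ^+ r.+1 :> R by exact: exprn_gt0.
have L0 : 0 <= L.
  by rewrite addr_ge0// mulr_ge0// ?sqr_ge0// ?addr_ge0// ltW.
(* Chosen for p L eta <= eps/4, so that [up] contradicts [low]. *)
pose eta := eps / (4 * (p%:R * L + 1)).
have pL : 0 < p%:R * L + 1 by rewrite ltr_wpDl// mulr_ge0.
have eta_gt0 : 0 < eta by rewrite divr_gt0// mulr_gt0.
have etaE : p%:R * L * eta <= eps / 4.
  rewrite /eta invfM (_ : _ * _ = eps / 4 * (p%:R * L / (p%:R * L + 1))); last by ring.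
  by apply: ler_piMr; [lra|rewrite ler_pdivrMr// mul1r lerDl].
have [alpha alpha_gt0 big] := h_big eta eta_gt0.
have vB s v i : bad_family w eps s v -> `|v 0 i| <= 1 + w.
  move=> [y1 _ u1 _].
  have y2 : `|lsubmx v| <= 1.
    by apply: (le_trans (norm_le_enorm _)); rewrite /enorm y1 sqrtr1.
  have u2 : `|rsubmx v| <= w.
    apply: (le_trans (norm_le_enorm _)).
    by rewrite -(@ler_pXn2r _ 2)// ?nnegrE ?enorm_ge0// sqr_enorm.
  rewrite -[v]hsubmxK mxE; case: splitP => j _.
    by apply: (le_trans (coord_le_norm _ _ _)); lra.
  by apply: (le_trans (coord_le_norm _ _ _)); lra.
have := slow_selection r (@safamily_bad w eps) bad vB eps2_gt0.
move=> /(ev0_and (ev0_and (ev0_lt ltr01) (ev0_lt alpha_gt0)))/ev0_ex.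
move=> [s s_gt0 [[s_lt1 s_alpha] [v [v' [[y1 hu u1 [a [a1 aeps]]] [y'1 hu' _ _] vv']]]]].
set s' := s + s ^+ r.+1 in hu' y'1.
move: y1 hu u1 a1 aeps; set y := lsubmx v; set u := rsubmx v; set x := s *: y.
set N := a *m pjac x => y1 hu u1 a1 aeps.
move: y'1 hu'; set y' := lsubmx v'; set u' := rsubmx v' => y'1 hu'.
have ey : enorm y = 1 by rewrite /enorm y1 sqrtr1.
have ex : enorm x = s by rewrite enormZ ey mulr1 gtr0_norm.
have x0 : x != 0 by apply: contraTneq s_gt0 => x0; rewrite -ex x0 enorm0 ltxx.
have eN : enorm N = 1 by rewrite /enorm a1 sqrtr1.
have sr_gt0 : 0 < s ^+ r by exact: exprn_gt0.
have sr1_gt0 : 0 < s ^+ r.+1 by exact: exprn_gt0.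
have eu : enorm u <= w.
  by rewrite -(@ler_pXn2r _ 2)// ?nnegrE ?enorm_ge0// sqr_enorm.
have aE : s ^+ r * `|a| <= eta.
  rewrite -[leRHS]mulr1 -eN -ex; apply: big; rewrite ?ex//.
  rewrite (_ : poly_map h x = s ^+ r.+1 *: u).
    by rewrite enormZ gtr0_norm// mulrC ler_wpM2r// ltW.
  by apply/rowP => i; rewrite [LHS]mxE [RHS]mxE -hu.
have s's : s' <= 2 * s.
  have : s * s ^+ r <= s by apply: ler_piMr; [exact: ltW|apply: exprn_ile1; exact: ltW].
  by rewrite /s' exprS; lra.
have dy : `|y' - y| <= eps2 * s ^+ r.
  apply: norm_le_coord => [|i0 j]; first by rewrite mulr_ge0// ltW.
  by rewrite ord1 !mxE distrC; exact: vv'.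
have du i : `|u' 0 i - u 0 i| <= eps2 * s ^+ r.
  by rewrite !mxE distrC; exact: vv'.
have y_le : `|y| <= 1 by rewrite -ey norm_le_enorm.
have y'_le : `|y'| <= 1.
  by apply: (le_trans (norm_le_enorm _)); rewrite /enorm y'1 sqrtr1.
have s'_gt0 : 0 < s' by rewrite addr_gt0.
(* D joins the bad point x to the bad point of parameter s'. Badness bounds
   <N, D> below by about eps * s^(r+1), while h changes only by
   O(s^r * s^(r+1)) and s^r |a| is small. *)
pose D := s' *: (y' - y) + s ^+ r.+1 *: y.
have xD : x + D = s' *: y'.
  by apply/rowP => j; rewrite /D /x !mxE /s'; ring.
have D_le : `|D| <= (2 * eps2 + 1) * s ^+ r.+1.
  apply: (le_trans (ler_normD _ _)); rewrite !normrZ !gtr0_norm//.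
  have := ler_pM (ltW s'_gt0) (normr_ge0 _) s's dy.
  have := ler_wpM2l (ltW sr1_gt0) y_le; rewrite exprS; lra.
have low : s ^+ r.+1 * (eps - 2 * (n%:R * eps2)) <= edot N D.
  rewrite /D edotDr !edotZr.
  have := ler_wpM2l (ltW sr1_gt0) aeps.
  have : `|edot N (y' - y)| <= n%:R * (eps2 * s ^+ r).
    apply: (le_trans (edot_le _ _)); rewrite eN mul1r.
    by apply: (le_trans (enorm_le_norm _)); rewrite ler_wpM2l.
  move=> /(ler_pM (ltW s'_gt0) (normr_ge0 _) s's).
  have := ler_norm (- (s' * edot N (y' - y))); rewrite normrN normrM (gtr0_norm s'_gt0).
  rewrite exprS; lra.
have up : edot N D <= p%:R * L * eta * s ^+ r.+1.
  rewrite /N pjacE; apply: (@le_trans _ _ (\sum_(i < p) L * eta * s ^+ r.+1)); last first.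
    by rewrite sumr_const card_ord -[leLHS]mulr_natl !mulrA.
  apply: ler_sum => i _; apply: (le_trans (ler_norm _)); rewrite normrM.
  have gi : `|edot (pgrad (h i) x) D| <= L * (s ^+ r * s ^+ r.+1).
    have xx : `|x| <= 2 by have := norm_le_enorm x; rewrite ex; lra.
    have xxD : `|x + D| <= 2.
      rewrite xD normrZ gtr0_norm//.
      by have := ler_wpM2l (ltW s'_gt0) y'_le; lra.
    have := Krem i x D xx xxD; rewrite xD hu hu'.
    have H1 : `|s' ^+ r.+1 * u' 0 i - s ^+ r.+1 * u 0 i| <=
        2 ^+ r.+1 * (eps2 + w) * (s ^+ r * s ^+ r.+1).
      have s'r : 0 <= s' ^+ r.+1 <= 2 ^+ r.+1 * s ^+ r.+1.
        apply/andP; split; first by apply/exprn_ge0/ltW.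
        by rewrite -exprMn lerXn2r ?nnegrE//; lra.
      have {s'r}/andP[s'r0 s'r] := s'r.
      have s'r1 : 0 <= s' ^+ r.+1 - s ^+ r.+1 <= s ^+ r.+1 * (2 ^+ r.+1 * s ^+ r).
        have -> : s' = s * (1 + s ^+ r) by rewrite /s' exprS mulrDr mulr1.
        rewrite exprMn -{2}[s ^+ r.+1]mulr1 -{4}[s ^+ r.+1]mulr1 -mulrBr.
        rewrite mulr_ge0 ?(ltW sr1_gt0)//=; last first.
          by rewrite subr_ge0 exprn_ege1// lerDl ltW.
        by rewrite ler_wpM2l ?(ltW sr1_gt0)// exprD1_le ?exprn_ile1// ltW.
      have {s'r1}/andP[s'r2 s'r1] := s'r1.
      rewrite (_ : _ - _ = s' ^+ r.+1 * (u' 0 i - u 0 i) +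
        (s' ^+ r.+1 - s ^+ r.+1) * u 0 i); last by ring.
      apply: (le_trans (ler_normD _ _)); rewrite !normrM (ger0_norm s'r0) (ger0_norm s'r2).
      have B1 := ler_pM s'r0 (normr_ge0 _) s'r (du i).
      have ui : `|u 0 i| <= w.
        apply: le_trans eu; apply: le_trans (norm_le_enorm _); exact: coord_le_norm.
      have B2 := ler_pM s'r2 (normr_ge0 _) s'r1 ui.
      apply: (le_trans (lerD B1 B2)).
      by rewrite le_eqVlt; apply/orP; left; apply/eqP; ring.
    have H2 : K * `|D| ^+ 2 <= K * (2 * eps2 + 1) ^+ 2 * (s ^+ r * s ^+ r.+1).
      rewrite -mulrA ler_wpM2l//.
      have := ler_pM (normr_ge0 D) (normr_ge0 D) D_le D_le.
      rewrite -!expr2 exprMn => /le_trans; apply; rewrite ler_wpM2l ?sqr_ge0//.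
      rewrite expr2 ler_wpM2r ?(ltW sr1_gt0)// exprS ler_piMl ?ltW//.
    move=> /le_trans/(_ H2) H3.
    rewrite (_ : edot _ _ = (s' ^+ r.+1 * u' 0 i - s ^+ r.+1 * u 0 i) -
      (s' ^+ r.+1 * u' 0 i - s ^+ r.+1 * u 0 i - edot (pgrad (h i) x) D)); last by ring.
    apply: (le_trans (ler_normB _ _)); rewrite /L mulrDl.
    exact: lerD.
  have ai : `|a 0 i| * s ^+ r <= eta.
    by apply: le_trans aE; rewrite mulrC ler_wpM2l ?coord_le_norm// ltW.
  apply: (@le_trans _ _ (`|a 0 i| * (L * (s ^+ r * s ^+ r.+1)))).
    exact: ler_wpM2l.
  have LS : 0 <= L * s ^+ r.+1 by rewrite mulr_ge0// ltW.
  have := ler_wpM2l LS ai; lra.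
have := le_trans low up; rewrite mulrC ler_pM2r//; lra.
Qed.
End Angle.

(** * Calculus of C^k maps *)

Section DiffEps.
Variables (R : realType) (V W : normedModType R).
Implicit Types (f g : V -> W).

Lemma diff_epsP f x (L : {linear V -> W}) : continuous L ->
  (forall e, 0 < e -> \forall h \near (0 : V), `|f (h + x) - f x - L h| <= e * `|h|) ->
  differentiable f x /\ 'd f x = L :> (V -> W).
Proof.
move=> cL H.
have E : f \o shift x = cst (f x) + L +o_ (0 : V) id.
  apply/eqaddoP => e e0; near=> h.
  have : `|f (h + x) - f x - L h| <= e * `|h| by near: h; exact: H.
  by rewrite !fctE /= opprD addrA.
have dE := diff_unique cL E; split=> //.
by apply/diff_locallyP; rewrite dE; split.
Unshelve. all: by end_near. Qed.

Lemma diff_eps f x : differentiable f x ->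
  forall e, 0 < e -> \forall h \near (0 : V),
    `|f (h + x) - f x - 'd f x h| <= e * `|h|.
Proof.
move=> /diff_locally /eqaddoP H e e0; near=> h.
have : `|(f \o shift x - (cst (f x) + 'd f x)) h| <= e * `|h| by near: h; exact: H.
by rewrite !fctE /= opprD addrA.
Unshelve. all: by end_near. Qed.

Lemma near_eq_diff f g x : (\forall y \near x, f y = g y) -> differentiable f x ->
  differentiable g x /\ 'd g x = 'd f x :> (V -> W).
Proof.
move=> fg df; apply: diff_epsP; first exact: (diff_continuous df).
move=> e e0; have fgx := nbhs_singleton fg.
have {}fg : \forall h \near (0 : V), f (h + x) = g (h + x).
  by move: fg; rewrite (near_shift 0) /=; by apply: filterS => h; rewrite subr0.
by near=> h; rewrite -fgx -(near fg)//; near: h; exact: diff_eps.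
Unshelve. all: by end_near. Qed.

End DiffEps.

Section CkGeneral.
Variables (R : realType) (V : normedModType R).
Implicit Types (W : normedModType R) (U : set V).

Lemma Ck_cts W k U (f : V -> W) : Ck k U f -> forall x, U x -> {for x, continuous f}.
Proof. by case: k => [//|k] [fd _] x Ux; exact/differentiable_continuous/fd. Qed.

Lemma Ck_subset W k U U' (f : V -> W) : U' `<=` U -> Ck k U f -> Ck k U' f.
Proof.
move=> U'U; elim: k f => [|k IH] f /=; first by move=> H x /U'U/H.
by move=> [fd fD]; split=> [x /U'U/fd//|v]; apply: IH.
Qed.

(** The sets [U'] need not be open: [Ck] refers to differentiability in the ambient space, point by
    point. *)
Lemma Ck_local W k U (f : V -> W) :
  (forall x, U x -> exists2 U', U' x & Ck k U' f) -> Ck k U f.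
Proof.
elim: k f => [|k IH] f /=; first by move=> H x /H[U' U'x]; exact.
move=> H; split=> [x /H[U' U'x [fd _]]|v]; first exact: fd.
by apply: IH => x /H[U' U'x [_ fD]]; exists U'.
Qed.

Lemma Ck_ext W k U (f g : V -> W) : open U -> (forall x, U x -> f x = g x) ->
  Ck k U f -> Ck k U g.
Proof.
move=> oU; have Un (h1 h2 : V -> W) : (forall x, U x -> h1 x = h2 x) ->
    forall x, U x -> \forall y \near x, h1 y = h2 y.
  move=> h12 x Ux; have : nbhs x U by apply: open_nbhs_nbhs.
  by apply: filterS => y; exact: h12.
elim: k f g => [|k IH] f g fg /=.
  move=> fc x Ux; have gf := Un _ _ fg x Ux.
  change (g @ x --> g x); rewrite -fg//; apply: cvg_trans (fc x Ux).
  by apply: near_eq_cvg.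
move=> [fd fD]; split=> [x Ux|v].
  by have [] := near_eq_diff (Un _ _ fg x Ux) (fd x Ux).
apply: IH (fD v) => x Ux; apply: near_eq_derive; exact: Un.
Qed.

Lemma Ck_eq W k U (f g : V -> W) : f =1 g -> Ck k U f -> Ck k U g.
Proof. by move=> /funext ->. Qed.

Lemma CkW W k U (f : V -> W) : Ck k.+1 U f -> Ck k U f.
Proof.
elim: k f => [|k IH] f [fd fD]; first by move=> x Ux; exact/differentiable_continuous/fd.
by split=> // v; exact: IH.
Qed.

Lemma Ck_le W k l U (f : V -> W) : (k <= l)%N -> Ck l U f -> Ck k U f.
Proof.
move=> /subnK <-; by elim: (l - k)%N => [//|m IH] fk; apply/IH/CkW; rewrite -addSn.
Qed.

Lemma Ck_cst W k U (w : W) : Ck k U (fun=> w).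
Proof.
elim: k w => [|k IH] w; first by move=> x _; exact: cvg_cst.
split=> [x _|v]; first exact: differentiable_cst.
by apply: Ck_eq (IH 0) => x; rewrite derive_cst.
Qed.

Lemma Ck_linear W k U (L : {linear V -> W}) : continuous L -> Ck k U L.
Proof.
move=> cL; case: k => [|k]; first by move=> x _; exact: cL.
split=> [x _|v]; first exact: linear_differentiable.
apply: Ck_eq (Ck_cst k U (L v)) => x.
by rewrite deriveE ?diff_lin//; exact: linear_differentiable.
Qed.

Lemma Ck_id k U : Ck k U id.
Proof.
case: k => [|k]; first by move=> x _; exact: cvg_id.
split=> [x _|v]; first by apply: ex_diff.
by apply: Ck_eq (Ck_cst k U v) => x; rewrite derive_id.
Qed.

Lemma CkD W k U (f g : V -> W) : open U -> Ck k U f -> Ck k U g -> Ck k U (fun x => f x + g x).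
Proof.
move=> oU; elim: k f g => [|k IH] f g.
  by move=> fc gc x Ux; apply: cvgD; [exact: fc|exact: gc].
move=> [fd fD] [gd gD]; split=> [x Ux|v]; first by apply: differentiableD; [exact: fd|exact: gd].
apply: Ck_ext (IH _ _ (fD v) (gD v)) => // x Ux.
by rewrite -deriveD//; apply: diff_derivable; [exact: fd|exact: gd].
Qed.

Lemma Ck_sum W k U (I : Type) (s : seq I) (P : pred I) (f : I -> V -> W) : open U ->
  (forall i, Ck k U (f i)) -> Ck k U (fun x => \sum_(i <- s | P i) f i x).
Proof.
move=> oU fk; elim: s => [|i s IH].
  by apply: Ck_eq (Ck_cst k U 0) => x; rewrite big_nil.
apply: (@Ck_eq _ _ _ (fun x => if P i then f i x + \sum_(i <- s | P i) f i x else
  \sum_(i <- s | P i) f i x)); first by move=> x; rewrite big_cons.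
by case: (P i) => //; exact: CkD.
Qed.

Lemma Ck_linear_comp W W' k U (L : {linear W -> W'}) (f : V -> W) : continuous L ->
  open U -> Ck k U f -> Ck k U (fun x => L (f x)).
Proof.
move=> cL oU; elim: k f => [|k IH] f.
  by move=> fc x Ux; apply: (@continuous_comp _ _ _ f L) => //; [exact: fc|exact: cL].
move=> [fd fD]; split=> [x Ux|v].
  by apply: (@differentiable_comp _ _ _ _ f L); [exact: fd|exact: linear_differentiable].
apply: Ck_ext (IH _ (fD v)) => // x Ux.
have dL := linear_differentiable (f x) cL.
rewrite (deriveE _ (differentiable_comp (fd x Ux) dL)) (diff_comp (fd x Ux) dL) /=.
by rewrite diff_lin// deriveE//; exact: fd.
Qed.

Lemma CkN W k U (f : V -> W) : open U -> Ck k U f -> Ck k U (fun x => - f x).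
Proof.
by move=> oU; apply: (@Ck_linear_comp _ _ _ _ [the {linear W -> W} of -%R]) => // x; apply: opp_continuous.
Qed.

Lemma CkB W k U (f g : V -> W) : open U -> Ck k U f -> Ck k U g -> Ck k U (fun x => f x - g x).
Proof. by move=> oU fk gk; apply: CkD => //; exact: CkN. Qed.

Lemma CkM k U (f g : V -> R^o) : open U -> Ck k U f -> Ck k U g ->
  Ck k U (fun x => f x * g x : R^o).
Proof.
move=> oU; elim: k f g => [|k IH] f g.
  by move=> fc gc x Ux; apply: (@continuousM R V f g x); [exact: fc|exact: gc].
move=> fk gk; have [fd fD] := fk; have [gd gD] := gk.
split=> [x Ux|v]; first by apply: differentiableM; [exact: fd|exact: gd].
apply: (@Ck_ext _ _ _ (fun x => f x * 'D_v g x + g x * 'D_v f x : R^o)) => //.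
  move=> x Ux; rewrite deriveM//; apply: diff_derivable; [exact: fd|exact: gd].
by apply: CkD => //; apply: IH; [exact: CkW|exact: gD|exact: CkW|exact: fD].
Qed.

Lemma Ck_prod k U (I : Type) (s : seq I) (P : pred I) (f : I -> V -> R^o) : open U ->
  (forall i, Ck k U (f i)) -> Ck k U (fun x => \prod_(i <- s | P i) f i x : R^o).
Proof.
move=> oU fk; elim: s => [|i s IH].
  by apply: Ck_eq (Ck_cst k U (1 : R^o)) => x; rewrite big_nil.
apply: (@Ck_eq R^o _ _ (fun x => if P i then f i x * \prod_(i <- s | P i) f i x else
  \prod_(i <- s | P i) f i x)); first by move=> x; rewrite big_cons.
by case: (P i) => //; exact: CkM.
Qed.

Lemma Ck_inv k U (f : V -> R^o) : open U -> (forall x, U x -> f x != 0) ->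
  Ck k U f -> Ck k U (fun x => (f x)^-1 : R^o).
Proof.
move=> oU f0; elim: k => [|k IH].
  by move=> fc x Ux; apply: (@continuousV R V f x); [exact: f0|exact: fc].
move=> fk; have [fd fD] := fk; have fVk := IH (CkW fk).
split=> [x Ux|v]; first by apply: differentiableV; [exact: fd|exact: f0].
apply: (@Ck_ext _ _ _ (fun x => - ((f x)^-1 * (f x)^-1 * 'D_v f x) : R^o)) => //.
  move=> x Ux; have df : derivable f x v by exact/diff_derivable/fd.
  by rewrite (deriveV (f0 x Ux) df) scaleNr expr2 invfM.
by apply: CkN => //; apply: CkM => //; [exact: CkM|exact: fD].
Qed.

Section Matrix.
Variables (m n : nat).

Definition coordmx i j (A : 'M[R]_(m, n)) : R^o := A i j.

Lemma coordmx_is_linear i j : linear (coordmx i j).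
Proof. by move=> a A B; rewrite /coordmx !mxE. Qed.

HB.instance Definition _ i j := GRing.isLinear.Build R 'M[R]_(m, n) R^o _
  (coordmx i j) (coordmx_is_linear i j).

Lemma Ck_coord k U (f : V -> 'M[R]_(m, n)) i j : open U -> Ck k U f ->
  Ck k U (fun x => f x i j : R^o).
Proof.
move=> oU fk.
apply: (@Ck_linear_comp _ _ k U (coordmx i j) f) => //.
exact: coord_continuous.
Qed.

Definition scalemx_l (A : 'M[R]_(m, n)) (a : R^o) := a *: A.

Lemma scalemx_l_is_linear A : linear (scalemx_l A).
Proof. by move=> a b c; rewrite /scalemx_l scalerDl scalerA. Qed.

HB.instance Definition _ A := GRing.isLinear.Build R R^o 'M[R]_(m, n) _
  (scalemx_l A) (scalemx_l_is_linear A).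

Lemma Ck_mx k U (f : V -> 'M[R]_(m, n)) : open U ->
  (forall i j, Ck k U (fun x => f x i j : R^o)) -> Ck k U f.
Proof.
move=> oU fk.
apply: (@Ck_eq _ _ _ (fun x => \sum_i \sum_j f x i j *: delta_mx i j)).
  by move=> x; rewrite -matrix_sum_delta.
apply: Ck_sum => // i; apply: Ck_sum => // j.
apply: (@Ck_linear_comp _ _ k U (scalemx_l (delta_mx i j)) (fun x => f x i j : R^o)) => //.
by move=> a; exact: scalel_continuous.
Qed.

Lemma CkZ k U (c : V -> R^o) (f : V -> 'M[R]_(m, n)) : open U ->
  Ck k U c -> Ck k U f -> Ck k U (fun x => c x *: f x).
Proof.
move=> oU ck fk; apply: Ck_mx => // i j.
apply: (@Ck_eq R^o _ _ (fun x => c x * f x i j)); first by move=> x; rewrite mxE.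
by apply: CkM => //; exact: Ck_coord.
Qed.

End Matrix.

Lemma Ck_trmx m n k U (f : V -> 'M[R]_(m, n)) : open U -> Ck k U f ->
  Ck k U (fun x => (f x)^T).
Proof.
move=> oU fk; apply: Ck_mx => // i j.
by apply: Ck_eq (Ck_coord j i oU fk) => x; rewrite mxE.
Qed.

Lemma Ck_mulmx m n p k U (f : V -> 'M[R]_(m, n)) (g : V -> 'M[R]_(n, p)) : open U ->
  Ck k U f -> Ck k U g -> Ck k U (fun x => f x *m g x).
Proof.
move=> oU fk gk; apply: Ck_mx => // i j.
apply: (@Ck_eq R^o _ _ (fun x => \sum_l f x i l * g x l j)); first by move=> x; rewrite mxE.
by apply: Ck_sum => // l; apply: CkM => //; exact: Ck_coord.
Qed.

Lemma Ck_det n k U (f : V -> 'M[R]_n) : open U -> Ck k U f ->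
  Ck k U (fun x => \det (f x) : R^o).
Proof.
move=> oU fk; apply: Ck_sum => // s; apply: CkM => //; first exact: Ck_cst.
by apply: Ck_prod => // i; exact: Ck_coord.
Qed.

Lemma Ck_invmx n k U (f : V -> 'M[R]_n) : open U -> (forall x, U x -> f x \in unitmx) ->
  Ck k U f -> Ck k U (fun x => invmx (f x)).
Proof.
move=> oU fu fk.
apply: (@Ck_ext _ _ _ (fun x => (\det (f x))^-1 *: \adj (f x))) => //.
  by move=> x Ux; rewrite /invmx fu.
apply: CkZ => //.
  apply: Ck_inv => //; last exact: Ck_det.
  by move=> x /fu; rewrite unitmxE unitfE.
apply: Ck_mx => // i j.
apply: (@Ck_eq R^o _ _ (fun x => (-1) ^+ (j + i) * \det (row' j (col' i (f x))))).
  by move=> x; rewrite mxE.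
apply: CkM => //; first exact: Ck_cst.
apply: Ck_det => //; apply: Ck_mx => // a b.
by apply: Ck_eq (Ck_coord _ _ oU fk) => x; rewrite !mxE.
Qed.

(** The chain rule is expanded along the standard basis, so that the outer factors are again scalar
    functions, to which the induction hypothesis applies. *)
Lemma Ck_comp_scalar m k U O (f : V -> 'rV[R]_m) (g : 'rV[R]_m -> R^o) : open U -> open O ->
  (forall x, U x -> O (f x)) -> Ck k U f -> Ck k O g -> Ck k U (fun x => g (f x)).
Proof.
move=> oU oO UO; elim: k g => [|k IH] g.
  by move=> fc gc x Ux; apply: (@continuous_comp _ _ _ f g); [exact: fc|exact/gc/UO].
move=> fk gk; have [fd fD] := fk; have [gd gD] := gk.
split=> [x Ux|v].
  by apply: (@differentiable_comp _ _ _ _ f g); [exact: fd|exact/gd/UO].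
apply: (@Ck_ext _ _ _ (fun x => \sum_j 'D_v f x 0 j *: 'D_(delta_mx 0 j) g (f x))) => //.
  move=> x Ux; have df := fd x Ux; have dg := gd _ (UO x Ux).
  rewrite (deriveE _ (differentiable_comp df dg)) (diff_comp df dg) /= -(deriveE v df).
  rewrite {2}(row_sum_delta ('D_v f x)) linear_sum; apply: eq_bigr => j _.
  by rewrite linearZ (deriveE _ dg).
apply: Ck_sum => // j; apply: CkM => //; first by apply: Ck_coord => //; exact: fD.
exact: (IH (fun y => 'D_(delta_mx 0 j) g y) (CkW fk) (gD _)).
Qed.

Lemma Ck_comp m a b k U O (f : V -> 'rV[R]_m) (g : 'rV[R]_m -> 'M[R]_(a, b)) :
  open U -> open O -> (forall x, U x -> O (f x)) -> Ck k U f ->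
  (forall i j, Ck k O (fun x => g x i j : R^o)) -> Ck k U (fun x => g (f x)).
Proof.
move=> oU oO UO fk gk; apply: Ck_mx => // i j.
exact: (@Ck_comp_scalar _ _ _ O f (fun x => g x i j : R^o)).
Qed.

End CkGeneral.

Section MeanValue.
Variables (R : realType) (V : normedModType R).

Lemma mvt_line (f : V -> R^o) x v :
  (forall t : R, 0 <= t -> t <= 1 -> differentiable f (x + t *: v)) ->
  exists t : R, [/\ 0 <= t, t <= 1 & f (x + v) - f x = 'D_v f (x + t *: v)].
Proof.
move=> fd; pose l (t : R) := x + t *: v; pose g (t : R) : R := f (l t).
have dl t : is_diff t l ( *:%R^~ v).
  by apply: is_diff_eq; apply/funext => h /=; rewrite fctE add0r.
have gd (t : R) : 0 <= t -> t <= 1 -> is_derive (t : R^o) (1 : R^o) (g : R^o -> R^o) ('D_v f (l t)).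
  move=> t0 t1; have dft := fd t t0 t1.
  have dlt : differentiable l t by apply: ex_diff.
  have dg : differentiable g t by apply: (differentiable_comp dlt dft).
  apply: DeriveDef; first exact: diff_derivable.
  rewrite (deriveE _ dg) (_ : g = f \o l)// (diff_comp dlt dft) /= (deriveE _ dft).
  by rewrite diff_val scale1r.
have [| |t] := @MVT_segment R g (fun t => 'D_v f (l t)) 0 1 ler01.
- by move=> t; rewrite in_itv /= => /andP[t0 t1]; apply: gd; exact: ltW.
- apply: derivable_within_continuous => t; rewrite in_itv /= => /andP[t0 t1].
  by have [] := gd t t0 t1.
rewrite in_itv /= subr0 mulr1 /g /l scale1r scale0r addr0 => /andP[t0 t1] E.
by exists t.
Qed.
End MeanValue.

Section InverseFunction.
Variable R : realType.

(* The fixed point is a minimum of |T x - x| on the compact ball. *)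
Lemma fixed_point_ball n (T : 'rV[R]_n -> 'rV[R]_n) x0 (d : R) : 0 <= d ->
  (forall x, `|x - x0| <= d -> `|T x - x0| <= d) ->
  (forall x y, `|x - x0| <= d -> `|y - x0| <= d -> `|T x - T y| <= 2^-1 * `|x - y|) ->
  exists2 p, `|p - x0| <= d & T p = p.
Proof.
move=> d0 TB TL; pose A := [set x : 'rV[R]_n | `|x - x0| <= d].
have cA : compact A.
  apply: bounded_closed_compact.
    exists (`|x0| + d); split; first exact: num_real.
    move=> M lM x /= Ax; rewrite -(subrK x0 x); apply: (le_trans (ler_normD _ _)).
    by apply: ltW; apply: le_lt_trans lM; rewrite addrC lerD2l.
  rewrite (_ : A = closed_ball_ Num.norm x0 d); first exact: closed_closed_ball_.
  by apply/seteqP; split=> x; rewrite /A /closed_ball_ /= distrC.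
have [|||p Ap pmin] := @EVT_min_rV R n (fun x => `|T x - x|) A.
- by exists x0; rewrite /A /= subrr normr0.
- exact: cA.
- apply/subspace_continuousP => x Ax; apply/cvgrPdist_le => e e0.
  have e2 : 0 < e / 2 by lra.
  have : \forall y \near x, `|x - y| <= e / 2.
    by near=> y; near: y; apply: (cvgr_dist_le (fun y => y)) => //; exact: cvg_id.
  rewrite /= near_withinE; apply: filterS => y xy Ay.
  apply: (le_trans (ler_dist_dist _ _)).
  have -> : T x - x - (T y - y) = (T x - T y) - (x - y).
    by apply/rowP => j; rewrite !mxE; ring.
  apply: (le_trans (ler_normB _ _)); have := TL x y Ax Ay; lra.
exists p; first by move: Ap; rewrite inE.
apply: contrapT => /eqP; rewrite -subr_eq0 -normr_gt0 => Tp.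
have Ap' : `|p - x0| <= d by move: Ap; rewrite inE.
have := pmin (T p); rewrite inE => /(_ (TB _ Ap')).
have := TL (T p) p (TB _ Ap') Ap'; lra.
Unshelve. all: by end_near. Qed.

Lemma jacobianE m n (f : 'rV[R]_m -> 'rV[R]_n) x i j : differentiable f x ->
  jacobian f x i j = 'D_(delta_mx 0 i) f x 0 j.
Proof. by move=> df; rewrite deriveEjacobian// -rowE [RHS]mxE. Qed.

Lemma Ck_jacobian m n k (U : set 'rV[R]_m) (f : 'rV[R]_m -> 'rV[R]_n) : open U ->
  Ck k.+1 U f -> Ck k U (fun x => jacobian f x).
Proof.
move=> oU [fd fD]; apply: Ck_mx => // i j.
apply: (@Ck_ext _ _ _ _ _ (fun x => 'D_(delta_mx 0 i) f x 0 j : R^o)) => //.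
  by move=> x /fd df; rewrite jacobianE.
by apply: Ck_coord => //; exact: fD.
Qed.

Lemma derive_coord (V : normedModType R) m n (f : V -> 'M[R]_(m, n)) x v i j :
  differentiable f x -> 'D_v f x i j = 'D_v (fun y => f y i j : R^o) x.
Proof. by move=> df; rewrite derive_mx ?mxE//; exact: diff_derivable. Qed.

Lemma differentiable_coordf (V : normedModType R) m n (f : V -> 'M[R]_(m, n)) x i j :
  differentiable f x -> differentiable (fun y => f y i j : R^o) x.
Proof.
move=> df; apply: (@differentiable_comp _ _ _ _ f (fun A : 'M[R]_(m, n) => A i j : R^o)) => //.
exact: differentiable_coord.
Qed.

Lemma lipschitz_jacobian m n (f : 'rV[R]_m -> 'rV[R]_n) x y (c : R) : 0 <= c ->
  (forall t : R, 0 <= t -> t <= 1 -> differentiable f (x + t *: (y - x)) /\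
     `|jacobian f (x + t *: (y - x))| <= c) ->
  `|f y - f x| <= m%:R * c * `|y - x|.
Proof.
move=> c0 fH; apply: norm_le_coord => [|i j]; first by rewrite !mulr_ge0.
rewrite ord1 !mxE; have [|t [t0 t1]] := @mvt_line R _ (fun z => f z 0 j : R^o) x (y - x).
  by move=> t t0 t1; apply: differentiable_coordf; case: (fH t t0 t1).
have [df dc] := fH t t0 t1; rewrite [x + _]addrC subrK => ->.
rewrite -derive_coord// deriveEjacobian// mxE.
apply: (le_trans (ler_norm_sum _ _ _)).
apply: (@le_trans _ _ (\sum_(l < m) c * `|y - x|)); last first.
  by rewrite sumr_const card_ord -[leLHS]mulr_natl mulrA.
apply: ler_sum => l _; rewrite normrM mulrC; apply: ler_pM => //; last exact: coord_le_norm.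
exact: le_trans (coord_le_norm _ _ _) dc.
Qed.

End InverseFunction.

(** * Inverse function theorem *)

Section InverseFunctionTheorem.
Variable R : realType.

Lemma derive_linear_comp (V W W' : normedModType R) (L : {linear W -> W'}) (f : V -> W) x v :
  continuous L -> differentiable f x ->
  differentiable (fun y => L (f y)) x /\ 'D_v (fun y => L (f y)) x = L ('D_v f x).
Proof.
move=> cL df; have dL := linear_differentiable (f x) cL.
have dLf : differentiable (L \o f) x by exact: differentiable_comp.
split=> //; rewrite (deriveE _ dLf) (diff_comp df dL) /=.
by rewrite diff_lin// deriveE.
Qed.

Lemma mulmxr_continuous a m p (A : 'M[R]_(m, p)) : continuous (mulmxr A : 'M[R]_(a, m) -> _).
Proof.
move=> x; have : Ck 0 setT (fun y : 'M[R]_(a, m) => y *m A).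
  by apply: Ck_mulmx; [exact: openT|exact: Ck_id|exact: Ck_cst].
exact.
Qed.

Lemma derive_mulmxr (V : normedModType R) a m p (A : 'M[R]_(m, p)) (f : V -> 'M[R]_(a, m)) x v :
  differentiable f x ->
  differentiable (fun y => f y *m A) x /\ 'D_v (fun y => f y *m A) x = 'D_v f x *m A.
Proof.
by move=> df; have := @derive_linear_comp _ _ _ (mulmxr A) f x v (@mulmxr_continuous _ _ _ A) df.
Qed.

Lemma jacobianP m p (f : 'rV[R]_m -> 'rV[R]_p) x (B : 'M[R]_(m, p)) : differentiable f x ->
  (forall v, 'D_v f x = v *m B) -> jacobian f x = B.
Proof.
by move=> df fB; apply/row_matrixP => i; rewrite !rowE -deriveEjacobian.
Qed.

Lemma mulmx_norm_le a m p (A : 'M[R]_(a, m)) (B : 'M[R]_(m, p)) :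
  `|A *m B| <= m%:R * `|A| * `|B|.
Proof.
apply: norm_le_coord => [|i j]; first by rewrite !mulr_ge0.
rewrite mxE; apply: (le_trans (ler_norm_sum _ _ _)).
apply: (@le_trans _ _ (\sum_(l < m) `|A| * `|B|)); last first.
  by rewrite sumr_const card_ord -[leLHS]mulr_natl mulrA.
by apply: ler_sum => l _; rewrite normrM; apply: ler_pM => //; exact: coord_le_norm.
Qed.

Lemma cts_ball (V W : normedModType R) (f : V -> W) x (e : R) :
  {for x, continuous f} -> 0 < e ->
  exists2 d : R, 0 < d & forall y, `|y - x| < d -> `|f y - f x| < e.
Proof.
move=> /cvgrPdist_lt/[apply]/nbhs_ballP[d d0 H]; exists d => // y yx.
by rewrite distrC; apply: H; rewrite -ball_normE /= distrC.
Qed.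

Lemma open_ball (V : normedModType R) (O : set V) x : open O -> O x ->
  exists2 d : R, 0 < d & forall y, `|y - x| < d -> O y.
Proof.
move=> oO Ox; have /nbhs_ballP[d d0 H] : nbhs x O by exact: open_nbhs_nbhs.
by exists d => // y yx; apply: H; rewrite -ball_normE /= distrC.
Qed.

Lemma open_normlt (V : normedModType R) x (d : R) : open [set y : V | `|y - x| < d].
Proof.
have [d0|d0] := ltP 0 d; last first.
  rewrite (_ : mkset _ = set0); first exact: open0.
  by apply/seteqP; split=> y //=; rewrite ltNge (le_trans d0).
rewrite (_ : mkset _ = ball x d); first exact: ball_open.
by rewrite -ball_normE; apply/seteqP; split=> y; rewrite /= distrC.
Qed.

Lemma nbhs_normlt (V : normedModType R) (x : V) (d : R) : 0 < d ->
  nbhs x [set y : V | `|y - x| < d].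
Proof.
by move=> d0; apply: open_nbhs_nbhs; split; [exact: open_normlt|rewrite /= subrr normr0].
Qed.

(** With A the inverse of the derivative at x0, the map phi x = x - Psi x A contracts by 1/2 near
    x0. Preimages are fixed points of its translates, and the same contraction makes the inverse
    Lipschitz, which gives injectivity and then differentiability. *)
Theorem inverse_function m k (O : set 'rV[R]_m) (Psi : 'rV[R]_m -> 'rV[R]_m) x0 :
  open O -> O x0 -> Ck k.+1 O Psi -> jacobian Psi x0 \in unitmx ->
  exists (d : R) (chi : 'rV[R]_m -> 'rV[R]_m) (W : set 'rV[R]_m),
  [/\ 0 < d,
      (forall x y, `|x - x0| < d -> `|y - x0| < d -> Psi x = Psi y -> x = y),
      open W /\ W (Psi x0),
      (forall w, W w -> [/\ `|chi w - x0| < d, O (chi w) & Psi (chi w) = w])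
    & Ck k.+1 W chi].
Proof.
move=> oO Ox0 Psik.
have [Psid _] := Psik; have JPk := Ck_jacobian oO Psik.
have [Jf JfE] : {Jf : 'rV[R]_m -> 'M[R]_m | jacobian Psi = Jf} by exists (jacobian Psi).
have JPsi x v : O x -> 'D_v Psi x = v *m Jf x by move=> /Psid/deriveEjacobian ->; rewrite JfE.
rewrite JfE in JPk *; move=> Ju; clear JfE.
have [A JA AJ] : exists2 A, Jf x0 *m A = 1%:M & A *m Jf x0 = 1%:M.
  by exists (invmx (Jf x0)); rewrite ?mulmxV// mulVmx.
have Jc : {for x0, continuous Jf} by apply: (Ck_cts JPk).
pose phi x := x - Psi x *m A.
have phiJ x : O x -> differentiable phi x /\ jacobian phi x = 1%:M - Jf x *m A.
  move=> Ox; have [dA DA] := derive_mulmxr A 0 (Psid x Ox).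
  have dphi : differentiable phi x by apply: differentiableB => //; exact: ex_diff.
  split=> //; apply: jacobianP => // v.
  have [_ DvA] := derive_mulmxr A v (Psid x Ox).
  rewrite deriveB; [|exact: derivable_id|exact: diff_derivable].
  rewrite derive_id DvA JPsi//.
  by rewrite mulmxBr mulmx1 mulmxA.
(* Entrywise bound on the derivative of [phi]; the sup norm costs a factor [m], and m c <= 1/2. *)
pose c : R := (2 * m.+1%:R)^-1.
have c0 : 0 < c by rewrite invr_gt0 mulr_gt0.
have m0 : 0 < m.+1%:R :> R by [].
have mc : m%:R * c <= 2^-1.
  rewrite /c invfM mulrCA ler_piMr// ler_pdivrMr// mul1r ler_nat//.
pose K := m%:R * `|A| + 1.
have K0 : 0 < K by rewrite ltr_wpDl// mulr_ge0.
have [d1 d1_gt0 d1H] := cts_ball Jc (divr_gt0 c0 K0).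
have [d2 d2_gt0 d2H] := open_ball oO Ox0.
pose d := Num.min d1 d2 / 2.
have d12 : 0 < Num.min d1 d2 by rewrite lt_min d1_gt0.
have d_gt0 : 0 < d by rewrite /d; lra.
have dO x : `|x - x0| <= d -> O x.
  move=> xd; apply: d2H; apply: (le_lt_trans xd).
  have : Num.min d1 d2 <= d2 by rewrite ge_min lexx orbT.
  rewrite /d; lra.
have dJ x : `|x - x0| <= d -> `|jacobian phi x| <= c.
  move=> xd; have [_ ->] := phiJ x (dO x xd).
  have -> : 1%:M - Jf x *m A = (Jf x0 - Jf x) *m A.
    by rewrite [RHS]mulmxBl JA.
  apply: (le_trans (mulmx_norm_le (Jf x0 - Jf x) A)).
  have : `|Jf x0 - Jf x| <= c / K.
    rewrite distrC; apply/ltW/d1H; apply: (le_lt_trans xd).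
    have : Num.min d1 d2 <= d1 by rewrite ge_min lexx.
    rewrite /d; lra.
  rewrite ler_pdivlMr// => H; apply: le_trans H; rewrite mulrAC [leLHS]mulrC.
  by rewrite ler_wpM2l// lerDl.
have phiL x y : `|x - x0| <= d -> `|y - x0| <= d -> `|phi x - phi y| <= 2^-1 * `|x - y|.
  move=> xd yd; apply: (@le_trans _ _ (m%:R * c * `|x - y|)); last by rewrite ler_wpM2r.
  apply: lipschitz_jacobian; first exact: ltW.
  move=> t t0 t1; have td : `|y + t *: (x - y) - x0| <= d.
    have -> : y + t *: (x - y) - x0 = t *: (x - x0) + (1 - t) *: (y - x0).
      by apply/rowP => j; rewrite !mxE; ring.
    apply: (le_trans (ler_normD _ _)); rewrite !normrZ !ger0_norm ?subr_ge0//.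
    have := ler_wpM2l t0 xd; have t10 : 0 <= 1 - t by lra.
    by have := ler_wpM2l t10 yd; lra.
  by split; [case: (phiJ _ (dO _ td))|exact: dJ].
have PsiL x y : `|x - x0| <= d -> `|y - x0| <= d -> `|x - y| <= 2 * `|(Psi x - Psi y) *m A|.
  move=> xd yd; have := phiL x y xd yd.
  have -> : phi x - phi y = (x - y) - (Psi x - Psi y) *m A.
    by rewrite /phi mulmxBl; apply/rowP => j; rewrite !mxE; ring.
  have := ler_normD ((x - y) - (Psi x - Psi y) *m A) ((Psi x - Psi y) *m A).
  rewrite subrK; lra.
pose W := [set w : 'rV[R]_m | `|w - Psi x0| < d / 2 / K].
have Wopen : open W by exact: open_normlt.
have WA w : W w -> `|(w - Psi x0) *m A| < d / 2.
  rewrite /W /= ltr_pdivlMr// => H; apply: le_lt_trans H.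
  apply: (le_trans (mulmx_norm_le _ _)); rewrite mulrAC [leLHS]mulrC.
  by rewrite ler_wpM2l// lerDl.
(* As A is invertible, Psi x = w holds exactly when x is fixed by [T]. *)
have sol w : W w -> exists x, `|x - x0| < d /\ Psi x = w.
  move=> Ww; pose T x := phi x + w *m A.
  have Tx0 : `|T x0 - x0| < d / 2.
    rewrite /T /phi (_ : _ - _ = (w - Psi x0) *m A); first exact: WA.
    by rewrite mulmxBl; apply/rowP => j; rewrite !mxE; ring.
  have TT x y : T x - T y = phi x - phi y by rewrite /T opprD addrACA subrr addr0.
  have TB x : `|x - x0| <= d -> `|T x - x0| < d.
    move=> xd; have := phiL x x0 xd; rewrite subrr normr0 (ltW d_gt0) => /(_ isT).
    rewrite -TT => H; have := ler_normD (T x - T x0) (T x0 - x0).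
    rewrite subrKA; lra.
  have [|||p pd Tp] := @fixed_point_ball R m T x0 d.
  - exact: ltW.
  - by move=> x /TB/ltW.
  - by move=> x y xd yd; rewrite TT; exact: phiL.
  exists p; split; first by rewrite -{1}Tp; exact: TB.
  have : (w - Psi p) *m A = 0.
    by rewrite mulmxBl; apply/eqP; rewrite subr_eq0 -(inj_eq (addrI (p - Psi p *m A))) -/(phi p) -/(T p) Tp subrK.
  move=> /(congr1 (mulmx^~ (Jf x0))); rewrite mul0mx -mulmxA AJ mulmx1.
  by move=> /eqP; rewrite subr_eq0 => /eqP.
pose chi w := xget x0 [set x | `|x - x0| < d /\ Psi x = w].
have chiP w : W w -> `|chi w - x0| < d /\ Psi (chi w) = w.
  move=> /sol[x xH].
  exact: (@xgetPex _ x0 [set x | `|x - x0| < d /\ Psi x = w] (ex_intro _ x xH)).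
have chid w : W w -> `|chi w - x0| <= d by move=> /chiP[/ltW].
have chiL w w' : W w -> W w' -> `|chi w - chi w'| <= 2 * K * `|w - w'|.
  move=> Ww Ww'; have := PsiL _ _ (chid _ Ww) (chid _ Ww').
  have [_ ->] := chiP w Ww; have [_ ->] := chiP w' Ww' => /le_trans; apply.
  rewrite -mulrA ler_wpM2l//; apply: (le_trans (mulmx_norm_le _ _)).
  by rewrite mulrAC ler_wpM2r// lerDl.
(* The matrix J A differs from the identity by an operator of norm at most 1/2, so it has no
   kernel. *)
have Juw w : W w -> Jf (chi w) \in unitmx.
  move=> Ww; have := dJ _ (chid _ Ww); have [_ ->] := phiJ _ (dO _ (chid _ Ww)) => H.
  suff : Jf (chi w) *m A \in unitmx by rewrite unitmx_mul => /andP[].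
  rewrite -row_free_unit -kermx_eq0; apply/rowV0P => v /sub_kermxP vJ.
  have : `|v *m (1%:M - Jf (chi w) *m A)| <= 2^-1 * `|v|.
    apply: (le_trans (mulmx_norm_le _ _)).
    rewrite mulrAC; apply: ler_wpM2r => //; apply: le_trans mc.
    by rewrite ler_wpM2l.
  rewrite mulmxBr mulmx1 vJ subr0 => vv.
  by apply/eqP; rewrite -normr_eq0; have := normr_ge0 v; lra.
have chi_diff w : W w -> differentiable chi w /\
    forall v, 'D_v chi w = v *m invmx (Jf (chi w)).
  move=> Ww; set x := chi w; set J := Jf x.
  have Ox : O x by exact/dO/chid.
  suff [dchi chiE] : differentiable chi w /\ 'd chi w = mulmxr (invmx J) :> ('rV[R]_m -> _).
    by split=> // v; rewrite deriveE// chiE.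
  apply: diff_epsP; first exact: mulmxr_continuous.
  move=> e e0; pose K1 := m%:R * `|invmx J| + 1.
  have K1_gt0 : 0 < K1 by rewrite ltr_wpDl// mulr_ge0.
  have KK : 0 < 2 * K * K1 by rewrite !mulr_gt0.
  have := diff_eps (Psid x Ox) (divr_gt0 e0 KK).
  move=> /nbhs_ballP[e1 e1_gt0 He1].
  have [e2 e2_gt0 He2] := open_ball Wopen Ww.
  apply/nbhs_ballP; exists (Num.min e2 (e1 / (2 * K))) => /=.
    by rewrite lt_min e2_gt0 divr_gt0// mulr_gt0.
  move=> h; rewrite -ball_normE /= sub0r normrN lt_min => /andP[h2 h1].
  have Wh : W (h + w) by apply: He2; rewrite addrK.
  set kk := chi (h + w) - x.
  have kkL : `|kk| <= 2 * K * `|h|.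
    by have := chiL _ _ Wh Ww; rewrite addrK.
  have := He1 kk; rewrite -ball_normE /= sub0r normrN.
  have kk1 : `|kk| < e1.
    by apply: (le_lt_trans kkL); rewrite mulrC -ltr_pdivlMr// mulr_gt0.
  move=> /(_ kk1); rewrite /kk subrK; have [_ ->] := chiP _ Wh; have [_ ->] := chiP _ Ww.
  rewrite addrK -/kk -deriveE; last exact: Psid.
  rewrite JPsi//.
  rewrite -/J => H.
  have -> : kk - h *m invmx J = (kk *m J - h) *m invmx J.
    by rewrite [RHS]mulmxBl -mulmxA mulmxV ?Juw// mulmx1.
  rewrite distrC in H; apply: (le_trans (mulmx_norm_le _ _)).
  apply: (@le_trans _ _ (K1 * (e / (2 * K * K1) * `|kk|))).
    rewrite mulrAC ler_pM// ?mulr_ge0// /K1; lra.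
  apply: (@le_trans _ _ (K1 * (e / (2 * K * K1) * (2 * K * `|h|)))).
    by rewrite !ler_wpM2l// ?ltW// divr_gt0.
  rewrite le_eqVlt; apply/orP; left; apply/eqP; field.
  by rewrite !gt_eqF.
exists d, chi, W; split=> //.
- by move=> x y xd yd xy; apply/eqP; rewrite -subr_eq0 -normr_le0;
    have := PsiL x y (ltW xd) (ltW yd); rewrite xy subrr mul0mx normr0 mulr0.
- by split=> //; rewrite /W /= subrr normr0 !divr_gt0.
- by move=> w Ww; have [? ?] := chiP w Ww; split=> //; exact/dO/chid.
(* Bootstrap: the derivative of chi is the inverse of J at chi, so class C^l of chi gives class
   C^(l+1), up to the class of [Psi]. *)
suff H l : (l <= k.+1)%N -> Ck l W chi by exact: H.
elim: l => [|l IH] lk.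
  by move=> w Ww; apply: differentiable_continuous; case: (chi_diff w Ww).
split=> [w /chi_diff[]//|v].
apply: (@Ck_ext _ _ _ _ _ (fun w => v *m invmx (Jf (chi w)))) => //.
  by move=> w /chi_diff[_ ->].
apply: Ck_mulmx => //; first exact: Ck_cst.
apply: Ck_invmx => //.
apply: (@Ck_comp _ _ _ _ _ l W O chi Jf) => //.
- by move=> w Ww; exact/dO/chid.
- by apply: IH; exact: ltnW.
- by move=> i j; apply: Ck_coord => //; apply: Ck_le JPk; rewrite -ltnS.
Qed.

End InverseFunctionTheorem.

(** * Taylor polynomials *)

Section Schwarz.
Variables (R : realType) (V : normedModType R).

Lemma derive_diffZ (f : V -> R^o) x v (c : R) : differentiable f x ->
  'D_(c *: v) f x = c * 'D_v f x.
Proof. by move=> df; rewrite !deriveE// linearZ. Qed.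

Lemma differentiable_shift (f : V -> R^o) (a x : V) : differentiable f (x + a) ->
  differentiable (fun y => f (y + a)) x.
Proof.
move=> df; apply: (@differentiable_comp _ _ _ _ (fun y => y + a) f) => //; exact: differentiableD.
Qed.

Lemma derive_shiftE (f : V -> R^o) (a x v : V) :
  'D_v (fun y => f (y + a)) x = 'D_v f (x + a).
Proof.
rewrite /derive; set F := (X in lim (X @ _)); set G := (X in _ = lim (X @ _)).
by have -> : F = G by apply/funext => h; rewrite /F /G /= addrA.
Qed.

(** Mean value theorem twice: along u for y |-> f (y + s v) - f y, then along v for the derivative
    D_u f. *)
Lemma second_difference (U : set V) (f : V -> R^o) x u v (d : R) (s : R) :
  (forall y, `|y - x| < d -> U y) -> Ck 2 U f -> 0 < s ->
  s * (`|u| + `|v|) < d ->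
  exists y, `|y - x| < d /\
    f (x + s *: u + s *: v) - f (x + s *: u) - f (x + s *: v) + f x =
    s * (s * 'D_v (fun z => 'D_u f z) y).
Proof.
move=> dU [fd fD] s0 sd.
have near_x (t t' : R) : 0 <= t -> t <= 1 -> 0 <= t' -> t' <= 1 ->
    `|x + t *: (s *: u) + t' *: (s *: v) - x| < d.
  move=> t0 t1 t'0 t'1; rewrite -(addrA x) [x + _]addrC addrK.
  apply: le_lt_trans sd; apply: (le_trans (ler_normD _ _)).
  rewrite !normrZ (ger0_norm t0) (ger0_norm t'0) (gtr0_norm s0) mulrDr.
  by apply: lerD; apply: ler_piMl => //; rewrite mulr_ge0// ltW.
pose g (y : V) : R^o := f (y + s *: v) - f y.
have gd t : 0 <= t -> t <= 1 -> differentiable g (x + t *: (s *: u)).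
  move=> t0 t1; apply: differentiableB.
    apply: differentiable_shift; apply/fd/dU.
    by have := near_x t 1 t0 t1 ler01 (lexx _); rewrite scale1r.
  by apply/fd/dU; have := near_x t 0 t0 t1 (lexx _) ler01; rewrite scale0r addr0.
have [t [t0 t1 Et]] := mvt_line gd.
set y1 := x + t *: (s *: u) in Et.
have dy1 (t' : R) : 0 <= t' -> t' <= 1 -> U (y1 + t' *: (s *: v)).
  by move=> t'0 t'1; apply: dU; exact: near_x.
have [fuD _] := fD u.
have [|t' [t'0 t'1 Et']] := @mvt_line R V (fun z => 'D_u f z) y1 (s *: v).
  by move=> t' t'0 t'1; apply/fuD/dy1.
exists (y1 + t' *: (s *: v)); split; first exact: near_x.
rewrite derive_diffZ in Et'; last exact/fuD/dy1.
rewrite -Et' -[LHS](_ : g (x + s *: u) - g x = _); last by rewrite /g; ring.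
have U0 : U y1 by have := dy1 0 (lexx _) ler01; rewrite scale0r addr0.
have U1 : U (y1 + s *: v) by have := dy1 1 ler01 (lexx _); rewrite scale1r.
rewrite Et derive_diffZ; last exact: gd.
congr (_ * _); rewrite /g deriveB.
- by rewrite derive_shiftE.
- by apply/diff_derivable/differentiable_shift/fd.
- exact/diff_derivable/fd.
Qed.

Lemma eq_of_nearby_eq (A B : V -> R^o) x :
  {for x, continuous A} -> {for x, continuous B} ->
  (forall d : R, 0 < d -> exists y z, [/\ `|y - x| < d, `|z - x| < d & A y = B z]) ->
  A x = B x.
Proof.
move=> cA cB H; apply/eqP; apply/negPn/negP => neq.
have e0 : 0 < `|A x - B x| / 2 by rewrite divr_gt0// normr_gt0 subr_eq0.
have [d1 d1_gt0 H1] := cts_ball cA e0.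
have [d2 d2_gt0 H2] := cts_ball cB e0.
have [|y [z [yd zd E]]] := H (Num.min d1 d2); first by rewrite lt_min d1_gt0.
have ya : `|y - x| < d1 by apply: (lt_le_trans yd); rewrite ge_min lexx.
have zb : `|z - x| < d2 by apply: (lt_le_trans zd); rewrite !ge_min lexx orbT.
have := H1 y ya; have := H2 z zb; rewrite E => h1 h2.
have := ler_normB (B z - B x) (B z - A x).
by rewrite (_ : _ - _ - _ = A x - B x); [lra|ring].
Qed.

(** The second difference is symmetric in u and v, so both mixed derivatives take a common value at
    points arbitrarily close to x, and they are continuous. *)
Lemma schwarz (U : set V) (f : V -> R^o) x u v : open U -> Ck 2 U f -> U x ->
  'D_v (fun z => 'D_u f z) x = 'D_u (fun z => 'D_v f z) x.
Proof.
move=> oU f2 Ux; have [_ fD] := f2; have [_ fuDD] := fD u; have [_ fvDD] := fD v.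
apply: (@eq_of_nearby_eq (fun y => 'D_v (fun z => 'D_u f z) y)
  (fun y => 'D_u (fun z => 'D_v f z) y)); [exact: fuDD|exact: fvDD|move=> d0 d0_gt0].
have [d3 d3_gt0 H3] := open_ball oU Ux.
pose d := Num.min d0 d3.
have d_gt0 : 0 < d by rewrite !lt_min d0_gt0 d3_gt0.
pose s := d / (`|u| + `|v| + 1).
have uv : 0 < `|u| + `|v| + 1 by rewrite ltr_wpDl// addr_ge0.
have s0 : 0 < s by rewrite divr_gt0.
have sd : s * (`|u| + `|v|) < d.
  by rewrite /s mulrAC ltr_pdivrMr// ltr_pM2l// ltrDl.
have dU y : `|y - x| < d -> U y.
  by move=> yd; apply: H3; apply: (lt_le_trans yd); rewrite !ge_min lexx !orbT.
have dd0 y : `|y - x| < d -> `|y - x| < d0.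
  by move=> yd; apply: (lt_le_trans yd); rewrite !ge_min lexx.
have [y [yd Ey]] := second_difference dU f2 s0 sd.
rewrite addrC in sd.
have [z [zd Ez]] := second_difference dU f2 s0 sd.
exists y, z; split; [exact: dd0|exact: dd0|].
have sN0 : s != 0 by rewrite gt_eqF.
apply: (mulfI sN0); apply: (mulfI sN0); apply: (etrans (esym Ey)).
by apply: (etrans _ Ez); rewrite [x + s *: u + s *: v]addrAC; ring.
Qed.
End Schwarz.

Section Partials.
Variables (R : realType) (n : nat).
Implicit Types (U : set 'rV[R]_n) (f : 'rV[R]_n -> R^o) (js : seq 'I_n).

Definition spartial js f : 'rV[R]_n -> R^o :=
  foldr (fun j (h : 'rV[R]_n -> R^o) x => 'D_(delta_mx 0 j) h x) f js.

Lemma Ck_spartial U k js f : Ck (size js + k) U f -> Ck k U (spartial js f).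
Proof.
elim: js k => [//|j js IH] k; rewrite addSnnS => /IH[_]; exact.
Qed.

(** The derivative along [j] is moved to the front by exchanges of neighbours, each an instance of
    [schwarz]. *)
Lemma spartial_front U j k1 k2 f : open U -> Ck (size k1 + size k2).+1 U f ->
  forall x, U x -> spartial (k1 ++ j :: k2) f x = spartial (j :: k1 ++ k2) f x.
Proof.
move=> oU; elim: k1 => [//|i k1 IH] fk x Ux.
have {}IH := IH (CkW fk).
rewrite /= (@near_eq_derive _ _ _ _ (spartial (j :: k1 ++ k2) f)); last first.
  have : nbhs x U by exact: open_nbhs_nbhs.
  by apply: filterS => y; exact: IH.
apply: (@schwarz R _ U (spartial (k1 ++ k2) f) x (delta_mx 0 j) (delta_mx 0 i) oU _ Ux).
apply: Ck_spartial.
by rewrite size_cat addn2 -addSn.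
Qed.

Lemma spartial_perm U js ks f : open U -> Ck (size js) U f -> perm_eq js ks ->
  forall x, U x -> spartial js f x = spartial ks f x.
Proof.
move=> oU; elim: js ks => [|j js IH] ks fk.
  by rewrite perm_sym => /perm_nilP ->.
move=> jks; have : j \in ks by rewrite -(perm_mem jks) mem_head.
move=> /path.splitPr ksE; case: ksE jks => k1 k2.
rewrite perm_sym -cat1s perm_catCA /= perm_cons perm_sym => jk x Ux.
have sjk := perm_size jk; rewrite size_cat in sjk.
have fk' : Ck (size k1 + size k2).+1 U f by rewrite -sjk.
rewrite (spartial_front j oU fk' Ux) /=; apply: near_eq_derive.
have : nbhs x U by exact: open_nbhs_nbhs.
apply: filterS => y; apply: IH => //; exact: CkW.
Qed.

Lemma diff_row_sum f x v : differentiable f x ->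
  'D_v f x = \sum_j v 0 j * 'D_(delta_mx 0 j) f x.
Proof.
move=> df; rewrite deriveE// [in LHS](row_sum_delta v) linear_sum.
by apply: eq_bigr => j _; rewrite linearZ deriveE.
Qed.

(** Induction on the order, with the mean value theorem on the segment from 0; each order costs a
    factor [n], the number of partial derivatives. *)
Lemma taylor_bound m f (rho eps : R) : 0 < rho -> 0 <= eps ->
  Ck m [set x : 'rV[R]_n | `|x| < rho] f ->
  (forall js, (size js < m)%N -> spartial js f 0 = 0) ->
  (forall js, size js = m -> forall x : 'rV[R]_n, `|x| < rho -> `|spartial js f x| <= eps) ->
  forall x : 'rV[R]_n, `|x| < rho -> `|f x| <= n%:R ^+ m * eps * `|x| ^+ m.
Proof.
move=> rho0 eps0; elim: m f => [|m IH] f fk f0 fe x xr.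
  by rewrite !expr0 mul1r mulr1; exact: (fe [::]).
have sE js j : spartial js (fun z => 'D_(delta_mx 0 j) f z) = spartial (rcons js j) f.
  by rewrite /spartial foldr_rcons.
have {}IH j y : `|y| < rho -> `|'D_(delta_mx 0 j) f y| <= n%:R ^+ m * eps * `|y| ^+ m.
  apply: (IH (fun z => 'D_(delta_mx 0 j) f z)).
  - by case: fk => _; exact.
  - by move=> js jsm; rewrite sE f0// size_rcons.
  - by move=> js jsm z zr; rewrite sE fe// size_rcons jsm.
have [fd _] := fk.
have tx (t : R) : 0 <= t -> t <= 1 -> `|0 + t *: x| <= `|x|.
  by move=> t0 t1; rewrite add0r normrZ ger0_norm// ler_piMl.
have [|t [t0 t1]] := @mvt_line R _ f 0 x.
  by move=> t t0 t1; apply: fd; apply: le_lt_trans xr; exact: tx.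
have f00 : f 0 = 0 by exact: (f0 [::]).
rewrite [0 + x]add0r f00 subr0 => ->.
have txx := tx t t0 t1; have txr := le_lt_trans txx xr.
rewrite diff_row_sum; last exact: fd.
apply: (le_trans (ler_norm_sum _ _ _)).
apply: (@le_trans _ _ (\sum_(j < n) `|x| * (n%:R ^+ m * eps * `|x| ^+ m))); last first.
  by rewrite sumr_const card_ord -[leLHS]mulr_natl !exprS le_eqVlt; apply/orP; left; apply/eqP; ring.
apply: ler_sum => j _; rewrite normrM; apply: ler_pM => //; first exact: coord_le_norm.
apply: (le_trans (IH j _ txr)); apply: ler_wpM2l; first by rewrite mulr_ge0// exprn_ge0.
by rewrite lerXn2r ?nnegrE.
Qed.

(** A strict bound at 0 persists nearby by continuity, uniformly because the derivatives of order
    [m] are finitely many. *)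
Lemma taylor_germ m f U (C : R) : open U -> U 0 -> Ck m U f ->
  (forall js, (size js < m)%N -> spartial js f 0 = 0) ->
  (forall js, size js = m -> `|spartial js f 0| < C) -> 0 < C ->
  exists2 rho : R, 0 < rho & forall x, `|x| < rho -> `|f x| <= n%:R ^+ m * C * `|x| ^+ m.
Proof.
move=> oU U0 fk f0 fC C0.
have [d d0 dU] := open_ball oU U0.
have : \forall x \near (0 : 'rV[R]_n), forall js : m.-tuple 'I_n, `|spartial js f x| < C.
  apply: (@filter_forall _ _ (fun (js : m.-tuple 'I_n) x => `|spartial js f x| < C)
    (nbhs (0 : 'rV[R]_n)) _) => js.
  have jsk : Ck 0 U (spartial js f) by apply: Ck_spartial; rewrite size_tuple addn0.
  have /cvgr_norm_lt := jsk 0 U0; apply; exact/fC/size_tuple.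
move=> /nbhs_ballP[d1 d1_gt0 Hd1].
exists (Num.min d d1); first by rewrite lt_min d0.
apply: taylor_bound => //.
- by rewrite lt_min d0.
- exact: ltW.
- apply: Ck_subset fk => x /=; rewrite lt_min => /andP[xd _].
  by apply: dU; rewrite subr0.
- move=> js jsm x; rewrite lt_min => /andP[_ xd1]; apply: ltW.
  have := Hd1 x; rewrite -ball_normE /= sub0r normrN => /(_ xd1).
  by move/eqP: jsm => jsm /(_ (Tuple jsm)).
Qed.

Lemma taylor_bigO m f U : open U -> U 0 -> Ck m U f ->
  (forall js, (size js < m)%N -> spartial js f 0 = 0) ->
  exists K rho : R, [/\ 0 < rho, 0 <= K & forall x, `|x| < rho -> `|f x| <= K * `|x| ^+ m].
Proof.
move=> oU U0 fk f0.
pose C := 1 + \sum_(js : m.-tuple 'I_n) `|spartial js f 0|.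
have C0 : 0 < C by rewrite ltr_pwDl// sumr_ge0.
have [js jsm||rho rho0 H] := taylor_germ oU U0 fk f0 (C := C) => //.
  move/eqP: jsm => jsm; rewrite /C (bigD1 (Tuple jsm))//=.
  by rewrite addrCA ltrDl ltr_pwDl// sumr_ge0.
by exists (n%:R ^+ m * C), rho; split=> //; rewrite mulr_ge0 ?exprn_ge0// ltW.
Qed.

Lemma pev_derive (q : mpoly.mpoly n R) x : differentiable (pev q : 'rV[R]_n -> R^o) x /\
  forall v, 'D_v (pev q : 'rV[R]_n -> R^o) x = edot (pgrad q x) v.
Proof.
elim/mpoly_ring_ind: q => [c|i|q q' [dq Dq] [dq' Dq']|q q' [dq Dq] [dq' Dq']].
- have -> : pev (mpoly.mpolyC n c) = cst c.
    by apply/funext => y; rewrite /pev mpoly.mevalC.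
  by split=> [|v]; [exact: differentiable_cst|rewrite derive_cst pgradC edot0l].
- have -> : pev (mpoly.mpolyX R (mpoly.mnm1 i)) = fun y => y 0 i.
    by apply/funext => y; exact: mpoly.mevalXU.
  split=> [|v]; first exact: differentiable_coord.
  rewrite pgradX edotC /edot.
  rewrite -(@derive_coord R _ _ _ (fun y : 'rV[R]_n => y)); last by apply: ex_diff.
  rewrite derive_id (bigD1 i)//= mxE !eqxx mulr1 big1 ?addr0// => j ij.
  by rewrite mxE (negbTE ij) andbF mulr0.
- have -> : pev (q + q') = (pev q : 'rV[R]_n -> R^o) + pev q'.
    by apply/funext => y; rewrite pevD.
  split=> [|v]; first exact: differentiableD.
  by rewrite deriveD ?Dq ?Dq' ?pgradD ?edotDl//; exact: diff_derivable.
- have -> : pev (q * q') = (pev q : 'rV[R]_n -> R^o) * pev q'.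
    by apply/funext => y; rewrite pevM.
  split=> [|v]; first exact: differentiableM.
  rewrite deriveM ?Dq ?Dq' ?pgradM ?edotDl ?edotZl 1?addrC//; exact: diff_derivable.
Qed.

Lemma derive_pev (q : mpoly.mpoly n R) x j :
  'D_(delta_mx 0 j) (pev q : 'rV[R]_n -> R^o) x = pev (mpoly.mderiv j q) x.
Proof.
have [_ ->] := pev_derive q x; rewrite edotC /edot (bigD1 j)//= !mxE !eqxx mul1r.
by rewrite big1 ?addr0// => i ij; rewrite !mxE (negbTE ij) andbF mul0r.
Qed.

Lemma Ck_pev k (q : mpoly.mpoly n R) : Ck k setT (pev q : 'rV[R]_n -> R^o).
Proof.
elim: k q => [|k IH] q.
  by move=> x _; apply: differentiable_continuous; case: (pev_derive q x).
split=> [x _|v]; first by case: (pev_derive q x).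
apply: (@Ck_eq _ _ R^o _ _ (fun x => \sum_j v 0 j * pev (mpoly.mderiv j q) x)).
  move=> x; have [dq _] := pev_derive q x; rewrite (diff_row_sum _ dq).
  by apply: eq_bigr => j _; rewrite derive_pev.
apply: Ck_sum => [|j]; first exact: openT.
by apply: CkM => //; [exact: openT|exact: Ck_cst].
Qed.

Lemma spartial_pev js (q : mpoly.mpoly n R) :
  spartial js (pev q) = pev (foldr (@mpoly.mderiv n R) q js).
Proof.
elim: js => [//|j js IH]; apply/funext => x.
by rewrite [LHS]/= -/(spartial js _) IH derive_pev.
Qed.

(** Since partial derivatives commute, only the multiplicities in [js] matter; these maps pass
    between sequences of indices and multi-indices. *)
Definition mnm_of_seq js := mpoly.Multinom [tuple count_mem i js | i < n].

Definition seq_of_mnm (m : mpoly.multinom n) := flatten [seq nseq (m i) i | i <- enum 'I_n].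

Lemma perm_mnm_of_seq js : perm_eq js (seq_of_mnm (mnm_of_seq js)).
Proof.
apply/allP => i _ /=; rewrite count_flatten -map_comp sumnE big_map big_enum /=.
rewrite (bigD1 i)//= count_nseq /= eqxx mul1n big1 ?addn0.
  by rewrite mpoly.mnmE.
by move=> j ij; rewrite count_nseq /= (negbTE ij) mul0n.
Qed.

Lemma mdeg_mnm_of_seq js : mpoly.mdeg (mnm_of_seq js) = size js.
Proof.
rewrite mpoly.mdegE (perm_size (perm_mnm_of_seq js)) size_flatten /shape -map_comp.
rewrite sumnE big_map big_enum /=.
by apply: eq_bigr => i _; rewrite size_nseq.
Qed.

Lemma pev0 (q : mpoly.mpoly n R) : pev q 0 = mpoly.mcoeff mpoly.mnm0 q.
Proof.
have H (m : mpoly.multinom n) :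
    \prod_(i < n) (0 : 'rV[R]_n) 0 i ^+ m i = (m == mpoly.mnm0)%:R.
  have [->|/eqP m0] := eqVneq m mpoly.mnm0.
    by rewrite big1// => i _; rewrite mpoly.mnm0E expr0.
  have [i mi] : exists i, m i != 0%N.
    apply: contrapT => H; apply: m0; apply/mpoly.mnmP => i.
    rewrite mpoly.mnm0E; apply/eqP/negPn/negP => mi; apply: H.
    by exists i.
  by rewrite (bigD1 i)//= mxE expr0n (negbTE mi) mul0r.
rewrite /pev mpoly.mevalE; under eq_bigr do rewrite H.
have [m0|m0] := boolP (mpoly.mnm0 \in mpoly.msupp q).
  rewrite (bigD1_seq mpoly.mnm0)//= ?eqxx ?mulr1 ?mpoly.msupp_uniq//.
  by rewrite big1 ?addr0// => m /negbTE ->; rewrite mulr0.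
rewrite big_seq big1 => [|m mq]; first by apply/esym/eqP; rewrite mpoly.mcoeff_eq0.
by case: eqP mq m0 => [-> ->|_ _ _]//; rewrite mulr0.
Qed.

(** After differentiation by a multi-index m and evaluation at 0, only the coefficient of the
    monomial m survives, multiplied by the product of the factorials that [E] divides out. *)
Lemma taylor_polynomial d U f : open U -> U 0 -> Ck d U f ->
  exists q : mpoly.mpoly n R, (mpoly.msize q <= d.+1)%N /\
    forall js, (size js <= d)%N -> spartial js (pev q) 0 = spartial js f 0.
Proof.
move=> oU U0 fk.
pose E m := spartial (seq_of_mnm m) f 0 / (\prod_(i < n) (m i)`!)%:R.
exists (\sum_(m : mpoly.bmultinom n d.+1) E (mpoly.bmnm m) *: mpoly.mpolyX R (mpoly.bmnm m)).
split.
  apply: (leq_trans (mpoly.msize_sum _ _ _)); apply/bigmax_leqP => m _.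
  apply: (leq_trans (mpoly.msizeZ_le _ _)); rewrite mpoly.msizeX; exact: mpoly.bmdeg.
move=> js jsd; rewrite spartial_pev.
rewrite (mpoly.mderiv_perm _ (perm_mnm_of_seq js)) -mpoly.mderivm_foldr.
set m := mnm_of_seq js; set q := \sum_(_ | _) _.
have mE : (mpoly.mdeg m < d.+1)%N by rewrite mdeg_mnm_of_seq.
rewrite pev0 mpoly.mcoeff_mderivm mpoly.addm0 mpoly.mcoeff_mpoly// /E.
rewrite [X in _ *+ X](_ : _ = (\prod_(i < n) (m i)`!)%N); last by apply: eq_bigr => i _; rewrite ffactnn.
rewrite -[LHS]mulr_natr divfK; last first.
  by rewrite pnatr_eq0 -lt0n prodn_gt0// => i; exact: fact_gt0.
by apply/esym/(@spartial_perm U) => //; [exact: Ck_le fk|exact: perm_mnm_of_seq].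
Qed.

End Partials.

(** * Kuo distance and the local estimate *)

Section Kuo.
Variables (R : realType) (n p : nat).

Lemma edist_le (N : nat) (v : 'rV[R]_N) (E : {vspace 'rV[R]_N}) w : w \in E ->
  edist v E <= enorm (v - w).
Proof.
move=> wE; apply: ge_inf; last by exists w.
by exists 0 => _ [u _ <-]; exact: enorm_ge0.
Qed.

Lemma edist_ge0 (N : nat) (v : 'rV[R]_N) (E : {vspace 'rV[R]_N}) : 0 <= edist v E.
Proof.
apply: lb_le_inf; first by exists (enorm (v - 0)), 0 => //=; exact: mem0v.
by move=> _ [u _ <-]; exact: enorm_ge0.
Qed.

Lemma kuo_dist_le (v : 'I_p -> 'rV[R]_n) i :
  kuo_dist v <= edist (v i) (\sum_(j < p | j != i) <[v j]>)%VS.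
Proof.
apply: ge_inf; last by exists i.
by exists 0 => _ [j _ <-]; exact: edist_ge0.
Qed.

Lemma norm_attained (a : 'rV[R]_p) : a != 0 -> exists i, `|a| = `|a 0 i|.
Proof.
move=> a0; have /mx_norm_neq0[[i0 i] /= ai] : mx_norm a != 0.
  by apply: contra_neq a0; exact: mx_norm_eq0.
by exists i; rewrite -[LHS]/(mx_norm a) ai ord1.
Qed.

(** For an index i with |a_i| maximal, the combination is a_i times the difference of v_i and a
    vector in the span of the others. The sup norm of [a] makes the constant equal to 1. *)
Lemma kuo_dist_lower (v : 'I_p -> 'rV[R]_n) (a : 'rV[R]_p) :
  kuo_dist v * `|a| <= enorm (a *m \matrix_i v i).
Proof.
have aE : a *m \matrix_i v i = \sum_j a 0 j *: v j.
  by rewrite mulmx_sum_row; apply: eq_bigr => j _; rewrite rowK.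
have [->|a0] := eqVneq a 0; first by rewrite normr0 mulr0 enorm_ge0.
have [i ai] := norm_attained a0.
have ai0 : a 0 i != 0 by rewrite -normr_eq0 -ai normr_eq0.
pose w := - \sum_(j < p | j != i) ((a 0 i)^-1 * a 0 j) *: v j.
have -> : a *m \matrix_i v i = a 0 i *: (v i - w).
  rewrite aE (bigD1 i)//= /w opprK scalerDr; congr (_ + _).
  rewrite scaler_sumr; apply: eq_bigr => j _; rewrite scalerA mulrA divff// mul1r//.
rewrite enormZ ai mulrC ler_wpM2l//; apply: (le_trans (kuo_dist_le v i)).
apply: edist_le; rewrite memvN; apply: memv_suml => j ji.
apply: memvZ; apply: (subvP (sumv_sup j ji (subvv _))); exact: memv_line.
Qed.

Definition gradmx (f : 'rV[R]_n -> 'rV[R]_p) (x : 'rV[R]_n) : 'M[R]_(p, n) :=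
  \matrix_i grad (fun y => f y 0 i) x.

Lemma gradmxE f x i j : gradmx f x i j = 'D_(delta_mx 0 j) (fun y => f y 0 i : R^o) x.
Proof. by rewrite !mxE. Qed.

Lemma gradmx_jacobian f x : differentiable f x -> gradmx f x = (jacobian f x)^T.
Proof.
move=> df; apply/matrixP => i j.
by rewrite gradmxE mxE jacobianE// derive_coord.
Qed.

End Kuo.

Section Germs.
Variables (R : realType) (n p : nat).
Implicit Types (f g : 'rV[R]_n -> 'rV[R]_p) (U : set 'rV[R]_n).

Lemma Ck_partial U k js f : Ck (size js + k) U f -> Ck k U (partial js f).
Proof.
elim: js k => [//|j js IH] k; rewrite addSnnS => /IH[_]; exact.
Qed.

Lemma partial_coord U js f i : open U -> Ck (size js) U f ->
  forall x, U x -> partial js f x 0 i = spartial js (fun y => f y 0 i) x.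
Proof.
move=> oU; elim: js => [//|j js IH] fk x Ux.
have := Ck_partial (k := 1) (js := js) (U := U) (f := f).
rewrite addn1 => /(_ fk)[pd _].
rewrite [LHS]/= -/(partial js f) (derive_coord _ _ _ (pd x Ux)).
rewrite /=; apply: near_eq_derive.
have : nbhs x U by exact: open_nbhs_nbhs.
by apply: filterS => y; apply: IH; exact: CkW.
Qed.

Lemma spartialD U js (phi psi : 'rV[R]_n -> R^o) (c : R) : open U ->
  Ck (size js) U phi -> Ck (size js) U psi ->
  forall x, U x -> spartial js (fun y => phi y + c * psi y : R^o) x =
    spartial js phi x + c * spartial js psi x.
Proof.
move=> oU; elim: js => [//|j js IH] fk gk x Ux.
have := @Ck_spartial R n U 1 js phi; rewrite addn1 => /(_ fk)[fd _].
have := @Ck_spartial R n U 1 js psi; rewrite addn1 => /(_ gk)[gd _].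
rewrite [LHS]/= -/(spartial js _).
transitivity ('D_(delta_mx 0 j) (spartial js phi + (c *: spartial js psi)) x).
  apply: near_eq_derive; have : nbhs x U by exact: open_nbhs_nbhs.
  by apply: filterS => y Uy; rewrite IH//; exact: CkW.
have dphi : derivable (spartial js phi) x (delta_mx 0 j) by exact/diff_derivable/fd.
have dpsi : derivable (spartial js psi) x (delta_mx 0 j) by exact/diff_derivable/gd.
by rewrite deriveD ?deriveZ//; exact: derivableZ.
Qed.

Lemma same_jet0_coord r U f g : open U -> U 0 -> Ck r U f -> Ck r U g ->
  (same_jet0 r f g <-> forall i js, (size js <= r)%N ->
     spartial js (fun y => f y 0 i) 0 = spartial js (fun y => g y 0 i) 0).
Proof.
move=> oU U0 fk gk; split=> [H i js jsr|H js jsr].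
  rewrite -(@partial_coord U)//; last exact: Ck_le fk.
  rewrite -(@partial_coord U)//; last exact: Ck_le gk.
  by rewrite H.
apply/rowP => i.
rewrite (@partial_coord U)//; last exact: Ck_le fk.
rewrite (@partial_coord U)//; last exact: Ck_le gk.
exact: H.
Qed.

Lemma common_radius (T : finType) (rho : T -> R) : (forall i, 0 < rho i) ->
  exists2 d : R, 0 < d & forall i, d <= rho i.
Proof.
move=> rho0; exists (\big[Num.min/1]_i rho i); last by move=> i; exact: bigmin_le_cond.
by apply: lt_bigmin.
Qed.

Lemma germ_bigO r U f : open U -> U 0 -> Ck r.+1 U f ->
  (forall i js, (size js <= r)%N -> spartial js (fun y => f y 0 i) 0 = 0) ->
  exists K rho : R, [/\ 0 < rho, 0 <= K &
    forall x, `|x| < rho -> [/\ U x, `|f x| <= K * `|x| ^+ r.+1 &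
      `|gradmx f x| <= K * `|x| ^+ r]].
Proof.
move=> oU U0 fk f0.
have fik i : Ck r.+1 U (fun y => f y 0 i : R^o) by exact: Ck_coord.
have /choice[K1 K1P] i : exists K, exists rho, [/\ 0 < rho, 0 <= K &
    forall x : 'rV[R]_n, `|x| < rho -> `|f x 0 i| <= K * `|x| ^+ r.+1].
  exact: (taylor_bigO oU U0 (fik i) (fun js => f0 i js)).
have /choice[r1 r1P] := K1P.
have /choice[K2 K2P] (ij : 'I_p * 'I_n) : exists K, exists rho, [/\ 0 < rho, 0 <= K &
    forall x : 'rV[R]_n, `|x| < rho ->
      `|'D_(delta_mx 0 ij.2) (fun y => f y 0 ij.1 : R^o) x| <= K * `|x| ^+ r].
  have [_ /(_ (delta_mx 0 ij.2)) fijk] := fik ij.1.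
  apply: (taylor_bigO oU U0 fijk) => js jsr.
  rewrite (_ : spartial _ _ = spartial (rcons js ij.2) (fun y => f y 0 ij.1)).
    by apply: f0; rewrite size_rcons.
  by rewrite /spartial foldr_rcons.
have /choice[r2 r2P] := K2P.
have [d d0 dU] := open_ball oU U0.
have [d1 d10 r1d] : exists2 d : R, 0 < d & forall i, d <= r1 i.
  by apply: common_radius => i; case: (r1P i).
have [d2 d20 r2d] : exists2 d : R, 0 < d & forall ij, d <= r2 ij.
  by apply: common_radius => ij; case: (r2P ij).
pose K := \sum_i K1 i + \sum_ij K2 ij.
have K10 : 0 <= \sum_i K1 i by apply: sumr_ge0 => i _; case: (r1P i).
have K20 : 0 <= \sum_ij K2 ij by apply: sumr_ge0 => ij _; case: (r2P ij).
exists K, (Num.min d (Num.min d1 d2)); split; [by rewrite !lt_min d0 d10|exact: addr_ge0|].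
move=> x; rewrite !lt_min => /and3P[xd xd1 xd2].
have x1 i := lt_le_trans xd1 (r1d i); have x2 ij := lt_le_trans xd2 (r2d ij).
split; first by apply: dU; rewrite subr0.
  apply: norm_le_coord => [|i j]; first by rewrite mulr_ge0 ?exprn_ge0// addr_ge0.
  have [_ _ H1] := r1P j; rewrite ord1; apply: (le_trans (H1 x (x1 j))).
  rewrite ler_wpM2r ?exprn_ge0// /K (bigD1 j)//= -addrA lerDl addr_ge0//.
  by apply: sumr_ge0 => i' _; case: (r1P i').
apply: norm_le_coord => [|i j]; first by rewrite mulr_ge0 ?exprn_ge0// addr_ge0.
have [_ _ H1] := r2P (i, j); rewrite gradmxE; apply: (le_trans (H1 x (x2 (i, j)))).
rewrite ler_wpM2r ?exprn_ge0// /K (bigD1 (i, j))//= addrCA lerDl addr_ge0//.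
by apply: sumr_ge0 => i' _; case: (r2P i').
Qed.

(** Here the derivatives of order [m] vanish at 0 as well, so the constant can be prescribed; [C']
    compensates the factor n^m of [taylor_germ]. *)
Lemma germ_littleo m U f (C : R) : open U -> U 0 -> Ck m U f -> 0 < C ->
  (forall i js, (size js <= m)%N -> spartial js (fun y => f y 0 i) 0 = 0) ->
  exists2 rho : R, 0 < rho & forall x, `|x| < rho -> `|f x| <= C * `|x| ^+ m.
Proof.
move=> oU U0 fk C0 f0.
pose C' := C / (n%:R ^+ m + 1).
have n0 : 0 < n%:R ^+ m + 1 :> R by rewrite ltr_wpDl// exprn_ge0.
have C'0 : 0 < C' by rewrite divr_gt0.
have /choice[r1 r1P] i : exists rho, 0 < rho /\ forall x : 'rV[R]_n, `|x| < rho ->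
    `|f x 0 i| <= n%:R ^+ m * C' * `|x| ^+ m.
  have [||||rho rho0 H] := @taylor_germ R n m (fun y => f y 0 i) U C' oU U0.
  - exact: Ck_coord.
  - by move=> js jsm; apply: f0; exact: ltnW.
  - by move=> js jsm; rewrite f0 ?normr0// jsm.
  - exact: C'0.
  by exists rho.
have [d d0 rd] : exists2 d : R, 0 < d & forall i, d <= r1 i.
  by apply: common_radius => i; case: (r1P i).
exists d => // x xd.
apply: norm_le_coord => [|i j]; first by rewrite mulr_ge0 ?exprn_ge0// ltW.
rewrite ord1; have [_ H1] := r1P j.
apply: (le_trans (H1 x (lt_le_trans xd (rd j)))).
rewrite ler_wpM2r ?exprn_ge0// /C' mulrCA; apply: ler_piMr; first exact: ltW.
by rewrite ler_pdivrMr// mul1r lerDl.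
Qed.

End Germs.

(** * Stability of angles and lengths under perturbation *)

Section Angles.
Variables (R : realType) (N : nat).
Implicit Types (u v x : 'rV[R]_N).

Lemma enorm_perturb u v : enorm v <= 8^-1 * enorm u -> 7 / 8 * enorm u <= enorm (u + v).
Proof.
move=> vu; have : enorm u <= enorm (u + v) + enorm v.
  by rewrite -{1}(addrK v u) enormB.
lra.
Qed.

(** The constants fit because 1/4 + 1/8 <= 1/2 * 7/8. *)
Lemma angle_perturb u v x : enorm v <= 8^-1 * enorm u ->
  `|edot u x| <= 4^-1 * enorm u * enorm x ->
  `|edot (u + v) x| <= 2^-1 * enorm (u + v) * enorm x.
Proof.
move=> vu ux; rewrite edotDl; apply: (le_trans (ler_normD _ _)).
have H1 := edot_le v x; have H2 := ler_wpM2r (enorm_ge0 x) vu.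
have H3 := ler_wpM2r (enorm_ge0 x) (enorm_perturb vu).
have H4 : 0 <= enorm u * enorm x by rewrite mulr_ge0 ?enorm_ge0.
lra.
Qed.

(** With V = |v| and X = |b x|, the square of the right side is at least V^2 - V X + X^2 >= 3/4 V^2,
    whatever b is. *)
Lemma angle_low v x (b : R) : `|edot v x| <= 2^-1 * enorm v * enorm x ->
  2^-1 * enorm v <= enorm (v + b *: x).
Proof.
move=> vx; rewrite -(@ler_pXn2r _ 2)// ?nnegrE ?mulr_ge0 ?enorm_ge0//.
rewrite exprMn sqr_enorm [X in _ <= X]sqr_enorm edotDl !edotDr edotZr edotZl edotZr (edotC x) edotZl.
have H1 : `|b * edot v x| <= 2^-1 * (enorm v * (`|b| * enorm x)).
  rewrite normrM; apply: (le_trans (ler_wpM2l (normr_ge0 b) vx)).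
  by rewrite le_eqVlt; apply/orP; left; apply/eqP; ring.
have H2 : - (b * edot v x) <= 2^-1 * (enorm v * (`|b| * enorm x)).
  by apply: le_trans H1; rewrite -normrN ler_norm.
have E1 : b * (b * edot x x) = (`|b| * enorm x) ^+ 2.
  by rewrite exprMn sqr_enorm real_normK ?num_real// expr2 mulrA.
rewrite E1 -(sqr_enorm v); have := sqr_ge0 (enorm v - `|b| * enorm x).
have := sqr_ge0 (enorm v); have := sqr_ge0 (`|b| * enorm x).
move: H2; set V := enorm v; set X := `|b| * enorm x; set D := b * _; lra.
Qed.

End Angles.

Section LocalEstimate.
Variables (R : realType) (n p r : nat).
Implicit Types (f g : 'rV[R]_n -> 'rV[R]_p) (U : set 'rV[R]_n).

Lemma gradmx_lin U f g (c : R) x : open U -> Ck 1 U f -> Ck 1 U g -> U x ->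
  gradmx (fun y => f y + c *: g y) x = gradmx f x + c *: gradmx g x.
Proof.
move=> oU [fd _] [gd _] Ux; apply/matrixP => i j; rewrite gradmxE [RHS]mxE [X in _ + X]mxE !gradmxE.
have dfi := differentiable_coordf 0 i (fd x Ux).
have dgi := differentiable_coordf 0 i (gd x Ux).
rewrite (_ : (fun y => _) = (fun y => f y 0 i : R^o) + c *: (fun y => g y 0 i : R^o)); last first.
  by apply/funext => y; rewrite !mxE.
by rewrite deriveD ?deriveZ//; [exact: diff_derivable..|exact/derivableZ/diff_derivable].
Qed.

Lemma gradmx_poly (h : 'I_p -> mpoly.mpoly n R) x : gradmx (poly_map h) x = pjac h x.
Proof.
apply/matrixP => i j; rewrite gradmxE [RHS]mxE.
have -> : (fun y => poly_map h y 0 i : R^o) = pev (h i) by apply/funext => y; rewrite mxE.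
exact: derive_pev.
Qed.

Lemma Ck_poly_map k (h : 'I_p -> mpoly.mpoly n R) : Ck k setT (poly_map h).
Proof.
apply: Ck_mx => [|i j]; first exact: openT.
by apply: Ck_eq (Ck_pev k (h j)) => x; rewrite mxE.
Qed.

Lemma enorm_mulmx_le (a : 'rV[R]_p) (E : 'M[R]_(p, n)) :
  enorm (a *m E) <= n%:R * p%:R * `|a| * `|E|.
Proof.
apply: (le_trans (enorm_le_norm _)); rewrite -!mulrA ler_wpM2l// mulrA.
exact: mulmx_norm_le.
Qed.

(** Turns the hypothesis on the gradients of [f] into the covector bound for [h] that [angle]
    requires. The two derivatives differ by O(|x|^r), which a large multiple of |x|^r absorbs. *)
Lemma kuo_big f (h : 'I_p -> mpoly.mpoly n R) (K rho C alpha w delta : R) :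
  0 <= K -> 0 < rho -> 0 < C -> 0 < alpha -> 0 < delta ->
  (forall x, `|x| < rho -> `|gradmx f x - pjac h x| <= K * `|x| ^+ r) ->
  (forall x, horn r.+1 (poly_map h) w x -> enorm x < alpha ->
     C * enorm x `^ (r%:R - delta) <= kuo_dist (fun i => grad (fun y => f y 0 i) x)) ->
  forall eta : R, 0 < eta ->
  exists2 alpha : R, 0 < alpha & forall x : 'rV[R]_n, x != 0 -> enorm x < alpha ->
    enorm (poly_map h x) <= w * enorm x ^+ r.+1 ->
    forall a : 'rV[R]_p, enorm x ^+ r * `|a| <= eta * enorm (a *m pjac h x).
Proof.
move=> K0 rho0 C0 alpha0 delta0 fh kuo eta eta0.
(* The first summand pays for replacing the gradients of [f] by those of [h]; the second is the
   bound wanted for [h]. *)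
pose L := n%:R * p%:R * K + eta^-1.
have npK : 0 <= n%:R * p%:R * K by rewrite !mulr_ge0.
have ei0 : 0 < eta^-1 by rewrite invr_gt0.
have L0 : 0 < L by rewrite ltr_wpDl.
have CL : 0 < C / L by rewrite divr_gt0.
(* Below the last radius C s^(r - delta) exceeds L s^r: this is where delta > 0 is spent. *)
exists (Num.min (Num.min alpha rho) ((C / L) `^ delta^-1)).
  by rewrite !lt_min alpha0 rho0 powR_gt0.
move=> x x0; rewrite !lt_min => /andP[/andP[xa xr] xC] xw a.
have s0 := enorm_gt0 x0; set s := enorm x in s0 xa xr xC xw *.
have xs : `|x| <= s by exact: norm_le_enorm.
have sd0 : 0 < s `^ delta by exact: powR_gt0.
have sdL : L * s `^ delta <= C.
  rewrite mulrC -ler_pdivlMr//.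
  have -> : C / L = ((C / L) `^ delta^-1) `^ delta.
    by rewrite -powRrM mulVf ?gt_eqF// powRr1// ltW.
  by apply: ge0_ler_powR; rewrite ?nnegrE ?powR_ge0// ltW.
have Cs : L * s ^+ r <= C * s `^ (r%:R - delta).
  rewrite powRD; last by rewrite (gt_eqF s0) implybT.
  rewrite powR_mulrn ?powRN; last exact: ltW.
  rewrite mulrCA [leLHS]mulrC; apply: ler_wpM2l; first by apply/exprn_ge0/ltW.
  by rewrite ler_pdivlMr.
have := kuo x xw xa; rewrite -/s => kx.
have := kuo_dist_lower (fun i => grad (fun y => f y 0 i) x) a.
rewrite -/(gradmx f x) => H.
have {}H : L * s ^+ r * `|a| <= enorm (a *m gradmx f x).
  apply: le_trans H; rewrite ler_wpM2r//; exact: le_trans kx.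
have : enorm (a *m gradmx f x) <= enorm (a *m pjac h x) + n%:R * p%:R * K * s ^+ r * `|a|.
  rewrite -{1}(subrK (pjac h x) (gradmx f x)) mulmxDr addrC.
  apply: (le_trans (enormD _ _)); rewrite lerD2l.
  apply: (le_trans (enorm_mulmx_le _ _)).
  have xrho : `|x| < rho by exact: le_lt_trans xr.
  have := le_trans (fh x xrho) (ler_wpM2l K0 _) => /(_ (s ^+ r)) Hx.
  have {}Hx : `|gradmx f x - pjac h x| <= K * s ^+ r.
    by apply: Hx; rewrite lerXn2r ?nnegrE// ltW.
  have := ler_wpM2l (mulr_ge0 (mulr_ge0 (ler0n _ n) (ler0n _ p)) (normr_ge0 a)) Hx.
  by move=> Hy; apply: (le_trans Hy); rewrite le_eqVlt; apply/orP; left; apply/eqP; ring.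
move=> /(le_trans H); rewrite /L !mulrDl => H2.
have {}H2 : eta^-1 * s ^+ r * `|a| <= enorm (a *m pjac h x) by lra.
by rewrite -ler_pdivrMl// mulrA.
Qed.

Variables (f g : 'rV[R]_n -> 'rV[R]_p) (U : set 'rV[R]_n).
Hypotheses (oU : open U) (U0 : U 0) (fk : Ck r.+1 U f) (gk : Ck r.+1 U g).
Hypothesis jet_gf : same_jet0 r g f.
Hypothesis kuo : forall h : 'I_p -> mpoly.mpoly n R,
    (forall i, (mpoly.msize (h i) <= r.+2)%N) ->
    same_jet0 r (poly_map h) f ->
    exists C alpha w delta : R,
      [/\ 0 < C, 0 < alpha, 0 < w, 0 < delta &
       forall x, horn r.+1 (poly_map h) w x -> enorm x < alpha ->
         C * enorm x `^ (r%:R - delta) <=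
         kuo_dist (fun i => grad (fun y => f y 0 i) x)].

Let P x := g x - f x.

Lemma Ck_pert : Ck r.+1 U P.
Proof. exact: CkB. Qed.

Lemma spartial_pert i js : (size js <= r)%N -> spartial js (fun y => P y 0 i) 0 = 0.
Proof.
move=> jsr.
have -> : (fun y => P y 0 i) = fun y => g y 0 i + (-1) * f y 0 i.
  by apply/funext => y; rewrite !mxE mulN1r.
have jk (F : 'rV[R]_n -> 'rV[R]_p) : Ck r.+1 U F -> Ck (size js) U (fun y => F y 0 i : R^o).
  by move=> Fk; apply: (Ck_coord 0 i oU); apply: Ck_le Fk; exact: leqW.
rewrite (spartialD (U := U))//; [|exact: jk|exact: jk].
have /same_jet0_coord := jet_gf; move=> /(_ U oU U0 (CkW gk) (CkW fk)) ->//.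
by rewrite mulN1r subrr.
Qed.

(** The r-jet of [P] vanishes, so the Taylor polynomial of f + t0 P is admissible in the hypothesis
    for every t0, although its terms of degree r+1 depend on t0. *)
Lemma taylor_data (t0 : R) : exists h : 'I_p -> mpoly.mpoly n R,
  [/\ forall i, (mpoly.msize (h i) <= r.+2)%N, same_jet0 r (poly_map h) f,
    (forall i js, (size js <= r)%N -> spartial js (fun y => (f y - poly_map h y) 0 i) 0 = 0) &
    forall i js, (size js <= r.+1)%N ->
      spartial js (fun y => (f y + t0 *: P y - poly_map h y) 0 i) 0 = 0].
Proof.
pose phi i : 'rV[R]_n -> R^o := fun y => f y 0 i + t0 * P y 0 i.
have fik i : Ck r.+1 U (fun y => f y 0 i : R^o) by exact: Ck_coord.
have Pik i : Ck r.+1 U (fun y => P y 0 i : R^o) by apply: Ck_coord => //; exact: Ck_pert.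
have phik i : Ck r.+1 U (phi i).
  by apply: CkD => //; apply: CkM => //; exact: Ck_cst.
have /choice[h hP] i := taylor_polynomial oU U0 (phik i).
have hE i : (fun y => poly_map h y 0 i) = pev (h i) by apply/funext => y; rewrite mxE.
have hk k i : Ck k U (pev (h i) : 'rV[R]_n -> R^o) by apply: Ck_subset (Ck_pev k (h i)).
have hf i js : (size js <= r)%N -> spartial js (pev (h i)) 0 = spartial js (fun y => f y 0 i) 0.
  move=> jsr; have [_ ->] := hP i; last exact: leqW.
  rewrite (spartialD (U := U))//; last 2 first.
  - by apply: Ck_le (fik i); exact: leqW.
  - by apply: Ck_le (Pik i); exact: leqW.
  by rewrite spartial_pert// mulr0 addr0.
exists h; split.
- by move=> i; case: (hP i).
- apply/(same_jet0_coord oU U0) => [||i js jsr].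
  + by apply: Ck_subset (Ck_poly_map r h).
  + exact: CkW.
  + by rewrite hE hf.
- move=> i js jsr.
  have -> : (fun y => (f y - poly_map h y) 0 i) = fun y => f y 0 i + (-1) * pev (h i) y.
    by apply/funext => y; rewrite !mxE mulN1r.
  rewrite (spartialD (U := U))//; last by apply: Ck_le (fik i); exact: leqW.
  by rewrite hf// mulN1r subrr.
- move=> i js jsr.
  have -> : (fun y => (f y + t0 *: P y - poly_map h y) 0 i) = fun y => phi i y + (-1) * pev (h i) y.
    by apply/funext => y; rewrite /phi !mxE mulN1r.
  rewrite (spartialD (U := U))//; last by apply: Ck_le (phik i).
  by have [_ hPi] := hP i; rewrite hPi// mulN1r subrr.
Qed.

(** Since P x = O(|x|^(r+1)) whereas |a| |x|^r is bounded by a multiple of |a B + b x|, a factor |x|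
    is left over, which is as small as desired. The term b x stands for the differential of |x|^2;
    the second conclusion makes F a submersion at its zeros off the axis. *)
Lemma local_estimate (t0 eps : R) : 0 < eps -> exists2 d : R, 0 < d &
  forall x (t : R), x != 0 -> `|x| < d -> `|t - t0| < d -> f x + t *: P x = 0 ->
  forall (a : 'rV[R]_p) (b : R),
    let B := gradmx (fun y => f y + t *: P y) x in
    `|edot a (P x)| <= eps * enorm (a *m B + b *: x) /\ (a *m B = 0 -> a = 0).
Proof.
move=> eps0; have [h [hs hjet hf hphi]] := taylor_data t0.
have [C [alpha [w [delta [C0 alpha0 w0 delta0 kuoh]]]]] := kuo hs hjet.
have hk k : Ck k U (poly_map h) by apply: Ck_subset (Ck_poly_map k h).
have [KP [rP [rP0 KP0 HP]]] := germ_bigO oU U0 Ck_pert spartial_pert.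
have [KE [rE [rE0 KE0 HE]]] := germ_bigO oU U0 (CkB oU fk (hk r.+1)) hf.
have gE x : U x -> gradmx (fun y => f y - poly_map h y) x = gradmx f x - pjac h x.
  move=> Ux; rewrite (_ : (fun y => _) = fun y => f y + (-1) *: poly_map h y).
    rewrite (gradmx_lin _ oU) ?gradmx_poly ?scaleN1r//; exact: Ck_le fk.
  by apply/funext => y; rewrite scaleN1r.
have gB x t : U x -> gradmx (fun y => f y + t *: P y) x = gradmx f x + t *: gradmx P x.
  move=> Ux; apply: (gradmx_lin t oU _ _ Ux); [exact: Ck_le fk|exact: Ck_le Ck_pert].
have HE' x : `|x| < rE -> `|gradmx f x - pjac h x| <= KE * `|x| ^+ r.
  by move=> xr; have [Ux _] := HE x xr; rewrite gE.
have big := kuo_big KE0 rE0 C0 alpha0 delta0 HE' kuoh.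
have quarter : 0 < 4^-1 :> R by rewrite invr_gt0.
have [beta beta0 ang] := angle (ltW w0) quarter big.
pose T := `|t0| + 1.
have T0 : 0 < T by rewrite /T ltr_wpDl.
have [K2 K2E] : exists K2, K2 = n%:R * p%:R * (KE + T * KP) by eexists.
have K20 : 0 <= K2 by rewrite K2E !mulr_ge0// addr_ge0// mulr_ge0// ltW.
(* [K2] bounds the effect on [a] of the difference between B and dh, relative to |a| s^r; with this
   [eta] it is at most one eighth of |a dh(x)|. *)
pose eta := (8 * K2 + 1)^-1.
have eta0 : 0 < eta by rewrite invr_gt0 ltr_wpDl// mulr_ge0.
have K2eta : K2 * eta <= 8^-1.
  have K281 : 0 < 8 * K2 + 1 by lra.
  by rewrite /eta ler_pdivrMr//; lra.
have [gamma gamma0 Hgamma] := big eta eta0.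
(* Half of the horn is spent on |t - t0| |P x|, half on the Taylor remainder; [p + 1] pays for
   passing from the sup norm to the Euclidean norm. *)
pose w2 := w / (2 * (p%:R + 1)).
have p10 : 0 < p%:R + 1 :> R by rewrite ltr_wpDl.
have w20 : 0 < w2 by rewrite divr_gt0// mulr_gt0.
have w2E : p%:R * (2 * w2) <= w.
  have <- : (p%:R + 1) * (2 * w2) = w by rewrite /w2; field; rewrite gt_eqF.
  by rewrite ler_wpM2r ?mulr_ge0 ?ltW// ltrDl.
have [rho rho0 Hrho] := germ_littleo oU U0 (CkB oU (CkD oU fk (CkZ oU (Ck_cst _ _ _) Ck_pert)) (hk r.+1)) w20 hphi.
(* The 3 bounds 2 * 8/7, the loss in [angle_low] times the loss in [enorm_perturb]. *)
pose L := p%:R * KP * eta * 3.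
have L0 : 0 <= L by rewrite !mulr_ge0// ltW.
pose m := Num.min (Num.min (Num.min rP rE) rho) (Num.min (Num.min beta gamma) (eps / (L + 1))).
have L10 : 0 < L + 1 by rewrite ltr_wpDl.
have m0 : 0 < m by rewrite !lt_min rP0 rE0 rho0 beta0 gamma0 divr_gt0.
have n10 : 0 < n%:R + 1 :> R by rewrite ltr_wpDl.
exists (Num.min (Num.min (m / (n%:R + 1)) 1) (w2 / (KP + 1))).
  by rewrite !lt_min divr_gt0//= ltr01 divr_gt0// ltr_wpDl.
move=> x t x0; rewrite !lt_min => /andP[/andP[xm x1] _] /andP[/andP[_ t1] tw] Fx a b B.
have s0 := enorm_gt0 x0; have xs : `|x| <= enorm x by exact: norm_le_enorm.
have sm : enorm x < m.
  apply: (le_lt_trans (enorm_le_norm x)); move: xm; rewrite ltr_pdivlMr//.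
  by apply: le_lt_trans; rewrite mulrC ler_wpM2l// lerDl.
move: sm; rewrite !lt_min => /andP[/andP[/andP[xP xE] xrho] /andP[/andP[xbeta xgamma] xL]].
set s := enorm x in s0 xs xP xE xrho xbeta xgamma xL *.
have [Ux Px gPx] := HP x (le_lt_trans xs xP).
have [_ _ gEx] := HE x (le_lt_trans xs xE); rewrite gE// in gEx.
have phx := Hrho x (le_lt_trans xs xrho).
have sr0 : 0 < s ^+ r by exact: exprn_gt0.
have xsr k : `|x| ^+ k <= s ^+ k by rewrite lerXn2r ?nnegrE// ltW.
have tKP : `|t - t0| * KP <= w2.
  move: tw; rewrite ltr_pdivlMr ?ltr_wpDl// => /ltW; apply: le_trans.
  by rewrite ler_wpM2l// lerDl.
have horn_x : enorm (poly_map h x) <= w * s ^+ r.+1.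
  apply: (le_trans (enorm_le_norm _)).
  have hx : `|poly_map h x| <= 2 * w2 * s ^+ r.+1.
    have -> : poly_map h x = (t0 - t) *: P x - (f x + t0 *: P x - poly_map h x).
      have -> : f x = - (t *: P x) by apply/eqP; rewrite -addr_eq0 Fx.
      by apply/rowP => j; rewrite !mxE; ring.
    apply: (le_trans (ler_normB _ _)); rewrite normrZ distrC.
    have H1 : `|t - t0| * `|P x| <= w2 * `|x| ^+ r.+1.
      apply: (le_trans (ler_wpM2l (normr_ge0 _) Px)).
      by rewrite mulrA ler_wpM2r// exprn_ge0.
    have := ler_wpM2l (ltW w20) (xsr r.+1); lra.
  apply: (le_trans (ler_wpM2l (ler0n _ p) hx)).
  by rewrite mulrA ler_wpM2r// exprn_ge0// ltW.
have {}ang := ang x x0 xbeta horn_x a.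
have {}Hg := Hgamma x x0 xgamma horn_x a.
rewrite -/s in ang Hg; set Nh := a *m pjac h x in ang Hg.
have BE : B = pjac h x + ((gradmx f x - pjac h x) + t *: gradmx P x).
  by rewrite /B gB// addrA [pjac h x + _]addrC subrK.
have tT : `|t| <= T.
  rewrite -(subrK t0 t); apply: (le_trans (ler_normD _ _)).
  by rewrite /T addrC lerD2l ltW.
pose E2 := (gradmx f x - pjac h x) + t *: gradmx P x.
have E2x : `|E2| <= (KE + T * KP) * s ^+ r.
  apply: (le_trans (ler_normD _ _)); rewrite normrZ mulrDl.
  have := ler_wpM2l KE0 (xsr r); have := ler_wpM2l KP0 (xsr r) => H1 H2.
  have := ler_pM (normr_ge0 _) (normr_ge0 _) tT (le_trans gPx H1); rewrite mulrA.
  by move=> H3; apply: lerD => //; exact: le_trans H2.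
have aE2 : enorm (a *m E2) <= 8^-1 * enorm Nh.
  apply: (le_trans (enorm_mulmx_le _ _)).
  have H1 := ler_wpM2l (mulr_ge0 (mulr_ge0 (ler0n _ n) (ler0n _ p)) (normr_ge0 a)) E2x.
  apply: (le_trans H1).
  rewrite [leLHS](_ : _ = K2 * (s ^+ r * `|a|)); last by rewrite K2E; ring.
  apply: (le_trans (ler_wpM2l K20 Hg)); rewrite mulrA.
  by rewrite ler_wpM2r ?enorm_ge0.
have aB : a *m B = Nh + a *m E2 by rewrite BE mulmxDr.
have Nh_le : 7 / 8 * enorm Nh <= enorm (a *m B) by rewrite aB; exact: enorm_perturb.
have low : 2^-1 * enorm (a *m B) <= enorm (a *m B + b *: x).
  by apply: angle_low; rewrite aB; exact: angle_perturb.
have a_le : s ^+ r * `|a| <= eta * (3 * enorm (a *m B + b *: x)).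
  apply: (le_trans Hg); apply: ler_wpM2l; first exact: ltW.
  clear - Nh_le low; have := enorm_ge0 Nh; lra.
split.
  apply: (le_trans (edot_le_norm _ _)).
  have H1 : `|P x| <= KP * (s * s ^+ r).
    by rewrite -exprS; apply: (le_trans Px); exact: ler_wpM2l.
  apply: (le_trans (ler_wpM2l (mulr_ge0 (ler0n _ p) (normr_ge0 a)) H1)).
  rewrite [leLHS](_ : _ = p%:R * KP * s * (s ^+ r * `|a|)); last by ring.
  have c0 : 0 <= p%:R * KP * s by rewrite !mulr_ge0// ltW.
  apply: (le_trans (ler_wpM2l c0 a_le)).
  rewrite [leLHS](_ : _ = L * s * enorm (a *m B + b *: x)); last by rewrite /L; ring.
  apply: ler_wpM2r; first exact: enorm_ge0.
  move: xL; rewrite ltr_pdivlMr// => /ltW; apply: le_trans.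
  by rewrite mulrC ler_wpM2l// ?lerDl// ltW.
move=> aB0; have Nh0 : enorm Nh = 0.
  apply/eqP; rewrite eq_le enorm_ge0 andbT.
  by move: Nh_le; rewrite aB0 enorm0 pmulr_rle0// divr_gt0.
move: Hg; rewrite Nh0 mulr0 pmulr_rle0// normr_le0 => /eqP//.
Qed.

End LocalEstimate.

(** * Orthogonal decompositions, product rules and critical points *)

Section Linear.
Variable R : realType.

Lemma edotE N (u v : 'rV[R]_N) : edot u v = (u *m v^T) 0 0.
Proof. by rewrite mxE; apply: eq_bigr => j _; rewrite mxE. Qed.

Lemma edot_mulmx m N (u : 'rV[R]_m) (A : 'M[R]_(m, N)) (v : 'rV[R]_N) :
  edot (u *m A) v = edot u (v *m A^T).
Proof. by rewrite !edotE trmx_mul trmxK mulmxA. Qed.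

Lemma mulmx_tr_eq0 m N (u : 'rV[R]_m) (A : 'M[R]_(m, N)) : u *m (A *m A^T) = 0 -> u *m A = 0.
Proof.
by move=> uA; apply: edot_eq0; rewrite edot_mulmx -mulmxA uA edot0r.
Qed.

(** Normal equations: A A^T has the rank of A, so e A^T always lies in its row space, even when the
    rows of A are dependent. *)
Lemma orth_decomp m N (A : 'M[R]_(m, N)) (e : 'rV[R]_N) :
  exists (u : 'rV[R]_m) (k : 'rV[R]_N), e = u *m A + k /\ k *m A^T = 0.
Proof.
have kk : (kermx (A *m A^T) <= kermx A)%MS.
  apply/rV_subP => v /sub_kermxP vA; apply/sub_kermxP; exact: mulmx_tr_eq0.
have rk : (\rank A <= \rank (A *m A^T))%N.
  by have := mxrankS kk; rewrite !mxrank_ker leq_sub2lE ?rank_leq_row.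
have : (A^T <= A *m A^T)%MS.
  have /mxrank_leqif_sup[_ <-] := submxMl A A^T.
  by rewrite eqn_leq mxrankM_maxr mxrank_tr.
move=> /(submx_trans (submxMl e _))/submxP[u uE].
exists u, (e - u *m A); rewrite addrC subrK; split=> //.
by rewrite mulmxBl uE mulmxA subrr.
Qed.

Lemma orth_ker m N (A : 'M[R]_(m, N)) (v : 'rV[R]_N) :
  (forall k, k *m A^T = 0 -> edot v k = 0) -> exists u, v = u *m A.
Proof.
move=> vk; have [u [k [vE kA]]] := orth_decomp A v; exists u.
suff k0 : k = 0 by rewrite vE k0 addr0.
by apply: edot_eq0; have := vk k kA; rewrite vE edotDl edot_mulmx kA edot0r add0r.
Qed.

End Linear.

Section MoreDerive.
Variables (R : realType) (V : normedModType R).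

Lemma derive_mulmx m n p (f : V -> 'M[R]_(m, n)) (g : V -> 'M[R]_(n, p)) x v :
  differentiable f x -> differentiable g x ->
  derivable (fun y => f y *m g y) x v /\
  'D_v (fun y => f y *m g y) x = 'D_v f x *m g x + f x *m 'D_v g x.
Proof.
move=> df dg.
have dfi i j : is_derive x v (fun y => f y i j : R^o) ('D_v f x i j).
  rewrite derive_coord//; apply: derivableP; apply: diff_derivable; exact: differentiable_coordf.
have dgi i j : is_derive x v (fun y => g y i j : R^o) ('D_v g x i j).
  rewrite derive_coord//; apply: derivableP; apply: diff_derivable; exact: differentiable_coordf.
have H i j : is_derive x v (fun y => (f y *m g y) i j : R^o)
    (('D_v f x *m g x + f x *m 'D_v g x) i j).
  rewrite (_ : (fun y => _) = \sum_l ((fun y => f y i l : R^o) * (fun y => g y l j : R^o))); last first.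
    by apply/funext => y; rewrite mxE fct_sumE.
  apply: is_derive_eq; rewrite !mxE -big_split; apply: eq_bigr => l _ /=.
  by rewrite addrC; congr (_ + _); rewrite /GRing.scale /= mulrC.
have dfg : derivable (fun y => f y *m g y) x v by apply/derivable_mxP => i j; case: (H i j).
split=> //; rewrite derive_mx//; apply/matrixP => i j; rewrite mxE.
by case: (H i j).
Qed.

Lemma Ck_row_mx m n1 n2 k (U : set V) (f : V -> 'M[R]_(m, n1)) (g : V -> 'M[R]_(m, n2)) :
  open U -> Ck k U f -> Ck k U g -> Ck k U (fun x => row_mx (f x) (g x)).
Proof.
move=> oU fk gk; apply: Ck_mx => // i j.
case: (splitP j) => l jl.
  apply: (@Ck_eq _ _ R^o _ _ (fun x => f x i l)); last exact: Ck_coord.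
  by move=> x; rewrite (_ : j = lshift n2 l) ?row_mxEl//; apply: val_inj.
apply: (@Ck_eq _ _ R^o _ _ (fun x => g x i l)); last exact: Ck_coord.
by move=> x; rewrite (_ : j = rshift n1 l) ?row_mxEr//; apply: val_inj.
Qed.

Lemma Ck_lsubmx m n1 n2 k (U : set V) (f : V -> 'M[R]_(m, n1 + n2)) :
  open U -> Ck k U f -> Ck k U (fun x => lsubmx (f x)).
Proof.
move=> oU fk; apply: Ck_mx => // i j.
by apply: Ck_eq (Ck_coord i (lshift n2 j) oU fk) => x; rewrite mxE.
Qed.

Lemma Ck_rsubmx m n1 n2 k (U : set V) (f : V -> 'M[R]_(m, n1 + n2)) :
  open U -> Ck k U f -> Ck k U (fun x => rsubmx (f x)).
Proof.
move=> oU fk; apply: Ck_mx => // i j.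
by apply: Ck_eq (Ck_coord i (rshift n1 j) oU fk) => x; rewrite mxE.
Qed.

Lemma derive_row_mx m n1 n2 (f : V -> 'M[R]_(m, n1)) (g : V -> 'M[R]_(m, n2)) x v :
  derivable f x v -> derivable g x v ->
  'D_v (fun y => row_mx (f y) (g y)) x = row_mx ('D_v f x) ('D_v g x).
Proof.
move=> df dg.
have H i j : derivable (fun y => row_mx (f y) (g y) i j : R^o) x v /\
   'D_v (fun y => row_mx (f y) (g y) i j : R^o) x = row_mx ('D_v f x) ('D_v g x) i j.
  case: (splitP j) => l jl.
    rewrite (_ : j = lshift n2 l); last exact: val_inj.
    rewrite row_mxEl; under eq_fun do rewrite row_mxEl.
    by split; [move/derivable_mxP: df; exact|rewrite (derive_mx df) mxE].
  rewrite (_ : j = rshift n1 l); last exact: val_inj.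
  rewrite row_mxEr; under eq_fun do rewrite row_mxEr.
  by split; [move/derivable_mxP: dg; exact|rewrite (derive_mx dg) mxE].
rewrite derive_mx; last by apply/derivable_mxP => i j; case: (H i j).
by apply/matrixP => i j; rewrite mxE; case: (H i j).
Qed.

Lemma local_min_derive0 (f : V -> R^o) y u : differentiable f y ->
  (\forall x \near y, f y <= f x) -> 'D_u f y = 0.
Proof.
move=> df fmin; apply/eqP/negPn/negP => D0.
set D := 'D_u f y in D0.
have e0 : 0 < `|D| / 2 / (`|u| + 1) by rewrite !divr_gt0 ?normr_gt0// ltr_wpDl.
have /nbhs_ballP[d1 d1_gt0 H1] := diff_eps df e0.
have /nbhs_ballP[d2 d2_gt0 H2] := fmin.
pose s := Num.min d1 d2 / 2 / (`|u| + 1).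
have u1 : 0 < `|u| + 1 by rewrite ltr_wpDl.
have d_gt0 : 0 < Num.min d1 d2 by rewrite lt_min d1_gt0.
have s0 : 0 < s by rewrite !divr_gt0.
pose h := (- s * Num.sg D) *: u.
have sgD : `|Num.sg D| = 1 by rewrite normr_sg D0.
have hs : `|h| = s * `|u| by rewrite normrZ normrM normrN sgD mulr1 gtr0_norm.
have hd : `|h| < Num.min d1 d2.
  rewrite hs /s mulrAC ltr_pdivrMr//.
  have : Num.min d1 d2 / 2 * `|u| <= Num.min d1 d2 / 2 * (`|u| + 1) by rewrite ler_wpM2l ?lerDl// ltW// divr_gt0.
  have : 0 < Num.min d1 d2 * (`|u| + 1) by rewrite mulr_gt0.
  lra.
have h1 : `|h| < d1 by apply: (lt_le_trans hd); rewrite ge_min lexx.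
have h2 : `|h| < d2 by apply: (lt_le_trans hd); rewrite ge_min lexx orbT.
have := H1 h; rewrite -ball_normE /= sub0r normrN => /(_ h1).
have := H2 (h + y); rewrite -ball_normE /= opprD addrCA subrr addr0 normrN => /(_ h2) fy.
have -> : 'd f y h = - (s * `|D|).
  by rewrite /h linearZ -(deriveE u df) -/D /= /GRing.scale /= normrEsg; ring.
rewrite hs opprK => H.
have sD : 0 < s * `|D| by rewrite mulr_gt0// normr_gt0.
have : `|D| / 2 / (`|u| + 1) * (s * `|u|) <= s * `|D| / 2.
  have -> : `|D| / 2 / (`|u| + 1) * (s * `|u|) = s * `|D| / 2 * (`|u| / (`|u| + 1)).
    by ring.
  by apply: ler_piMr; [lra|rewrite ler_pdivrMr// mul1r lerDl].
have := ler_norm (f (h + y) - f y + s * `|D|); lra.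
Qed.

End MoreDerive.

Lemma Ck_edot (R : realType) (V : normedModType R) N k (U : set V) (f g : V -> 'rV[R]_N) :
  open U -> Ck k U f -> Ck k U g -> Ck k U (fun x => edot (f x) (g x) : R^o).
Proof.
by move=> oU fk gk; apply: Ck_sum => // j; apply: CkM => //; exact: Ck_coord.
Qed.

Lemma derive_edot (R : realType) (V : normedModType R) N (f g : V -> 'rV[R]_N) x v :
  differentiable f x -> differentiable g x ->
  differentiable (fun y => edot (f y) (g y) : R^o) x /\
  'D_v (fun y => edot (f y) (g y) : R^o) x = edot ('D_v f x) (g x) + edot (f x) ('D_v g x).
Proof.
move=> df dg.
have E : (fun y => edot (f y) (g y) : R^o) =
    \sum_j ((fun y => f y 0 j : R^o) * (fun y => g y 0 j : R^o)).
  by apply/funext => y; rewrite fct_sumE.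
have dfj j := differentiable_coordf 0 j df.
have dgj j := differentiable_coordf 0 j dg.
rewrite E; split; first by apply: differentiable_sum => j; apply: differentiableM.
have dfd j := @diff_derivable _ _ _ _ _ v (dfj j).
have dgd j := @diff_derivable _ _ _ _ _ v (dgj j).
rewrite derive_sum; last by move=> j; exact: derivableM.
rewrite /edot -big_split; apply: eq_bigr => j _ /=.
rewrite (deriveM (dfd j) (dgd j)) (derive_coord v 0 j df) (derive_coord v 0 j dg) addrC.
by congr (_ + _); rewrite /GRing.scale /= mulrC.
Qed.

Lemma enorm_continuous (R : realType) N (y : 'rV[R]_N) :
  continuous (fun z : 'rV[R]_N => enorm (z - y)).
Proof.
move=> u; have zk := CkB openT (Ck_id 0 setT) (Ck_cst 0 setT y).
have c1 := Ck_cts (Ck_edot openT zk zk) (I : setT u).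
exact: (continuous_comp c1 (@sqrt_continuous R _)).
Qed.

Lemma open_enormlt (R : realType) N (y : 'rV[R]_N) (d : R) : open [set z | enorm (z - y) < d].
Proof.
rewrite (_ : mkset _ = (fun z => enorm (z - y)) @^-1` [set t | t < d]) //.
apply: open_comp; last exact: open_lt.
by move=> z _; exact: enorm_continuous.
Qed.

Lemma nbhs_enormlt (R : realType) N (y z : 'rV[R]_N) (d : R) : enorm (z - y) < d ->
  nbhs z [set z | enorm (z - y) < d].
Proof. by move=> zd; apply: open_nbhs_nbhs; split=> //; exact: open_enormlt. Qed.

Lemma line_diff (R : realType) (V : normedModType R) (x v : V) :
  exists l : R^o -> V, [/\ forall t, l t = x + t *: v, differentiable l (0 : R^o),
    l 0 = x & 'd l (0 : R^o) (1 : R^o) = v].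
Proof.
pose l (t : R^o) := x + t *: v; exists l.
have dl : is_diff (0 : R^o) l ( *:%R^~ v).
  by apply: is_diff_eq; apply/funext => h /=; rewrite fctE add0r.
by split; [|apply: ex_diff|rewrite /l scale0r addr0|rewrite diff_val scale1r].
Qed.

Lemma derive_near_cst (R : realType) (V W : normedModType R) (f : V -> W) z u (w : W) :
  differentiable f z -> (\forall x \near z, f x = w) -> 'D_u f z = 0.
Proof.
move=> df fw; rewrite -(derive_cst w z u); apply: near_eq_derive.
by move: fw; apply: filterS.
Qed.

(** * Limits of planes *)

Section Grassmann.
Variables (R : realType) (N : nat).

Lemma vspace_orth_decomp (E : {vspace 'rV[R]_N}) v :
  exists k, [/\ v - k \in E & forall q, q \in E -> edot k q = 0].
Proof.
pose A := \matrix_(i < \dim E) (vbasis E)`_i.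
have [u [k [-> kA]]] := orth_decomp A v; exists k; split.
  rewrite addrK mulmx_sum_row; apply: rpred_sum => i _; apply: rpredZ.
  by rewrite rowK; apply: vbasis_mem; apply: mem_nth; rewrite size_tuple.
move=> q /coord_vbasis ->.
have -> : \sum_i coord (vbasis E) i q *: (vbasis E)`_i = (\row_i coord (vbasis E) i q) *m A.
  by rewrite mulmx_sum_row; apply: eq_bigr => i _; rewrite rowK mxE.
by rewrite edotC edot_mulmx kA edot0r.
Qed.

(** A unit vector of P is within the gap of Q, and [k] sees only its difference from a vector of
    Q. *)
Lemma gap_orth (P Q : {vspace 'rV[R]_N}) k w : w \in P ->
  (forall q, q \in Q -> edot k q = 0) ->
  `|edot w k| <= enorm w * enorm k * gap P Q.
Proof.
move=> wP kQ; have [->|w0] := eqVneq w 0; first by rewrite edot0l normr0 enorm0 !mul0r.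
have [->|k0] := eqVneq k 0; first by rewrite edot0r normr0 enorm0 mulr0 mul0r.
have ew : 0 < enorm w by rewrite enorm_gt0.
have ek : 0 < enorm k by rewrite enorm_gt0.
pose v := (enorm w)^-1 *: w.
have ev : enorm v = 1 by rewrite enormZ gtr0_norm ?invr_gt0// mulVf// gt_eqF.
have vP : v \in P by rewrite rpredZ.
have le_gap : edist v Q <= gap P Q.
  apply: sup_upper_bound; last by exists v.
  split; first by exists (edist v Q), v.
  exists 1 => _ [x [xP x1] <-]; rewrite -x1 -[x in X in _ <= X]subr0.
  by apply: edist_le; exact: mem0v.
apply: (@le_trans _ _ (enorm w * enorm k * edist v Q)); last by rewrite ler_wpM2l// mulr_ge0// ltW.
rewrite -ler_pdivrMl ?mulr_gt0//; apply: lb_le_inf.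
  by exists (enorm (v - 0)), 0 => //=; exact: mem0v.
move=> _ [q /= qQ <-]; rewrite ler_pdivrMl ?mulr_gt0//.
have -> : edot w k = enorm w * edot (v - q) k.
  by rewrite edotBl (edotC q) kQ// subr0 edotZl mulrA divff ?mul1r// gt_eqF.
rewrite normrM gtr0_norm// -mulrA ler_wpM2l ?(ltW ew)// mulrC.
exact: edot_le.
Qed.

(** The form in which limits of planes are used. The component k of v normal to tau satisfies |k|^2
    = <v - w, k> + <w, k> for w in [P i]; the first term is small by approximation, the second by
    the gap. *)
Lemma grassmann_limit d (P : nat -> {vspace 'rV[R]_N}) tau v : grassmann_cvg d P tau ->
  (forall e, 0 < e -> \forall i \near \oo, exists2 w, w \in P i & enorm (v - w) <= e) ->
  v \in tau.
Proof.
move=> [_ _ gP] H; have [k [vk kQ]] := vspace_orth_decomp tau v.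
suff k0 : k = 0 by rewrite k0 subr0 in vk.
apply/eqP/negPn/negP => k0; have ek : 0 < enorm k by rewrite enorm_gt0.
have v0 := enorm_ge0 v.
(* Chosen so that |k|^2 <= e (|v| + 2) |k| <= |k|^2 / 2. *)
pose e := Num.min 1 (enorm k / (2 * (enorm v + 2))).
have e0 : 0 < e by rewrite lt_min ltr01 divr_gt0// mulr_gt0// ltr_wpDl.
have vvk : edot v k = enorm k * enorm k.
  have := kQ _ vk; rewrite edotC edotBl => /eqP; rewrite subr_eq0 => /eqP ->.
  by rewrite -sqr_enorm expr2.
have g1 : \forall i \near \oo, gap (P i) tau < e.
  have B : nbhs (0 : R^o) [set x : R^o | x < e].
    by apply: open_nbhs_nbhs; split; [exact: open_lt|].
  exact: (gP _ B).
have [i [[w wP vw] gi]] : exists i, (exists2 w, w \in P i & enorm (v - w) <= e) /\ gap (P i) tau < e.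
  by apply: (@filter_ex _ \oo); apply: filterI => //; exact: H.
have H1 := gap_orth wP kQ.
have H2 := edot_le (v - w) k.
have H3 : enorm w <= enorm v + e.
  have := enormD v (w - v); rewrite addrC subrK -(enormN (w - v)) opprB; lra.
have H4 : enorm k * enorm k <= enorm (v - w) * enorm k + enorm w * enorm k * gap (P i) tau.
  have -> : enorm k * enorm k = edot (v - w) k + edot w k by rewrite -edotDl subrK.
  have := ler_norm (edot (v - w) k); have := ler_norm (edot w k); lra.
have e1 : e <= 1 by rewrite ge_min lexx.
have e2 : e * (2 * (enorm v + 2)) <= enorm k.
  by rewrite -ler_pdivlMr ?ge_min ?lexx ?orbT// mulr_gt0// ltr_wpDl.
have w0 := enorm_ge0 w.
have H5 : enorm w * enorm k * gap (P i) tau <= (enorm v + 1) * enorm k * e.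
  apply: (@le_trans _ _ (enorm w * enorm k * e)).
    by rewrite ler_wpM2l ?mulr_ge0 ?enorm_ge0// ltW.
  by rewrite ler_wpM2r ?(ltW e0)// ler_wpM2r ?enorm_ge0//; lra.
have H6 : enorm (v - w) * enorm k <= e * enorm k by rewrite ler_wpM2r ?enorm_ge0.
have : enorm k * enorm k <= (e * (enorm v + 2)) * enorm k by lra.
rewrite ler_pM2r// => H7; lra.
Qed.

Lemma open_tangent_space (X : set 'rV[R]_N) x : open X -> X x ->
  tangent_space X x = fullv.
Proof.
move=> oX Xx.
have H v : tangent_vector X x v.
  have [l [_ dl0 l0 l1]] := line_diff x v.
  exists l; split=> //.
    have Bl : nbhs (l 0) X by rewrite l0; apply: open_nbhs_nbhs.
    exact: (differentiable_continuous dl0 Bl).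
  by apply: DeriveDef; [exact: diff_derivable|rewrite (deriveE _ dl0) l1].
have := @xgetPex _ 0%VS [set E : {vspace 'rV[R]_N} | forall v, v \in E <-> tangent_vector X x v].
move=> /(_ _)/= HE; apply/eqP; rewrite eqEsubv subvf /=; apply/subvP => v _.
apply/HE => //; exists fullv => w; split=> // _; exact: memvf.
Qed.
End Grassmann.

(** * Tubular neighbourhoods by nearest-point projection *)

Section Tube.
Variables (R : realType) (N c k : nat) (O : set 'rV[R]_N).
(** The derivative is passed as data, so that the axis can use a constant matrix and the smooth part
    of F = 0 can use [jacobian]. *)
Variables (F : 'rV[R]_N -> 'rV[R]_c) (J : 'rV[R]_N -> 'M[R]_(N, c)).
Hypotheses (oO : open O) (Fk : Ck k.+2 O F) (Jk : Ck k.+1 O J).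
Hypothesis JE : forall y v, O y -> 'D_v F y = v *m J y.
Hypothesis Jfree : forall y (e : 'rV[R]_c), O y -> e *m (J y)^T = 0 -> e = 0.

Let Y := [set z | O z /\ F z = 0].

Let O2 := [set w : 'rV[R]_(N + c) | O (lsubmx w)].

(* Psi (y, e) = (y + the normal vector at y with coordinates e, F y) is a local
   diffeomorphism at (y0, 0); inverting it at (z, 0) projects z to F = 0. *)
Let Psi (w : 'rV[R]_(N + c)) : 'rV[R]_(N + c) :=
  row_mx (lsubmx w + rsubmx w *m (J (lsubmx w))^T) (F (lsubmx w)).

Lemma JtJ_unit y : O y -> (J y)^T *m J y \in unitmx.
Proof.
move=> Oy; rewrite -row_free_unit -kermx_eq0; apply/rowV0P => e /sub_kermxP.
by rewrite -{2}(trmxK (J y)) => /mulmx_tr_eq0/(Jfree Oy).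
Qed.

Lemma open_O2 : open O2.
Proof. by apply: open_comp => // w _; exact: continuous_lsubmx. Qed.

Lemma Ck_Psi : Ck k.+1 O2 Psi.
Proof.
have oO2 := open_O2.
have lk : Ck k.+1 O2 (lsubmx : 'rV[R]_(N + c) -> 'rV[R]_N).
  by apply: (Ck_lsubmx (f := id)) => //; exact: Ck_id.
have rk : Ck k.+1 O2 (rsubmx : 'rV[R]_(N + c) -> 'rV[R]_c).
  by apply: (Ck_rsubmx (f := id)) => //; exact: Ck_id.
have Jl : Ck k.+1 O2 (fun w => J (lsubmx w)).
  by apply: (@Ck_comp _ _ _ _ _ _ O2 O) => // i j; exact: Ck_coord.
have Fl : Ck k.+1 O2 (fun w => F (lsubmx w)).
  by apply: (@Ck_comp _ _ _ _ _ _ O2 O) => // i j; apply: Ck_coord => //; exact: CkW.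
exact: (Ck_row_mx oO2 (CkD oO2 lk (Ck_mulmx oO2 rk (Ck_trmx oO2 Jl))) Fl).
Qed.

Lemma derive_Psi y (v : 'rV[R]_N) (e : 'rV[R]_c) : O y ->
  'D_(row_mx v e) Psi (row_mx y 0) = row_mx (v + e *m (J y)^T) (v *m J y).
Proof.
move=> Oy; have O2y : O2 (row_mx y 0) by rewrite /O2 /= row_mxKl.
have oO2 := open_O2.
have lk : Ck 1 O2 (lsubmx : 'rV[R]_(N + c) -> 'rV[R]_N).
  by apply: (Ck_lsubmx (f := id)) => //; exact: Ck_id.
have rk : Ck 1 O2 (rsubmx : 'rV[R]_(N + c) -> 'rV[R]_c).
  by apply: (Ck_rsubmx (f := id)) => //; exact: Ck_id.
have Jl : Ck 1 O2 (fun w => (J (lsubmx w))^T).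
  apply: Ck_trmx => //; apply: (@Ck_comp _ _ _ _ _ _ O2 O) => // i j.
  by apply: Ck_coord => //; exact: Ck_le Jk.
have dl := lk.1 _ O2y; have dr := rk.1 _ O2y; have dJ := Jl.1 _ O2y.
have Dl : 'D_(row_mx v e) (lsubmx : 'rV[R]_(N + c) -> 'rV[R]_N) (row_mx y 0) = v.
  rewrite (deriveE _ dl) diff_lin /=; first exact: row_mxKl.
  by move=> w; exact: continuous_lsubmx.
have Dr : 'D_(row_mx v e) (rsubmx : 'rV[R]_(N + c) -> 'rV[R]_c) (row_mx y 0) = e.
  rewrite (deriveE _ dr) diff_lin /=; first exact: row_mxKr.
  by move=> w; exact: continuous_rsubmx.
have dF : differentiable F (lsubmx (row_mx y (0 : 'rV[R]_c))).
  by rewrite row_mxKl; apply: Fk.1.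
have [dm Dm] := derive_mulmx (row_mx v e) dr dJ.
have dl' := @diff_derivable _ _ _ _ _ (row_mx v e) dl.
have dFl := differentiable_comp dl dF.
have dF' := @diff_derivable _ _ _ _ _ (row_mx v e) dFl.
have D1 := deriveD dl' dm.
have DF : 'D_(row_mx v e) (F \o lsubmx) (row_mx y 0) = v *m J y.
  rewrite (deriveE _ dFl) (diff_comp dl dF) /= -(deriveE _ dl) Dl.
  by rewrite -(deriveE _ dF) row_mxKl JE.
apply: (etrans (derive_row_mx (derivableD dl' dm) dF')).
by rewrite D1 DF Dl Dm Dr row_mxKl row_mxKr mul0mx addr0.
Qed.

(** A kernel vector (v, e) has v = - e J^T normal and v J = 0 tangent at y, hence v = 0, and then e
    = 0. *)
Lemma jacobian_Psi_unit y : O y -> jacobian Psi (row_mx y 0) \in unitmx.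
Proof.
move=> Oy; have O2y : O2 (row_mx y 0) by rewrite /O2 /= row_mxKl.
rewrite -row_free_unit -kermx_eq0; apply/rowV0P => w /sub_kermxP.
rewrite -deriveEjacobian; last by apply: Ck_Psi.1.
rewrite -(hsubmxK w) derive_Psi// -row_mx0 => /eq_row_mx[].
set v := lsubmx w; set e := rsubmx w => ve vJ.
have v0 : v = 0.
  apply: edot_eq0; have -> : edot v v = - edot v (e *m (J y)^T).
    by rewrite -edotNr; congr edot; apply/eqP; rewrite -addr_eq0 ve.
  by rewrite edotC edot_mulmx trmxK vJ edot0r oppr0.
by move: ve; rewrite v0 add0r => /(Jfree Oy) ->; rewrite row_mx0.
Qed.

Lemma norm_row_mx (y : 'rV[R]_N) (e : 'rV[R]_c) d :
  `|y| < d -> `|e| < d -> `|row_mx y e| < d.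
Proof.
move=> yd ed; have d0 : 0 < d by exact: le_lt_trans yd.
apply: (@le_lt_trans _ _ (Num.max `|y| `|e|)); last by rewrite gt_max yd.
apply: norm_le_coord => [|i j]; first by rewrite le_max normr_ge0.
rewrite mxE le_max; case: splitP => l _.
  by rewrite coord_le_norm.
by rewrite coord_le_norm orbT.
Qed.

(** [pil] and [cl] read the foot and the normal coordinates of z off the local inverse of [Psi] at
    (z, 0). Uniqueness is phrased with the normal vector e J^T, whose length is what will be
    controlled, rather than with e. *)
Lemma chart y0 : Y y0 -> exists (eps : R) (pil : 'rV[R]_N -> 'rV[R]_N) (cl : 'rV[R]_N -> 'rV[R]_c),
  [/\ 0 < eps,
     forall z, `|z - y0| < eps ->
       [/\ O z, Y (pil z) & z = pil z + cl z *m (J (pil z))^T],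
     Ck k.+1 [set z | `|z - y0| < eps] pil, Ck k.+1 [set z | `|z - y0| < eps] cl &
     forall y e, Y y -> `|y - y0| < eps -> `|e *m (J y)^T| < eps ->
       `|y + e *m (J y)^T - y0| < eps ->
       pil (y + e *m (J y)^T) = y /\ cl (y + e *m (J y)^T) = e].
Proof.
move=> [Oy0 Fy0]; have O2y : O2 (row_mx y0 0) by rewrite /O2 /= row_mxKl.
have [d [chi [W [d0 inj [oW Wy0] chiP chik]]]] :=
  inverse_function open_O2 O2y Ck_Psi (jacobian_Psi_unit Oy0).
have Psi0 : Psi (row_mx y0 0) = row_mx y0 0.
  by rewrite /Psi row_mxKl row_mxKr mul0mx addr0 Fy0.
rewrite Psi0 in Wy0.
have [d1 d1_gt0 H1] := open_ball oW Wy0.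
have [d2 d2_gt0 H2] := open_ball oO Oy0.
(* A right inverse of (J y)^T: it recovers e from e (J y)^T, and its bound near y0 turns a short
   normal vector into small coordinates. *)
pose G y := J y *m invmx ((J y)^T *m J y).
have Gk : Ck 0 O G.
  have J0 : Ck 0 O J by exact: (Ck_le (leq0n _) Jk).
  exact: (Ck_mulmx oO J0 (Ck_invmx oO JtJ_unit (Ck_mulmx oO (Ck_trmx oO J0) J0))).
have [d3 d3_gt0 H3] := cts_ball (Gk y0 Oy0) ltr01.
pose M := N%:R * (`|G y0| + 1) + 1.
have M0 : 0 < M by rewrite ltr_wpDl// mulr_ge0// addr_ge0.
pose eps := Num.min (Num.min (Num.min d1 d2) d3) (Num.min d (d / M)).
have eps0 : 0 < eps by rewrite !lt_min d1_gt0 d2_gt0 d3_gt0 d0 divr_gt0.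
have rowm0 z : `|z - y0| < eps -> W (row_mx z 0).
  move=> zy; apply: H1; have -> : row_mx z 0 - row_mx y0 0 = row_mx (z - y0) (0 : 'rV[R]_c).
    by rewrite opp_row_mx add_row_mx subr0.
  have zd1 : `|z - y0| < d1 by apply: (lt_le_trans zy); rewrite !ge_min lexx.
  by apply: norm_row_mx; rewrite ?normr0.
pose pil z := lsubmx (chi (row_mx z 0)).
pose cl z := rsubmx (chi (row_mx z 0)).
have chirow : Ck k.+1 [set z | `|z - y0| < eps] (fun z => chi (row_mx z 0)).
  apply: (@Ck_comp _ _ _ _ _ _ _ W (fun z : 'rV[R]_N => row_mx z (0 : 'rV[R]_c)) chi) => //.
  - exact: open_normlt.
  - by apply: Ck_row_mx; [exact: open_normlt|exact: Ck_id|exact: Ck_cst].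
  - by move=> i j; exact: Ck_coord.
exists eps, pil, cl; split; first exact: eps0.
- move=> z zy; have [_ Oz] := chiP _ (rowm0 z zy).
  rewrite -(hsubmxK (chi (row_mx z 0))) /Psi row_mxKl row_mxKr => /eq_row_mx[zE F0].
  split; [|by split|by rewrite -[LHS]zE].
  by apply: H2; apply: (lt_le_trans zy); rewrite !ge_min lexx !orbT.
- exact: (Ck_lsubmx (@open_normlt _ _ _ _) chirow).
- exact: (Ck_rsubmx (@open_normlt _ _ _ _) chirow).
move=> y e [Oy Fy] yy0 eJ zy; set z := y + _ in zy *.
have Wz := rowm0 z zy; have [chid _ Psichi] := chiP _ Wz.
have ee : `|e| < d.
  have -> : e = e *m (J y)^T *m G y.
    by rewrite /G !mulmxA -(mulmxA e) -mulmxA mulmxV ?mulmx1 ?JtJ_unit.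
  apply: (le_lt_trans (mulmx_norm_le _ _)).
  have Gy : `|G y| <= `|G y0| + 1.
    have := H3 y; have yd3 : `|y - y0| < d3.
      by apply: (lt_le_trans yy0); rewrite !ge_min lexx !orbT.
    move=> /(_ yd3) H; have := ler_normD (G y - G y0) (G y0); rewrite subrK; lra.
  have eJd : `|e *m (J y)^T| * M < d.
    rewrite -ltr_pdivlMr//; apply: (lt_le_trans eJ).
    by rewrite !ge_min lexx !orbT.
  apply: le_lt_trans eJd; rewrite -mulrA mulrCA ler_wpM2l// /M.
  by have := ler_wpM2l (ler0n R N) Gy; lra.
have : chi (row_mx z 0) = row_mx y e.
  apply: inj; first exact: chid.
    rewrite opp_row_mx add_row_mx subr0; apply: norm_row_mx => //.
    by apply: (lt_le_trans yy0); rewrite !ge_min lexx !orbT.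
  by rewrite Psichi /Psi row_mxKl row_mxKr Fy.
by rewrite /pil /cl => ->; rewrite row_mxKl row_mxKr.
Qed.

Lemma proj_derive_ker (pi : 'rV[R]_N -> 'rV[R]_N) z u : differentiable pi z ->
  (\forall x \near z, Y (pi x)) -> 'D_u pi z *m J (pi z) = 0.
Proof.
move=> dpi Ypi; have [Opz _] := nbhs_singleton Ypi.
have dF : differentiable F (pi z) by exact: Fk.1.
have dc := differentiable_comp dpi dF.
have <- : 'D_u (F \o pi) z = 'D_u pi z *m J (pi z).
  by rewrite (deriveE _ dc) (diff_comp dpi dF) /= -(deriveE _ dpi) -(deriveE _ dF) JE.
apply: (@derive_near_cst _ _ _ _ _ _ 0 dc).
by move: Ypi; apply: filterS => x [].
Qed.

(** Differentiate x = pi x + ga x J^T at y, where ga vanishes: u = D_u pi + (D_u ga) J^T. For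
    tangent u the last term is tangent as well as normal, hence 0. *)
Lemma proj_derive_id (pi : 'rV[R]_N -> 'rV[R]_N) (ga : 'rV[R]_N -> 'rV[R]_c) y u :
  O y -> differentiable pi y -> differentiable ga y -> pi y = y -> ga y = 0 ->
  (\forall x \near y, Y (pi x) /\ x = pi x + ga x *m (J (pi x))^T) ->
  u *m J y = 0 -> 'D_u pi y = u.
Proof.
move=> Oy dpi dga piy gay H uJ.
have Ypi : \forall x \near y, Y (pi x) by move: H; apply: filterS => x [].
have xE : \forall x \near y, x = pi x + ga x *m (J (pi x))^T by move: H; apply: filterS => x [].
have dJ : differentiable (fun x => (J x)^T) (pi y).
  by rewrite piy; apply: (Ck_trmx oO Jk).1.
have dJpi : differentiable (fun x => (J (pi x))^T) y := differentiable_comp dpi dJ.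
have [dm Dm] := derive_mulmx u dga dJpi.
have dpi' := @diff_derivable _ _ _ _ _ u dpi.
have E : u = 'D_u pi y + 'D_u ga y *m (J y)^T.
  have := deriveD dpi' dm; rewrite Dm gay mul0mx addr0 piy => <-.
  by rewrite -[LHS](derive_id y u); apply: near_eq_derive.
have D0 := proj_derive_ker u dpi Ypi; rewrite piy in D0.
have gJ : 'D_u ga y *m (J y)^T = 0.
  set e := 'D_u ga y in E *; apply: edot_eq0; rewrite edot_mulmx trmxK.
  suff -> : e *m (J y)^T *m J y = 0 by rewrite edot0r.
  have -> : e *m (J y)^T = u - 'D_u pi y by apply/eqP; rewrite eq_sym subr_eq addrC; exact/eqP.
  by rewrite mulmxBl uJ D0 subrr.
by apply: esym; apply: (etrans E); rewrite gJ addr0.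
Qed.

Lemma chart_center y : Y y -> exists pil : 'rV[R]_N -> 'rV[R]_N,
  [/\ pil y = y, differentiable pil y, \forall z \near y, Y (pil z)
     & forall u, u *m J y = 0 -> 'D_u pil y = u].
Proof.
move=> Yy; have [eps [pil [cl [eps0 H1 pk ck uniq]]]] := chart Yy.
have [Oy Fy] := Yy.
have yin : `|y - y| < eps by rewrite subrr normr0.
have := uniq y 0 Yy yin; rewrite mul0mx addr0 normr0 => /(_ eps0 yin)[py cy].
have By := nbhs_normlt y eps0.
exists pil; split=> // [|| u uJ]; first exact: pk.1.
  by move: By; apply: filterS => z /H1[].
apply: (@proj_derive_id pil cl) => //; [exact: pk.1|exact: ck.1|].
by move: By; apply: filterS => z /H1[].
Qed.

(** For the converse, the straight line through y in direction v is pushed into Y by the local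
    projection. *)
Lemma tangent_vectorP y v : Y y -> tangent_vector Y y v <-> v *m J y = 0.
Proof.
move=> Yy; have [Oy Fy] := Yy; split=> [[ga [ga0 gaY gav]]|vJ].
  have dga : differentiable ga (0 : R^o) by apply/derivable1_diffP; case: gav.
  have dF : differentiable F (ga 0) by rewrite ga0; exact: Fk.1.
  have dc := differentiable_comp dga dF.
  have E : 'D_(1 : R^o) (F \o ga) (0 : R^o) = v *m J y.
    rewrite (deriveE _ dc) (diff_comp dga dF) /= -(deriveE _ dga).
    by case: gav => _ ->; rewrite -(deriveE _ dF) ga0 JE.
  rewrite -E; apply: (@derive_near_cst _ _ _ _ _ _ 0 dc).
  by move: gaY; apply: filterS => t [].
have [pil [py dp pY pD]] := chart_center Yy.
have [l [_ dl0 l0 l1]] := line_diff y v.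
have dp0 : differentiable pil (l 0) by rewrite l0.
have dc := differentiable_comp dl0 dp0.
exists (pil \o l); split; first by rewrite /= l0.
  rewrite -l0 in pY; exact: (differentiable_continuous dl0 pY).
apply: DeriveDef; first exact: diff_derivable.
by rewrite (deriveE _ dc) (diff_comp dl0 dp0) /= l1 -(deriveE _ dp0) l0 pD.
Qed.

Lemma tangent_spaceP y v : Y y -> (v \in tangent_space Y y) = (v *m J y == 0).
Proof.
move=> Yy; have H : forall v, v \in tangent_space Y y <-> tangent_vector Y y v.
  apply: (@xgetPex _ 0%VS [set E : {vspace 'rV[R]_N} | forall v, v \in E <-> tangent_vector Y y v]).
  exists (lker (linfun (mulmxr (J y)))) => w; rewrite tangent_vectorP// memv_ker lfunE /=.
  by split=> [/eqP|/eqP].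
by apply/idP/eqP => [/H/(tangent_vectorP _ Yy)//|vJ]; apply/H/tangent_vectorP.
Qed.

(** The local projection serves as a parametrisation of Y at y: x |-> |z - pil x|^2 has a local
    minimum at y, and its derivative along a tangent u is -2 <z - y, u>. *)
Lemma lagrange z y (d : R) : 0 < d -> Y y ->
  (forall y', Y y' -> `|y' - y| < d -> enorm (z - y) <= enorm (z - y')) ->
  exists e, z - y = e *m (J y)^T.
Proof.
move=> d0 Yy ymin; apply: orth_ker => u; rewrite trmxK => uJ.
have [pil [py dp pY pD]] := chart_center Yy.
pose h x := z - pil x.
have dh : differentiable h y by apply: differentiableB => //; exact: differentiable_cst.
have Dh : 'D_u h y = - u.
  have dp' := @diff_derivable _ _ _ _ _ u dp.
  apply: (etrans (deriveB (derivable_cst z _ _) dp')).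
  by rewrite derive_cst sub0r pD.
pose g x : R^o := edot (h x) (h x).
have [dg Dg] := derive_edot u dh dh.
have : 'D_u g y = 0.
  apply: local_min_derive0 => //.
  have pd : \forall x \near y, `|pil x - y| < d.
    have Bp := nbhs_normlt (pil y) d0; rewrite {2}py in Bp.
    exact: (differentiable_continuous dp Bp).
  move: pY pd; apply: filterS2 => x Yx xd.
  rewrite /g /h py -!sqr_enorm lerXn2r ?nnegrE ?enorm_ge0//.
  exact: ymin.
rewrite /g Dg Dh edotNl edotNr edotC => D2.
have : edot (h y) u = 0 by lra.
by rewrite /h py.
Qed.

Definition nearest (X : set 'rV[R]_N) (z y : 'rV[R]_N) : Prop :=
  X y /\ forall y', X y' -> enorm (z - y) <= enorm (z - y').

(** The choice among several nearest points is arbitrary; on the balls found in [good_exists] there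
    is only one. *)
Definition proj (X : set 'rV[R]_N) (z : 'rV[R]_N) := xget 0 [set y | nearest X z y].

Lemma normle_enorm (u : 'rV[R]_N) d : enorm u < d -> `|u| < d.
Proof. exact: le_lt_trans (norm_le_enorm u). Qed.

Lemma compact_section z (d : R) : (forall y, enorm (y - z) <= d -> O y) ->
  compact [set y | enorm (y - z) <= d /\ F y = 0].
Proof.
move=> dO; apply: bounded_closed_compact.
  exists (`|z| + d); split; first exact: num_real.
  move=> M dM y [yd _]; apply/ltW; apply: le_lt_trans dM.
  have := ler_normD (y - z) z; rewrite subrK => H; apply: (le_trans H).
  by rewrite addrC lerD2l; exact: le_trans (norm_le_enorm _) yd.
move=> y cy; have yd : enorm (y - z) <= d.
  rewrite leNgt; apply/negP => dy.
  have : nbhs y [set x | d < enorm (x - z)].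
    apply: (@enorm_continuous _ _ z y [set t | d < t]).
    by apply: open_nbhs_nbhs; split=> //; exact: open_gt.
  by move=> /cy[x [[xd _] /=]]; rewrite ltNge xd.
split=> //; apply/eqP/negPn/negP => Fy.
have Fc := Ck_cts Fk (dO _ yd).
have : nbhs y [set x | F x != 0].
  have : nbhs (F y) [set u | 0 < `|u|].
    apply: (@norm_continuous _ _ (F y) [set t | 0 < t]).
    by apply: open_nbhs_nbhs; split; [exact: open_gt|rewrite /= normr_gt0].
  move=> /Fc H; have {}H : nbhs y (F @^-1` [set u | 0 < `|u|]) by exact: H.
  by move: H; apply: filterS => x /=; rewrite normr_gt0.
by move=> /cy[x [[_ Fx] /=]]; rewrite Fx eqxx.
Qed.

(** Points of Y outside the closed ball about z through y0 are farther than y0, so a minimum over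
    the compact section is global. *)
Lemma nearest_exists z y0 : Y y0 -> (forall y, enorm (y - z) <= enorm (z - y0) -> O y) ->
  exists y, nearest Y z y.
Proof.
move=> [Oy0 Fy0] dO; set d := enorm (z - y0).
have zd : enorm (y0 - z) = d by rewrite -enormN opprB.
have K0 : [set y | enorm (y - z) <= d /\ F y = 0] !=set0.
  by exists y0; split=> //=; rewrite zd.
have cf : {within [set y | enorm (y - z) <= d /\ F y = 0], continuous (fun y => enorm (y - z))}.
  by apply: continuous_subspaceT => x; exact: enorm_continuous.
have [y + ymin] := EVT_min_rV K0 (compact_section dO) cf.
rewrite inE => -[yd Fy]; exists y; split; first by split=> //; exact: dO.
move=> y' [Oy' Fy'].
rewrite -(enormN (z - y)) opprB -(enormN (z - y')) opprB.
have [yd'|dy'] := leP (enorm (y' - z)) d; last exact: (le_trans yd (ltW dy')).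
by apply: ymin; rewrite inE.
Qed.

(* The projection is controlled on the ball of radius 2 d, which contains y + v
   for y in the ball of radius d and |v| < d. *)
Definition good (y0 : 'rV[R]_N) (d : R) : Prop :=
  [/\ Y y0, 0 < d, Ck k.+1 [set z | enorm (z - y0) < 2 * d] (proj Y),
     forall z, enorm (z - y0) < 2 * d ->
       [/\ O z, nearest Y z (proj Y z) &
         exists e, z - proj Y z = e *m (J (proj Y z))^T]
   & forall y e, Y y -> enorm (y - y0) < d -> enorm (e *m (J y)^T) < d ->
       proj Y (y + e *m (J y)^T) = y].

(** By [lagrange], z minus a nearest point is a normal vector, so uniqueness in the chart identifies
    that point with [pil z]. Thus the canonical [proj Y] inherits the smoothness of the chart. *)
Lemma good_exists y0 : Y y0 -> exists d, good y0 d.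
Proof.
move=> Yy0; have [eps [pil [cl [eps0 H1 pk ck uniq]]]] := chart Yy0.
(* If z is within 2 d = eps/2 of y0, its nearest point is within eps/2 of z, hence within eps of y0,
   inside the chart. *)
pose d := eps / 4; have d0 : 0 < d by rewrite divr_gt0.
have dE : 2 * d = eps / 2 by rewrite /d; lra.
have E2 : eps / 2 < eps by lra.
have near_pil z y : enorm (z - y0) < 2 * d -> nearest Y z y -> y = pil z.
  rewrite dE => zd [Yy ymin].
  have [e zyE] := lagrange ltr01 Yy (fun y' Yy' _ => ymin y' Yy').
  have zy : enorm (z - y) < eps / 2 by exact: le_lt_trans (ymin _ Yy0) zd.
  have zE : y + e *m (J y)^T = z by rewrite -zyE addrC subrK.
  have U := uniq y e Yy; rewrite zE -zyE in U.
  have U1 : `|y - y0| < eps.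
    apply: normle_enorm; rewrite (_ : y - y0 = (y - z) + (z - y0)); last by rewrite addrA subrK.
    apply: (le_lt_trans (enormD _ _)); rewrite -(enormN (y - z)) opprB; lra.
  have U2 : `|z - y| < eps by apply: normle_enorm; lra.
  have U3 : `|z - y0| < eps by apply: normle_enorm; lra.
  by have [-> _] := U U1 U2 U3.
have near_ex z : enorm (z - y0) < 2 * d -> nearest Y z (pil z).
  rewrite dE => zd; have [|y yn] := @nearest_exists z y0 Yy0.
    move=> y yz; have [|//] := H1 y; apply: normle_enorm.
    rewrite (_ : y - y0 = (y - z) + (z - y0)); last by rewrite addrA subrK.
    apply: (le_lt_trans (enormD _ _)); lra.
  by rewrite -(near_pil z y)// dE.
have projE z : enorm (z - y0) < 2 * d -> proj Y z = pil z.
  move=> zd; apply: xget_unique; first exact: near_ex.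
  by move=> y; exact: near_pil.
have sub z : enorm (z - y0) < 2 * d -> `|z - y0| < eps.
  by move=> zd; apply: normle_enorm; lra.
exists d; split=> //.
- apply: (@Ck_ext _ _ _ _ _ pil); [exact: open_enormlt|by move=> z /projE|].
  by apply: Ck_subset pk => z /sub.
- move=> z zd; have [Oz Ypz zE] := H1 z (sub z zd); split=> //.
    by rewrite projE//; exact: near_ex.
  by rewrite projE//; exists (cl z); rewrite {1}zE addrAC subrr add0r.
- move=> y e Yy yd ed; have zd : enorm (y + e *m (J y)^T - y0) < 2 * d.
    rewrite addrAC; apply: (le_lt_trans (enormD _ _)); lra.
  have U1 : `|y - y0| < eps by apply: normle_enorm; lra.
  have U2 : `|e *m (J y)^T| < eps by apply: normle_enorm; lra.
  by rewrite projE//; case: (uniq y e Yy U1 U2 (sub _ zd)).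
Qed.

Lemma good_shrink y0 d d' : good y0 d -> 0 < d' -> d' <= d -> good y0 d'.
Proof.
move=> [Yy0 d0 pk H1 H2] d'0 d'd; split=> //.
- by apply: Ck_subset pk => z /= zd; lra.
- by move=> z zd; apply: H1; lra.
- by move=> y e Yy yd ed; apply: H2 => //; lra.
Qed.

Lemma good_center y0 d : good y0 d -> proj Y y0 = y0.
Proof.
move=> [Yy0 d0 _ _ H]; have := H y0 0 Yy0.
by rewrite mul0mx addr0 subrr enorm0; exact.
Qed.

Lemma normalP y v : Y y ->
  (forall u, u \in tangent_space Y y -> edot v u = 0) <-> exists e, v = e *m (J y)^T.
Proof.
move=> Yy; split=> [H|[e ->] u].
  apply: orth_ker => u uJ; apply: H.
  by rewrite (tangent_spaceP _ Yy) -[J y]trmxK uJ.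
rewrite (tangent_spaceP _ Yy) => /eqP uJ.
by rewrite edot_mulmx trmxK uJ edot0r.
Qed.

Variable M : set 'rV[R]_N.
Hypotheses (oM : open M) (YM : Y `<=` M).

Let goodM y0 d := good y0 d /\ forall z, enorm (z - y0) < 2 * d -> M z.

Lemma goodM_exists y0 : Y y0 -> exists d, goodM y0 d.
Proof.
move=> Yy0; have [d gd] := good_exists Yy0.
have [d1 d1_gt0 H1] := open_ball oM (YM Yy0).
have d0 : 0 < d by case: gd.
exists (Num.min d (d1 / 2)); split.
  apply: (good_shrink gd); first by rewrite lt_min d0 divr_gt0.
  by rewrite ge_min lexx.
move=> z zd; apply: H1; apply: normle_enorm; apply: (lt_le_trans zd).
by rewrite -ler_pdivlMl// ge_min mulrC lexx orbT.
Qed.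

Definition tube_base : set 'rV[R]_N :=
  [set z | exists y0 d, goodM y0 d /\ enorm (z - y0) < 2 * d].

Definition tube_normal : set ('rV[R]_N * 'rV[R]_N) :=
  [set w | exists y0 d, [/\ goodM y0 d, enorm (w.1 - y0) < d & enorm w.2 < d]].

(** The second condition keeps the normal vector short compared with a good ball containing its
    foot; the tube is then exactly the image of the part of the normal bundle inside
    [tube_normal]. *)
Definition tube : set 'rV[R]_N :=
  [set z | tube_base z /\ tube_normal (proj Y z, z - proj Y z)].

Lemma Ck_proj_base : Ck k.+1 tube_base (proj Y).
Proof.
apply: Ck_local => z [y0 [d [[[_ _ pk _ _] _] zd]]].
by exists [set z | enorm (z - y0) < 2 * d].
Qed.

Lemma open_tube_base : open tube_base.
Proof.
rewrite openE => z [y0 [d [gd zd]]].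
by apply: filterS (nbhs_enormlt zd) => x xd; exists y0, d.
Qed.

Lemma nbhs_tube_base z : tube_base z -> nbhs z tube_base.
Proof. by move=> zb; apply: open_nbhs_nbhs; split=> //; exact: open_tube_base. Qed.

Lemma open_tube_normal : open tube_normal.
Proof.
rewrite openE => -[y v] [y0 [d [gd yd vd]]].
have : nbhs (y, v) ([set y | enorm (y - y0) < d] `*` [set v : 'rV[R]_N | enorm (v - 0) < d]).
  exists ([set y | enorm (y - y0) < d], [set v | enorm (v - 0) < d]) => //=.
  by split; apply: nbhs_enormlt; rewrite ?subr0.
by apply: filterS => -[y' v'] /= [yd' vd']; exists y0, d; rewrite subr0 in vd'.
Qed.

Lemma open_tube : open tube.
Proof.
rewrite openE => z [zb zn].
have dp := Ck_proj_base.1 z zb.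
have H : nbhs z ((fun z => (proj Y z, z - proj Y z)) @^-1` tube_normal).
  have cc : {for z, continuous (fun z => (proj Y z, z - proj Y z))}.
    apply: differentiable_continuous; apply: differentiable_pair; first exact: dp.
    by apply: differentiableB; [apply: ex_diff|exact: dp].
  have Bn : nbhs (proj Y z, z - proj Y z) tube_normal.
    by apply: open_nbhs_nbhs; split=> //; exact: open_tube_normal.
  exact: (cc _ Bn).
by move: (nbhs_tube_base zb) H; apply: filterS2.
Qed.

Lemma tube_baseP z : tube_base z ->
  [/\ O z, nearest Y z (proj Y z) & exists e, z - proj Y z = e *m (J (proj Y z))^T].
Proof. by move=> [y0 [d [[[_ _ _ + _] _] zd]]]; exact. Qed.

Lemma tube_normal_proj y v : normal_bundle Y (y, v) -> tube_normal (y, v) ->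
  tube_base (y + v) /\ proj Y (y + v) = y.
Proof.
move=> [/= Yy vn] [y0 [d [gd /= yd vd]]].
have [e vE] := (normalP v Yy).1 vn; split.
  by exists y0, d; split=> //; rewrite addrAC; apply: (le_lt_trans (enormD _ _)); lra.
by rewrite vE; case: gd => -[_ _ _ _ H] _; apply: H => //; rewrite -vE.
Qed.

Lemma tube_sub : Y `<=` tube.
Proof.
move=> y Yy; have [d gd] := goodM_exists Yy; have d0 : 0 < d by case: gd.1.
have py := good_center gd.1.
split; exists y, d; first by split=> //; rewrite subrr enorm0 mulr_gt0.
by rewrite py; split=> //=; rewrite subrr enorm0.
Qed.

Lemma tube_tubular : tubular_nbhd k.+1 M Y tube (proj Y).
Proof.
have Tb : tube `<=` tube_base by move=> z [].
have pk := Ck_subset Tb Ck_proj_base.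
split; [exact: open_tube|exact: tube_sub| |exact: pk|].
  by move=> z [[y0 [d [[_ H] zd]]] _]; exact: H.
exists (fun z => z - proj Y z), (fun w => w.1 + w.2), tube_normal; split.
- exact: open_tube_normal.
- exact: (CkB open_tube (Ck_id _ _) pk).
- apply: CkD; first exact: open_tube_normal.
    apply: (@Ck_linear _ _ _ _ _ fst) => z; exact: cvg_fst.
  apply: (@Ck_linear _ _ _ _ _ snd) => z; exact: cvg_snd.
- move=> y Yy; split; last by rewrite /= addr0.
  by have [_] := tube_sub Yy; have [d [gd _]] := goodM_exists Yy; rewrite (good_center gd) subrr.
split=> [z [zb zn]|[y v] wn wZ].
  have [Oz [Yp _] eE] := tube_baseP zb; split=> //=; last by rewrite addrC subrK.
  by split=> //=; exact/(normalP _ Yp).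
have [yb py] := tube_normal_proj wn wZ.
by split; [split=> //|]; rewrite /= py addrAC subrr add0r.
Qed.

Definition sqdist (z : 'rV[R]_N) : R^o := edot (z - proj Y z) (z - proj Y z).

(** The derivative of the projection is tangent and z - proj Y z is normal, so their product drops
    out. What remains involves [proj Y] but not its derivative, whence the extra class of
    differentiability in [tube_control]. *)
Lemma derive_sqdist z v : tube_base z -> differentiable sqdist z /\
  'D_v sqdist z = 2 * edot (z - proj Y z) v.
Proof.
move=> zb; have dp := Ck_proj_base.1 z zb.
have df : differentiable (fun z => z - proj Y z) z.
  by apply: differentiableB => //; apply: ex_diff.
have [ds Ds] := derive_edot v df df; split=> //; rewrite Ds.
have -> : 'D_v (fun z => z - proj Y z) z = v - 'D_v (proj Y) z.
  have dp' := @diff_derivable _ _ _ _ _ v dp.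
  have did : derivable (id : 'rV[R]_N -> 'rV[R]_N) z v by apply: ex_derive.
  have := deriveB did dp'; by rewrite derive_id => <-.
have Yp : \forall x \near z, Y (proj Y x).
  by apply: filterS (nbhs_tube_base zb) => x /tube_baseP[_ []].
have D0 := proj_derive_ker v dp Yp.
have [_ _ [e eE]] := tube_baseP zb.
have E0 : edot (z - proj Y z) ('D_v (proj Y) z) = 0.
  by rewrite {1}eE edot_mulmx trmxK D0 edot0r.
by rewrite (edotC (v - _)) edotBr E0; ring.
Qed.

Lemma grad_sqdist z : tube_base z -> grad sqdist z = 2 *: (z - proj Y z).
Proof.
move=> zb; apply/rowP => j; rewrite !mxE (derive_sqdist _ zb).2.
congr (_ * _); rewrite /edot (bigD1 j)//= big1 => [|i ij].
  by rewrite !mxE !eqxx mulr1 addr0.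
by rewrite !mxE /= (negbTE ij) mulr0.
Qed.

(** The projection is constant along the normal line through z; the vector w + t w stays short
    enough for small t because the bound on w is strict. *)
Lemma proj_derive_normal z : tube z -> 'd (proj Y) z (z - proj Y z) = 0.
Proof.
move=> [zb [y0 [d [gd /= yd vd]]]]; have dp := Ck_proj_base.1 z zb.
have [_ [Yp _] [e eE]] := tube_baseP zb.
have zw : proj Y z + (z - proj Y z) = z by rewrite addrC subrK.
set w := z - proj Y z in zw vd eE *.
have [l [lE dl0 l0 l1]] := line_diff z w.
have dp0 : differentiable (proj Y) (l 0) by rewrite l0.
have dc := differentiable_comp dl0 dp0.
have <- : 'D_(1 : R^o) (proj Y \o l) (0 : R^o) = 'd (proj Y) z w.
  by rewrite (deriveE _ dc) (diff_comp dl0 dp0) /= l1 l0.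
apply: (@derive_near_cst _ _ _ _ _ _ (proj Y z) dc).
have [m [mE dm m0 _]] := line_diff w w.
have B : nbhs (m 0) [set u | enorm (u - 0) < d] by rewrite m0; apply: nbhs_enormlt; rewrite subr0.
have : nbhs (0 : R^o) (m @^-1` [set u | enorm (u - 0) < d]) := differentiable_continuous dm B.
apply: filterS => t /=; rewrite subr0 mE => td.
have -> : proj Y (l t) = proj Y (proj Y z + (w + t *: w)) by rewrite lE addrA zw.
have wE : w + t *: w = (e + t *: e) *m (J (proj Y z))^T.
  by rewrite mulmxDl -scalemxAl -eE.
by case: gd => -[_ _ _ _ H] _; rewrite wE; apply: H => //; rewrite -wE.
Qed.

Lemma tube_control : control_function k.+2 Y tube (proj Y) sqdist.
Proof.
have Tb : tube `<=` tube_base by move=> z [].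
have pk := Ck_subset Tb Ck_proj_base.
split.
- split=> [z /Tb zb|v]; first by case: (derive_sqdist 0 zb).
  apply: (@Ck_ext _ _ _ _ _ (fun z => 2 * edot (z - proj Y z) v : R^o)); first exact: open_tube.
    by move=> z /Tb zb; rewrite (derive_sqdist v zb).2.
  apply: CkM; [exact: open_tube|exact: Ck_cst|].
  apply: (Ck_edot open_tube); last exact: Ck_cst.
  exact: (CkB open_tube (Ck_id _ _) pk).
- by move=> z _; rewrite /sqdist -sqr_enorm sqr_ge0.
- apply/seteqP; split=> [z [/Tb zb /edot_eq0/eqP]|y Yy].
    by rewrite subr_eq0 => /eqP ->; case: (tube_baseP zb) => _ [].
  split; first exact: tube_sub.
  have [d [gd _]] := goodM_exists Yy.
  by rewrite /= /sqdist (good_center gd) subrr edot0l.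
- by move=> z zT; rewrite grad_sqdist ?linearZ /= ?proj_derive_normal ?scaler0//; exact: Tb.
Qed.

(** For open X the plane is the orthogonal complement of n = x - proj Y x, which is normal to Y at
    the foot of x. Hence v is off the plane by at most its normal component at that foot, which
    tends to its normal component at y0, namely 0. *)
Lemma tube_c_regular X dX y0 : open X -> Y y0 ->
  c_regular_at dX X Y tube sqdist y0.
Proof.
move=> oX Yy0 x tau xXT xy0 cvgP; have Oy0 := Yy0.1.
apply/subvP => v; rewrite (tangent_spaceP _ Yy0) => /eqP vJ.
apply: (grassmann_limit cvgP) => e e0.
(* The orthogonal projection of v to the normal space at y. *)
pose q y := v *m J y *m invmx ((J y)^T *m J y) *m (J y)^T.
have q0 : q y0 = 0 by rewrite /q vJ !mul0mx.
have qk : Ck 0 O q.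
  have J0 : Ck 0 O J by exact: (Ck_le (leq0n _) Jk).
  have JT := Ck_trmx oO J0.
  have Jinv := Ck_invmx oO (JtJ_unit) (Ck_mulmx oO JT J0).
  exact: (Ck_mulmx oO (Ck_mulmx oO (Ck_mulmx oO (Ck_cst 0 O v) J0) Jinv) JT).
have y0T := tube_sub Yy0.
have pc : {for y0, continuous (proj Y)}.
  exact: (Ck_cts (Ck_proj_base) y0T.1).
have [d [gd _]] := goodM_exists Yy0.
have py0 := good_center gd.
have near_q : \forall i \near \oo, enorm (q (proj Y (x i)) - 0) < e.
  have B : nbhs (q (proj Y y0)) [set u | enorm (u - 0) < e].
    by apply: nbhs_enormlt; rewrite py0 q0 subrr enorm0.
  have qc : {for proj Y y0, continuous q} by rewrite py0; exact: qk.
  have B1 : nbhs (proj Y y0) (q @^-1` [set u | enorm (u - 0) < e]) := qc _ B.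
  have B2 : nbhs y0 (proj Y @^-1` (q @^-1` [set u | enorm (u - 0) < e])) := pc _ B1.
  have xB S : nbhs y0 S -> \forall i \near \oo, S (x i) by move=> yS; exact: (xy0 _ yS).
  by move: (xB _ B2); apply: filterS.
apply: filterS near_q => i; rewrite subr0 => qe.
have [Xx xT] := xXT i; have [Ox [Yp _] [a aE]] := tube_baseP xT.1.
set n := x i - proj Y (x i) in aE *.
have nv : edot n v = edot n (q (proj Y (x i))).
  rewrite aE !edot_mulmx trmxK /q -[X in _ = edot a X]mulmxA mulmxKV//.
  exact: (JtJ_unit Yp.1).
(* The projection of v to the plane; for n = 0 the quotient is multiplied by 0 and v itself is
   taken. *)
exists (v - (edot n v / edot n n) *: n).
  rewrite memv_cap open_tangent_space// memvf andbT memv_ker lfunE /=.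
  have [ds _] := derive_sqdist 0 xT.1.
  rewrite -(deriveE _ ds) (derive_sqdist _ xT.1).2 -/n.
  rewrite edotBr edotZr; have [->|n0] := eqVneq n 0; first by rewrite !edot0l !mulr0 subrr mulr0.
  by rewrite divfK ?subrr ?mulr0//; apply: contra n0 => /eqP/edot_eq0 ->.
rewrite opprB addrC subrK enormZ.
have [->|n0] := eqVneq n 0; first by rewrite enorm0 mulr0 ltW.
have en : 0 < enorm n by rewrite enorm_gt0.
rewrite normrM normfV -sqr_enorm (ger0_norm (sqr_ge0 _)) -mulrA.
have -> : (enorm n ^+ 2)^-1 * enorm n = (enorm n)^-1 by field; rewrite gt_eqF.
rewrite ler_pdivrMr// nv mulrC; apply: (le_trans (edot_le _ _)).
by rewrite ler_wpM2l ?(ltW en) ?(ltW qe).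
Qed.

End Tube.

(** * The strata of the deformation *)

Section Deformation.
Variables (R : realType) (n p k : nat).
Variables (f g : 'rV[R]_n -> 'rV[R]_p) (U0 : set 'rV[R]_n).
Hypotheses (oU0 : open U0) (U00 : U0 0) (fk : Ck k.+2 U0 f) (gk : Ck k.+2 U0 g).

Let P x := g x - f x.
Let D : 'rV[R]_(n + 1) -> 'rV[R]_p := deformation f g.
Let grad_at z := gradmx (fun y => f y + tpart z *: P y) (xpart z).
Let O1 := [set z : 'rV[R]_(n + 1) | U0 (xpart z)].

Lemma deformationE : D = fun z => f (xpart z) + (rsubmx z : 'M[R]_1) *m P (xpart z).
Proof.
apply/funext => z; rewrite /D /deformation; congr (_ + _).
by rewrite [rsubmx z]mx11_scalar mul_scalar_mx.
Qed.

Lemma Ck_xpart l (O : set 'rV[R]_(n + 1)) : open O -> Ck l O (@xpart R n).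
Proof. by move=> oO; apply: (Ck_lsubmx (f := id)) => //; exact: Ck_id. Qed.

Lemma Ck_tpartmx l (O : set 'rV[R]_(n + 1)) : open O ->
  Ck l O (rsubmx : 'rV[R]_(n + 1) -> 'rV[R]_1).
Proof. by move=> oO; apply: (Ck_rsubmx (f := id)) => //; exact: Ck_id. Qed.

Lemma open_xpart (O : set 'rV[R]_n) : open O -> open [set z : 'rV[R]_(n + 1) | O (xpart z)].
Proof. by apply: open_comp => // w _; exact: continuous_lsubmx. Qed.

Lemma open_tpart (O : set R) : open O -> open [set z : 'rV[R]_(n + 1) | O (tpart z)].
Proof.
apply: open_comp => z _; have := Ck_coord 0 0 openT (Ck_tpartmx 0 openT).
exact.
Qed.

Lemma Ck_deformation : Ck k.+2 O1 D.
Proof.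
have oO1 := open_xpart oU0.
have comp (h : 'rV[R]_n -> 'rV[R]_p) : Ck k.+2 U0 h -> Ck k.+2 O1 (fun z => h (xpart z)).
  move=> hk; apply: (@Ck_comp _ _ _ _ _ _ O1 U0) => //; first exact: Ck_xpart.
  by move=> i j; exact: Ck_coord.
rewrite deformationE.
exact: (CkD oO1 (comp f fk) (Ck_mulmx oO1 (Ck_tpartmx k.+2 oO1) (comp P (CkB oU0 gk fk)))).
Qed.

Lemma derive_deformation z w (s : 'rV[R]_1) : O1 z ->
  'D_(row_mx w s) D z = w *m (grad_at z)^T + s *m P (xpart z).
Proof.
move=> O1z; have oO1 := open_xpart oU0.
have dx : differentiable (@xpart R n) z by exact: (Ck_xpart 1 oO1).1.
have dt : differentiable (rsubmx : 'rV[R]_(n + 1) -> 'rV[R]_1) z by exact: (Ck_tpartmx 1 oO1).1.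
have Dx : 'd (@xpart R n) z (row_mx w s) = w.
  by rewrite (@diff_lin _ _ _ lsubmx) /= ?row_mxKl// => u; exact: continuous_lsubmx.
have Dt : 'D_(row_mx w s) (rsubmx : 'rV[R]_(n + 1) -> 'rV[R]_1) z = s.
  rewrite (deriveE _ dt) (@diff_lin _ _ _ rsubmx) /= ?row_mxKr// => u; exact: continuous_rsubmx.
have df : differentiable f (xpart z) by exact: fk.1.
have dP : differentiable P (xpart z) by exact: (CkB oU0 gk fk).1.
have dfx := differentiable_comp dx df.
have dPx := differentiable_comp dx dP.
have [dm Dm] := derive_mulmx (row_mx w s) dt dPx.
have dfx' := @diff_derivable _ _ _ _ _ (row_mx w s) dfx.
have E1 : 'D_(row_mx w s) D z = 'D_w f (xpart z) + (s *m P (xpart z) + rsubmx z *m 'D_w P (xpart z)).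
  rewrite deformationE; apply: (etrans (deriveD dfx' dm)); rewrite Dm Dt.
  rewrite (deriveE _ dfx) (diff_comp dx df) /= Dx -(deriveE _ df).
  by rewrite (deriveE _ dPx) (diff_comp dx dP) /= Dx -(deriveE _ dP).
rewrite E1 addrCA addrC; congr (_ + _).
pose q y := f y + tpart z *: P y.
have dq : differentiable q (xpart z).
  by apply: differentiableD => //; apply: differentiableZ.
have gq : grad_at z = (jacobian q (xpart z))^T := gradmx_jacobian dq.
rewrite gq trmxK -(deriveEjacobian w dq).
have df' := @diff_derivable _ _ _ _ _ w df.
have dP' := @diff_derivable _ _ _ _ _ w dP.
have dZ : derivable (fun y => tpart z *: P y) (xpart z) w by exact: derivableZ.
have EZ : 'D_w (fun y => tpart z *: P y) (xpart z) = tpart z *: 'D_w P (xpart z).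
  exact: deriveZ.
have H := deriveD df' dZ; rewrite EZ in H; apply: etrans (esym H).
by rewrite [rsubmx z]mx11_scalar mul_scalar_mx.
Qed.

Lemma mulmx_ext m l (A B : 'M[R]_(m, l)) : (forall v : 'rV_m, v *m A = v *m B) -> A = B.
Proof. by move=> AB; apply/row_matrixP => i; rewrite !rowE. Qed.

Lemma jacobian_deformation z : O1 z -> jacobian D z = col_mx (grad_at z)^T (P (xpart z)).
Proof.
move=> O1z; apply: mulmx_ext => v; rewrite -(hsubmxK v) mul_row_col.
have dD : differentiable D z by exact: Ck_deformation.1.
by rewrite -(deriveEjacobian _ dD); exact: derive_deformation.
Qed.

(** The pull-back of a covector splits into e d_xF and the time component <e, P x>; the local
    estimate compares these two. *)
Lemma mul_jacobianT z e : O1 z ->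
  e *m (jacobian D z)^T = row_mx (e *m grad_at z) (edot e (P (xpart z)))%:M.
Proof.
move=> O1z; rewrite jacobian_deformation// tr_col_mx trmxK mul_mx_row; congr row_mx.
by rewrite [LHS]mx11_scalar edotE.
Qed.

End Deformation.

Lemma edot_row_mx (R : realType) m l (a c : 'rV[R]_m) (b d : 'rV[R]_l) :
  edot (row_mx a b) (row_mx c d) = edot a c + edot b d.
Proof.
rewrite /edot big_split_ord /=; congr (_ + _); apply: eq_bigr => i _.
  by rewrite !row_mxEl.
by rewrite !row_mxEr.
Qed.

Lemma closure_meets (T : topologicalType) (X W : set T) y : open W -> W y ->
  X `&` W = set0 -> closure X y -> False.
Proof.
move=> oW Wy XW0 cy; have [z] : X `&` W !=set0 by apply: cy; apply: open_nbhs_nbhs.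
by rewrite XW0.
Qed.

(** * Open strata as their own tubes *)

Section OpenStratum.
Variables (R : realType) (N k : nat) (M X : set 'rV[R]_N).
Hypotheses (oX : open X) (XM : X `<=` M).

Lemma open_submanifold : submanifold k N X.
Proof.
exists 0%N; first by rewrite addn0.
move=> x Xx; exists X, (fun=> 0); split=> //.
- exact: Ck_cst.
- by move=> z _; apply/eqP; rewrite -leqn0 rank_leq_col.
- by apply/seteqP; split=> z [].
Qed.

(** The tangent space is everything, so the normal bundle is zero and the identity is the
    projection. *)
Lemma open_tubular : tubular_nbhd k M X X id.
Proof.
split=> //; first exact: Ck_id.
exists (fun=> 0), fst, setT; split=> //.
- exact: openT.
- exact: Ck_cst.
- by apply: (@Ck_linear _ _ _ _ _ fst) => z; exact: cvg_fst.
split=> [z Xz|[y v] [/= Xy vn] _].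
  by split=> //; split=> //= v _; rewrite edot0l.
split=> //; congr pair; apply/esym/edot_eq0; apply: vn.
by rewrite open_tangent_space// memvf.
Qed.

Lemma open_control : control_function k X X id (fun=> 0 : R^o).
Proof.
split=> //; first exact: Ck_cst.
  by apply/seteqP; split=> z // [].
move=> z _; have -> : grad (fun=> 0 : R^o) z = 0.
  by apply/rowP => j; rewrite !mxE derive_cst.
by rewrite linear0.
Qed.

End OpenStratum.

Section Strata.
Variables (R : realType) (n p k : nat).
Variables (f g : 'rV[R]_n -> 'rV[R]_p) (U0 : set 'rV[R]_n) (Jt : set R).
Hypotheses (oU0 : open U0) (U00 : U0 0) (fk : Ck k.+2 U0 f) (gk : Ck k.+2 U0 g).
Hypotheses (f0 : f 0 = 0) (g0 : g 0 = 0) (oJ : open Jt) (le_pn : (p <= n)%N).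
Hypothesis est : forall t0 eps : R, 0 < eps -> exists2 d : R, 0 < d &
  forall (x : 'rV[R]_n) (t : R), x != 0 -> `|x| < d -> `|t - t0| < d ->
  f x + t *: (g x - f x) = 0 ->
  forall (a : 'rV[R]_p) (b : R),
    let B := gradmx (fun y => f y + t *: (g y - f y)) x in
    `|edot a (g x - f x)| <= eps * enorm (a *m B + b *: x) /\ (a *m B = 0 -> a = 0).

Let D : 'rV[R]_(n + 1) -> 'rV[R]_p := deformation f g.
Let grad_at (z : 'rV[R]_(n + 1)) := gradmx (fun y => f y + tpart z *: (g y - f y)) (xpart z).
Let A := axis (n := n) Jt.

Definition regular_at (z : 'rV[R]_(n + 1)) : Prop :=
  deformation f g z = 0 -> xpart z != 0 -> forall a : 'rV[R]_p,
    a *m gradmx (fun y => f y + tpart z *: (g y - f y)) (xpart z) = 0 -> a = 0.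

(** Taking the interior of the regular points makes the neighbourhood open, and the local estimate
    puts the axis inside it. *)
Definition dom : set 'rV[R]_(n + 1) :=
  [set z | [/\ Jt (tpart z), U0 (xpart z) & interior regular_at z]].

Let M := dom.

Lemma norm_xpart (z : 'rV[R]_(n + 1)) : `|xpart z| <= `|z|.
Proof. by apply: norm_le_coord => // i j; rewrite mxE coord_le_norm. Qed.

Lemma norm_tpart (z : 'rV[R]_(n + 1)) : `|tpart z| <= `|z|.
Proof. by rewrite /tpart mxE coord_le_norm. Qed.

Lemma xpartB (y z : 'rV[R]_(n + 1)) : xpart (y - z) = xpart y - xpart z.
Proof. by rewrite /xpart linearB. Qed.

Lemma tpartB (y z : 'rV[R]_(n + 1)) : tpart (y - z) = tpart y - tpart z.
Proof. by rewrite /tpart linearB !mxE. Qed.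

Lemma near_axis (y : 'rV[R]_(n + 1)) (d : R) : xpart y = 0 -> 0 < d ->
  \forall z \near y, `|xpart z| < d /\ `|tpart z - tpart y| < d.
Proof.
move=> y0 d0.
apply: filterS (nbhs_normlt y d0) => z zd; split; last by rewrite -tpartB; exact: le_lt_trans (norm_tpart _) zd.
by rewrite -[xpart z]subr0 -y0 -xpartB; exact: le_lt_trans (norm_xpart _) zd.
Qed.

Lemma dom_nbhd : nbhd_of_axis Jt M.
Proof.
split; last by move=> z [].
  rewrite (_ : M = [set z | Jt (tpart z)] `&` [set z | U0 (xpart z)] `&` interior regular_at).
    apply: openI; last exact: open_interior.
    by apply: openI; [exact: open_tpart|exact: open_xpart].
  by apply/seteqP; split=> z; [case=> ? ? ?; split|case=> -[]].
move=> z [z0 Jz]; split=> //; first by rewrite z0.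
have [d d0 H] := est (tpart z) ltr01.
move: (near_axis z0 d0); rewrite /interior /=; apply: filterS => y [xd td] Dy y0 a.
by have [] := H (xpart y) (tpart y) y0 xd td Dy a 0.
Qed.

Lemma open_dom : open M. Proof. by case: dom_nbhd. Qed.

Lemma axis_sub : A `<=` M. Proof. by case: dom_nbhd. Qed.

Lemma axisP z : M z -> A z <-> xpart z = 0.
Proof. by case=> Jz _ _; split=> [[]|]. Qed.

Lemma axis_zero z : A z -> D z = 0.
Proof. by case=> z0 _; rewrite /D /deformation z0 f0 g0 subrr scaler0 addr0. Qed.

Lemma Ck_dom : Ck k.+2 M D.
Proof. by apply: Ck_subset (Ck_deformation oU0 fk gk) => z []. Qed.

Let AO := [set z : 'rV[R]_(n + 1) | Jt (tpart z)].
(* The axis is the zero set of the submersion [xpart], with derivative AJ; its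
   tube is an instance of the general one. *)
Let AJ (z : 'rV[R]_(n + 1)) : 'M[R]_(n + 1, n) := col_mx 1%:M 0.

Lemma axisE : A = [set z | AO z /\ xpart z = 0].
Proof. by apply/seteqP; split=> z []. Qed.

Lemma mul_AJ z v : v *m AJ z = xpart v.
Proof. by rewrite -{1}(hsubmxK v) mul_row_col mulmx1 mulmx0 addr0. Qed.

Lemma mul_AJT z (e : 'rV[R]_n) : e *m (AJ z)^T = row_mx e (0 : 'rV[R]_1).
Proof. by rewrite tr_col_mx trmx1 trmx0 mul_mx_row mulmx1 mulmx0. Qed.

Lemma AO_open : open AO. Proof. exact: open_tpart. Qed.

Lemma AJE y v : AO y -> 'D_v (@xpart R n) y = v *m AJ y.
Proof.
move=> AOy; have dx := (Ck_xpart (n := n) 1 AO_open).1 y AOy.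
by rewrite (deriveE _ dx) (@diff_lin _ _ _ lsubmx) ?mul_AJ// => u; exact: continuous_lsubmx.
Qed.

Lemma AJfree y (e : 'rV[R]_n) : AO y -> e *m (AJ y)^T = 0 -> e = 0.
Proof. by move=> _; rewrite mul_AJT -row_mx0 => /eq_row_mx[]. Qed.

Lemma axis_subM : [set z | AO z /\ xpart z = 0] `<=` M.
Proof. by rewrite -axisE; exact: axis_sub. Qed.

Let AT := tube k AO (@xpart R n) AJ M.
Let Arho := sqdist AO (@xpart R n).

Lemma axis_tubular : tubular_nbhd k.+1 M A AT (proj A).
Proof.
rewrite axisE; exact: (tube_tubular AO_open (Ck_xpart k.+2 AO_open) (Ck_cst _ _ _) AJE AJfree
  open_dom axis_subM).
Qed.

Lemma axis_control : control_function k.+2 A AT (proj A) Arho.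
Proof.
rewrite axisE; exact: (tube_control AO_open (Ck_xpart k.+2 AO_open) (Ck_cst _ _ _) AJE AJfree
  open_dom axis_subM).
Qed.

Lemma axis_regular_open X dX y0 : open X -> A y0 -> c_regular_at dX X A AT Arho y0.
Proof.
rewrite axisE => oX Ay0.
exact: (tube_c_regular AO_open (Ck_xpart k.+2 AO_open) (Ck_cst _ _ _) AJE AJfree
  open_dom axis_subM).
Qed.

Lemma derive_axis_rho z v : AT z -> 'd Arho z v = 2 * edot (row_mx (xpart z) 0) v.
Proof.
move=> [zb _]; have [dr Dr] := derive_sqdist (Ck_xpart k.+2 AO_open) AJE v zb.
rewrite -(deriveE _ dr) Dr; have [_ [[_ pz] _] [e]] := tube_baseP zb.
rewrite mul_AJT => ze; rewrite ze; congr (2 * edot (row_mx _ _) _).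
by have := congr1 (@xpart R n) ze; rewrite xpartB pz subr0 [in RHS]/xpart row_mxKl.
Qed.

Lemma axis_submanifold : submanifold k.+2 1 A.
Proof.
exists n; first exact: addnC.
move=> y Ay; exists AO, (@xpart R n); split.
- by split; [exact: AO_open|case: Ay].
- exact: (Ck_xpart _ AO_open).
- move=> z AOz; have dx := (Ck_xpart (n := n) 1 AO_open).1 z AOz.
  apply/eqP; rewrite -/(row_full _) -sub1mx; apply/row_subP => i; apply/submxP; exists (row_mx (row i 1%:M) 0).
  by rewrite -(deriveEjacobian _ dx) AJE// mul_AJ /xpart row_mxKl.
- by rewrite axisE; apply/seteqP; split=> z [] // [].
Qed.

(** An open set containing the part of F = 0 off the axis, on which F is a submersion. Expressing
    the rank condition by the Gram determinant makes it an open one. *)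
Let O := [set z | [/\ M z, xpart z != 0 & (jacobian D z)^T *m jacobian D z \in unitmx]].
Let X1 := M `\` [set z | D z = 0].
Let X2 := (M `&` [set z | D z = 0]) `\` A.

Lemma open_X1 : open X1.
Proof.
rewrite openE => z [Mz /= Dz].
have Dc := Ck_cts Ck_dom Mz.
have B : nbhs (D z) [set u | u <> 0].
  have : nbhs (D z) [set u | 0 < `|u|].
    apply: (@norm_continuous _ _ (D z) [set t | 0 < t]).
    by apply: open_nbhs_nbhs; split; [exact: open_gt|rewrite /= normr_gt0; exact/eqP].
  by apply: filterS => u /= u0 uE; rewrite uE normr0 ltxx in u0.
have B1 : nbhs z (D @^-1` [set u | u <> 0]) := Dc _ B.
have : nbhs z M by apply: open_nbhs_nbhs; split=> //; exact: open_dom.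
by move: B1; apply: filterS2 => y.
Qed.

Lemma open_offaxis : open [set z : 'rV[R]_(n + 1) | xpart z != 0].
Proof.
have oN : open ((fun x : 'rV[R]_n => `|x|) @^-1` [set t : R | 0 < t]).
  by apply: open_comp => [x _|]; [exact: norm_continuous|exact: open_gt].
rewrite (_ : mkset _ = [set z | ((fun x : 'rV[R]_n => `|x|) @^-1` [set t : R | 0 < t]) (xpart z)]).
  exact: open_xpart oN.
by apply/seteqP; split=> z /=; rewrite normr_gt0.
Qed.

Lemma open_M_off : open (M `\` A).
Proof.
rewrite (_ : M `\` A = M `&` [set z | xpart z != 0]).
  by apply: openI; [exact: open_dom|exact: open_offaxis].
apply/seteqP; split=> z [Mz].
  by move=> nA; split=> //; apply/eqP => /(axisP Mz).
by move=> /= /eqP z0; split=> // /(axisP Mz).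
Qed.

Lemma open_O : open O.
Proof.
rewrite openE => z [Mz z0 Ju].
have oM := open_dom.
have D1 : Ck 1 M D by exact: Ck_le Ck_dom.
have Jk := Ck_jacobian oM D1.
have detk := Ck_det oM (Ck_mulmx oM (Ck_trmx oM Jk) Jk).
have B : nbhs (\det ((jacobian D z)^T *m jacobian D z) : R^o) [set u : R^o | 0 < `|u|].
  apply: (@norm_continuous _ R^o _ [set t | 0 < t]).
  apply: open_nbhs_nbhs; split; first exact: open_gt.
  by rewrite /= normr_gt0 -unitfE -unitmxE.
have B1 : nbhs z ((fun z => \det ((jacobian D z)^T *m jacobian D z) : R^o) @^-1` [set u | 0 < `|u|]).
  exact: (detk _ Mz _ B).
have B2 : nbhs z M by apply: open_nbhs_nbhs.
have B3 : nbhs z [set z | xpart z != 0] by apply: open_nbhs_nbhs; split=> //; exact: open_offaxis.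
near=> y; split; [near: y; exact: B2|near: y; exact: B3|].
have : 0 < `|\det ((jacobian D y)^T *m jacobian D y)| by near: y; exact: B1.
by rewrite normr_gt0 -unitfE -unitmxE.
Unshelve. all: by end_near.
Qed.

Lemma Jfree_O y (e : 'rV[R]_p) : O y -> e *m (jacobian D y)^T = 0 -> e = 0.
Proof.
move=> [_ _ Ju] eJ; rewrite -(mulmxK Ju e) mulmxA eJ.
by rewrite !mul0mx.
Qed.

Lemma X2E : X2 = [set z | O z /\ D z = 0].
Proof.
apply/seteqP; split=> z; last first.
  move=> [[Mz /eqP z0 _] Dz]; split=> // /(axisP Mz); exact: z0.
move=> [[Mz /= Dz] nA]; have z0 : xpart z != 0 by apply/eqP => /(axisP Mz).
split=> //; split=> //; have [_ Uz reg] := Mz.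
have Jf y (e : 'rV[R]_p) : [set z] y -> e *m (jacobian D y)^T = 0 -> e = 0.
  move=> -> ; rewrite (mul_jacobianT oU0 fk gk e Uz) -row_mx0 => /eq_row_mx[eB _].
  by apply: (nbhs_singleton reg Dz z0 e).
exact: (JtJ_unit Jf).
Qed.

Lemma Ck_O : Ck k.+2 O D. Proof. by apply: Ck_subset Ck_dom => z []. Qed.

Lemma Ck_jac_O : Ck k.+1 O (jacobian D).
Proof. exact: (Ck_jacobian open_O Ck_O). Qed.

Lemma JE_O y v : O y -> 'D_v D y = v *m jacobian D y.
Proof. by move=> Oy; apply: deriveEjacobian; exact: Ck_O.1. Qed.

Lemma X2_submanifold : submanifold k.+2 (n + 1 - p) X2.
Proof.
exists p; first by rewrite subnK// addn1 leqW.
move=> y; rewrite X2E => -[Oy Dy]; exists O, D; split.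
- by split=> //; exact: open_O.
- exact: Ck_O.
- move=> z Oz; rewrite -mxrank_tr; apply/eqP; rewrite -/(row_free _) -kermx_eq0.
  by apply/rowV0P => e /sub_kermxP; exact: Jfree_O.
- by apply/seteqP; split=> z [] // [].
Qed.

Lemma X2_subM : [set z | O z /\ D z = 0] `<=` M.
Proof. by move=> z [[]]. Qed.

Let T2 := tube k O D (jacobian D) M.
Let rho2 := sqdist O D.

Lemma X2_tubular : tubular_nbhd k.+1 M X2 T2 (proj X2).
Proof.
rewrite X2E; exact: (tube_tubular open_O Ck_O Ck_jac_O JE_O Jfree_O open_dom X2_subM).
Qed.

Lemma X2_control : control_function k.+2 X2 T2 (proj X2) rho2.
Proof.
rewrite X2E; exact: (tube_control open_O Ck_O Ck_jac_O JE_O Jfree_O open_dom X2_subM).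
Qed.

Lemma X2_regular_open X dX y0 : open X -> X2 y0 -> c_regular_at dX X X2 T2 rho2 y0.
Proof.
rewrite X2E => oX Xy0.
exact: (tube_c_regular open_O Ck_O Ck_jac_O JE_O Jfree_O open_dom X2_subM).
Qed.

(* The distance from v, parallel to the axis, to the kernel plane is the length
   of its projection m to the span of the rows of (dF)^T and of (x, 0). *)
Lemma axis_regular_X2 dX y0 : A y0 -> c_regular_at dX X2 A AT Arho y0.
Proof.
move=> Ay0 x tau xXT xy0 cvgP; have [y00 Jy0] := Ay0.
apply/subvP => v; rewrite axisE.
rewrite (tangent_spaceP AO_open (Ck_xpart k.+2 AO_open) (Ck_cst _ _ _) AJE AJfree _ (conj Jy0 y00)).
rewrite (mul_AJ y0) => /eqP v0; set s := rsubmx v.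
have vE : v = row_mx 0 s by rewrite -(hsubmxK v) -/(xpart v) v0.
apply: (grassmann_limit cvgP) => e e0.
have s1 : 0 < enorm s + 1 by rewrite ltr_wpDl// enorm_ge0.
pose eps := e / (enorm s + 1).
have eps0 : 0 < eps by rewrite divr_gt0.
have [d d0 H] := est (tpart y0) eps0.
have xB S : nbhs y0 S -> \forall i \near \oo, S (x i) by move=> yS; exact: (xy0 _ yS).
apply: filterS (xB _ (near_axis y00 d0)) => i [xd td].
have [X2x ATx] := xXT i; have := X2x; rewrite X2E => -[Ox Dx].
have [[_ Ux _] x0 _] := Ox.
set z := x i in X2x ATx Ox Dx Ux x0 xd td *.
pose K : 'M[R]_(p + 1, n + 1) := col_mx (jacobian D z)^T (row_mx (xpart z) 0).
have [u [w [vuw wK]]] := orth_decomp K v.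
move: wK; rewrite tr_col_mx trmxK mul_mx_row -row_mx0 => /eq_row_mx[wJ wx].
have wx0 : edot (row_mx (xpart z) 0) w = 0 by rewrite edotC edotE wx mxE.
exists w.
  rewrite memv_cap; apply/andP; split.
    by rewrite memv_ker lfunE /= derive_axis_rho// wx0 mulr0.
  have X2x' : [set z | O z /\ D z = 0] z by split.
  by rewrite (tangent_spaceP open_O Ck_O Ck_jac_O JE_O Jfree_O _ X2x') wJ.
set m := u *m K in vuw.
have -> : v - w = m by rewrite vuw addrK.
pose a := lsubmx u; pose b := rsubmx u 0 0; pose P := g (xpart z) - f (xpart z).
have mE : m = row_mx (a *m grad_at z + b *: xpart z) (edot a P)%:M.
  rewrite /m /K -(hsubmxK u) mul_row_col -/a (mul_jacobianT oU0 fk gk a Ux).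
  rewrite [rsubmx u]mx11_scalar -/b mul_scalar_mx scale_row_mx scaler0 add_row_mx addr0.
  by [].
have [Hm _] := H (xpart z) (tpart z) x0 xd td Dx a b.
have mm : edot m m = edot m v.
  rewrite vuw edotDr; have -> : edot m w = 0; last by rewrite addr0.
  by rewrite /m edot_mulmx tr_col_mx trmxK mul_mx_row wJ wx row_mx0 edot0r.
(* As v is parallel to the axis, only the last coordinate <a, P> of m counts, and the local estimate
   bounds it by eps |a d_xF + b x| <= eps |m|. *)
have mv : edot m v <= eps * enorm m * enorm s.
  rewrite mE vE edot_row_mx edot0r add0r; apply: (le_trans (ler_norm _)).
  apply: (le_trans (edot_le _ _)); rewrite ler_wpM2r ?enorm_ge0//.
  have -> : enorm (edot a P)%:M = `|edot a P|.
    by rewrite /enorm /edot big_ord1 mxE eqxx mulr1n -expr2 sqrtr_sqr.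
  apply: (le_trans Hm); rewrite ler_wpM2l ?(ltW eps0)// -mE.
  rewrite -(@ler_pXn2r _ 2) ?nnegrE ?enorm_ge0// !sqr_enorm mE edot_row_mx lerDl.
  by rewrite -sqr_enorm sqr_ge0.
have [m0|m0] := eqVneq m 0; first by rewrite m0 enorm0 ltW.
have em : 0 < enorm m by rewrite enorm_gt0.
have : enorm m * enorm m <= (eps * enorm s) * enorm m.
  by rewrite -expr2 sqr_enorm mm; apply: (le_trans mv); rewrite mulrAC.
rewrite ler_pM2r// => /le_trans; apply.
by rewrite /eps mulrAC ler_pdivrMr// ler_wpM2l ?(ltW e0)// lerDl.
Qed.

Lemma Sigma_stratification : stratification k.+2 M (Sigma Jt D M).
Proof.
rewrite /Sigma; case: asboolP => _; split.
- move=> X X' [->|->] [->|->] [z [zX zX']] //.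
  + by case: zX => _ /(_ zX').
  + by case: zX' => _ /(_ zX).
- apply/seteqP; split=> [z [X [->|->] zX]|z Mz]; [by case: zX|exact: axis_sub|].
  have [Az|nAz] := pselect (A z); first by exists A => //; right.
  by exists (M `\` A); [left|].
- move=> X [->|->]; first by exists (n + 1)%N; apply: open_submanifold; exact: open_M_off.
  by exists 1%N; exact: axis_submanifold.
- move=> X X' [[->|->]|->] [[->|->]|->] [z [zX zX']] //.
  + by case: zX => _ /=; case: zX' => -[].
  + by case: zX => _ /=; rewrite (axis_zero zX').
  + by case: zX' => _ /=; case: zX => -[].
  + by case: zX => _ /(_ zX').
  + by case: zX' => _ /=; rewrite (axis_zero zX).
  + by case: zX' => _ /(_ zX).
- apply/seteqP; split=> [z [X [[->|->]|->] zX]|z Mz].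
  + by case: zX.
  + by case: zX => -[].
  + exact: axis_sub.
  have [Az|nAz] := pselect (A z); first by exists A => //; right.
  have [Dz|nDz] := pselect (D z = 0); first by exists X2; [left; right|].
  by exists X1; [left; left|].
- move=> X [[->|->]|->].
  + by exists (n + 1)%N; apply: open_submanifold; exact: open_X1.
  + by exists (n + 1 - p)%N; exact: X2_submanifold.
  + by exists 1%N; exact: axis_submanifold.
Qed.

(** An open stratum lies in the closure of no other, by disjointness, and [X2] is not in the closure
    of the axis. There remain open strata over [X2] or over the axis, settled by the tubes, and [X2]
    over the axis, settled by the estimate. *)
Lemma Sigma_c_regular : c_regular_stratification k.+1 M (Sigma Jt D M).
Proof.
split; first exact: Sigma_stratification.
pose regular Y := exists T pi rho,
  [/\ tubular_nbhd k.+1 M Y T pi, control_function k.+2 Y T pi rho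
    & forall X dX, Sigma Jt D M X -> X <> Y -> Y `<=` closure X ->
        submanifold k.+2 dX X -> forall y0, Y y0 -> c_regular_at dX X Y T rho y0].
have openY Y : open Y -> Y `<=` M -> (forall X, Sigma Jt D M X -> X = Y \/ X `&` Y = set0) ->
    regular Y.
  move=> oY YM disj; exists Y, id, (fun=> 0).
  split; [exact: open_tubular|exact: open_control|].
  move=> X dX SX XY YX _ y0 Yy0; have [//|XY0] := disj X SX.
  by case: (closure_meets oY Yy0 XY0 (YX _ Yy0)).
have [trivS _ _] := Sigma_stratification.
have disj Y : Sigma Jt D M Y -> forall X, Sigma Jt D M X -> X = Y \/ X `&` Y = set0.
  move=> SY X SX; have [->|/set0P XY] := eqVneq (X `&` Y) set0; first by right.
  by left; apply: trivS.
have axisY : (forall X, Sigma Jt D M X -> [\/ open X, X = X2 | X = A]) ->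
    regular A.
  move=> SX; exists AT, (proj A), Arho; split; [exact: axis_tubular|exact: axis_control|].
  move=> X dX /SX[oX|->|->] // _ _ _ y0 Ay0; first exact: axis_regular_open.
  exact: axis_regular_X2.
move: openY disj axisY; rewrite /regular /Sigma; case: asboolP => _ openY disj axisY Y.
  case=> ->; last by apply: axisY => X [->|->]; [constructor 1; exact: open_M_off|constructor 3].
  apply: openY; [exact: open_M_off|by move=> z []|by apply: disj; left].
case=> [[->|->]|->].
- by apply: openY; [exact: open_X1|by move=> z []|by apply: disj; left; left].
- exists T2, (proj X2), rho2; split; [exact: X2_tubular|exact: X2_control|].
  move=> X dX [[->|->]|->] // _ cX _ y0 X2y0; first by apply: X2_regular_open => //; exact: open_X1.
  have : [set z | O z /\ D z = 0] y0 by rewrite -X2E.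
  move=> [[_ x0 _] _].
  case: (closure_meets open_offaxis x0 _ (cX _ X2y0)).
  by apply/seteqP; split=> z // [[z0 _] /=]; rewrite z0 eqxx.
- apply: axisY => X [[->|->]|->]; [constructor 1; exact: open_X1|by constructor 2|by constructor 3].
Qed.

End Strata.

(** * The case r = 0 *)

Section DegreeZero.
Variables (R : realType) (n p : nat).
Variables (f : 'rV[R]_n -> 'rV[R]_p) (U : set 'rV[R]_n).
Hypotheses (p_gt0 : (0 < p)%N) (n_gt0 : (0 < n)%N).
Hypotheses (oU : open U) (U0 : U 0) (fk : Ck 1 U f) (f0 : f 0 = 0).

(* The horn of 0 is a full neighbourhood of 0, on which the Kuo distance would
   be at least C |x|^-delta, although the gradients are continuous at 0. *)
Lemma kuo_degree0 : ~ exists C alpha w delta : R,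
  [/\ 0 < C, 0 < alpha, 0 < w, 0 < delta &
   forall x, horn 1 (poly_map (fun=> 0 : mpoly.mpoly n R) : 'rV[R]_n -> 'rV[R]_p) w x ->
     enorm x < alpha ->
     C * enorm x `^ (0%:R - delta) <= kuo_dist (fun i => grad (fun y => f y 0 i) x)].
Proof.
move=> [C [alpha [w [delta [C0 alpha0 w0 delta0 kuo]]]]].
pose h (i : 'I_p) : mpoly.mpoly n R := 0.
have h0 x : poly_map h x = 0 by apply/rowP => i; rewrite !mxE mpoly.meval0.
have jac0 x : pjac h x = 0.
  rewrite -gradmx_poly; apply/matrixP => i j; rewrite gradmxE mxE.
  under eq_fun do rewrite h0 mxE.
  by rewrite derive_cst.
have gradc : Ck 0 U (gradmx f).
  apply: (Ck_ext oU _ (Ck_trmx oU (Ck_jacobian oU fk))) => x Ux.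
  exact: (esym (gradmx_jacobian (fk.1 x Ux))).
have [d2 d2_gt0 H2] := cts_ball (gradc 0 U0) ltr01.
pose K := `|gradmx f 0| + 1.
have K0 : 0 <= K by rewrite addr_ge0.
have bound x : `|x| < d2 -> `|gradmx f x - pjac h x| <= K * `|x| ^+ 0.
  move=> xd; rewrite jac0 subr0 expr0 mulr1.
  have := H2 x; rewrite subr0 => /(_ xd) H.
  have := ler_normD (gradmx f x - gradmx f 0) (gradmx f 0); rewrite subrK /K; lra.
(* For h = 0 the right side of this bound vanishes, which forces every covector to be 0. *)
have [d d0 H] := kuo_big K0 d2_gt0 C0 alpha0 delta0 bound kuo ltr01.
pose e : 'rV[R]_n := const_mx 1.
have ne : e != 0.
  by apply/eqP => /rowP/(_ (Ordinal n_gt0)); rewrite !mxE => /eqP; rewrite oner_eq0.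
have ee : 0 < enorm e by rewrite enorm_gt0.
pose x := (d / 2 / enorm e) *: e.
have c0 : 0 < d / 2 / enorm e by rewrite !divr_gt0.
have x0 : x != 0 by rewrite scaler_eq0 negb_or ne gt_eqF.
have xd : enorm x < d by rewrite enormZ gtr0_norm// divfK ?gt_eqF//; lra.
have := H x x0 xd; rewrite h0 enorm0 => /(_ _ (const_mx 1)).
rewrite mulr_ge0 ?exprn_ge0 ?enorm_ge0 ?(ltW w0)// => /(_ isT).
rewrite jac0 mulmx0 enorm0 mulr0 expr0 mul1r normr_le0 => /eqP/rowP/(_ (Ordinal p_gt0)).
by rewrite !mxE => /eqP; rewrite oner_eq0.
Qed.

End DegreeZero.

Theorem theorem3p4 (R : realType) (n p r : nat)
  (p_gt0 : (0 < p)%N) (le_pn : (p <= n)%N)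
  (f : 'rV[R]_n -> 'rV[R]_p) (f_germ : map_germ r.+1 f)
  (J : set R) (a b : R) (J_itv : J = `]a, b[%classic)
  (J01 : `[0, 1]%classic `<=` J)
  (g : 'rV[R]_n -> 'rV[R]_p) (g_germ : map_germ r.+1 g)
  (jet_gf : same_jet0 r g f)
  (kuo : forall h : 'I_p -> mpoly.mpoly n R,
    (forall i, (mpoly.msize (h i) <= r.+2)%N) ->
    same_jet0 r (poly_map h) f ->
    exists C alpha w delta : R,
      [/\ 0 < C, 0 < alpha, 0 < w, 0 < delta &
       forall x, horn r.+1 (poly_map h) w x -> enorm x < alpha ->
         C * enorm x `^ (r%:R - delta) <=
         kuo_dist (fun i => grad (fun y => f y 0 i) x)]) :
  exists2 U, nbhd_of_axis J U &
    c_regular_stratification r U (Sigma J (deformation f g) U).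
Proof.
have [f0 [Uf [oUf Uf0] fk]] := f_germ; have [g0 [Ug [oUg Ug0] gk]] := g_germ.
pose U0 := Uf `&` Ug.
have oU0 : open U0 by exact: openI.
have fk' : Ck r.+1 U0 f by apply: Ck_subset fk => x [].
have gk' : Ck r.+1 U0 g by apply: Ck_subset gk => x [].
have est := local_estimate oU0 (conj Uf0 Ug0) fk' gk' jet_gf kuo.
have oJ : open J by rewrite J_itv; exact: interval_open.
(* The tubes are built from maps of class at least C^2, so r = 0 is split off; there h = 0 is
   admissible because f 0 = 0. *)
case: r => [|k] in f_germ g_germ fk gk jet_gf kuo fk' gk' est *.
  exfalso; apply: (kuo_degree0 p_gt0 (leq_trans p_gt0 le_pn) oUf Uf0 fk).
  apply: kuo => [i|]; first by rewrite mpoly.msize0.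
  case=> // _; apply/rowP => i; rewrite /= !mxE mpoly.meval0 f0 mxE//.
exists (dom f g U0 J); first exact: (dom_nbhd oU0 (conj Uf0 Ug0) oJ est).
exact: (Sigma_c_regular oU0 (conj Uf0 Ug0) fk' gk' f0 g0 oJ le_pn est).
Qed.
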